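(* Let $\alpha\in(0,1)$ with $\alpha\ne1/n$ for all $n\in\mathbb N$, $N=\lfloor1/\alpha\rfloor$, $\mathbf X\in\mathscr C^\alpha$ and $\mathbf Z\in\mathscr D^\alpha_{\mathbf X}$. For a dissection $\pi=\{0=t_0<t_1<\dots<t_L<t_{L+1}=T\}$ of $[0,T]$ with mesh $\theta=\max_k|t_{k+1}-t_k|$, let $\tilde{\mathbf Z}=\tilde{\mathbf Z}^\pi$ be the path with $\tilde{\mathbf Z}_t=\tilde{\mathbf Z}^k_t$ for $t\in I_k=[t_k,t_{k+1}]$, where $\tilde{\mathbf Z}^k:I_k\to\mathrm{span}\,\mathcal F_{(N-1)}$ has components defined by decreasing recursion on $|h|$: for $|h|=N-1$, $$\tilde Z^{k,h}_t=Z^h_{t_k}+\tfrac{t-t_k}{t_{k+1}-t_k}(Z^h_{t_{k+1}}-Z^h_{t_k}),$$ and for $0\le|h|<N-1$, $$\tilde Z^{k,h}_t=\sum_{p}\int_{t_k}^t\tilde Z^{k,p^*\star h}_u\,d\mathbf X^p_u+Z^h_{t_k}+\tfrac{t-t_k}{t_{k+1}-t_k}\Big[Z^h_{t_{k+1}}-Z^h_{t_k}-\sum_p\int_{t_k}^{t_{k+1}}\tilde Z^{k,p^*\star h}_u\,d\mathbf X^p_u\Big],$$ the sums being over $p\in\mathcal P$ with $|p|\le N-|h|-1$. Then for every $0<\beta<\alpha$, $$|||\mathbf Z;\tilde{\mathbf Z}|||_\beta\to0\quad\text{as }\theta\to0.$$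
   Context: Forests. $A$ is a fixed finite nonempty set. $\mathcal F$ is the set of forests (commutative monomials of non-planar rooted trees with nodes labelled by $A$), including the empty forest $\mathbf 1$; $\mathcal H$ is the real vector space with basis $\mathcal F$, i.e. the polynomial algebra on trees. $|h|$ is the number of nodes of $h\in\mathcal F$; $\mathcal F_{(n)}=\{h\in\mathcal F:|h|\le n\}$. $[h]_a$ is the tree obtained by grafting the trees of $h$ on a new root labelled $a\in A$. The coproduct $\Delta$ is the algebra morphism with $\Delta[h]_a=(\mathrm{id}\otimes[\cdot]_a)\Delta h+[h]_a\otimes\mathbf 1$. On $\mathcal H^*$, $\langle\phi\star\psi,h\rangle=\langle\phi\otimes\psi,\Delta h\rangle$. A forest $h$ is identified with the functional $h'\mapsto\delta_{h,h'}$, so the span of forests is a subalgebra of $(\mathcal H^*,\star)$. Rough paths. $T>0$ is fixed. $\mathscr C^\alpha$ is the set of $\alpha$-branched rough paths: families $\mathbf X=(\mathbf X_{s,t})_{s,t\in[0,T]}$ of characters (unital multiplicative linear functionals) of $\mathcal H$ with $\mathbf X_{s,u}\star\mathbf X_{u,t}=\mathbf X_{s,t}$ and $\sup_{s\ne t}|\langle\mathbf X_{s,t},h\rangle|/|t-s|^{\alpha|h|}<\infty$ for all $h\in\mathcal F$. $\mathbf X^h_{s,t}=\langle\mathbf X_{s,t},h\rangle$ (extended linearly in $h$), $\|F\|_\gamma=\sup_{s\neq t}|F_{s,t}|/|t-s|^\gamma$. Controlled paths. For a path $\mathbf Z:[0,T]\to\mathrm{span}\,\mathcal F_{(N-1)}$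 put $Z^h_t=\langle h,\mathbf Z_t\rangle$ (extended linearly in $h$), $R^h_{s,t}=\langle h,\mathbf Z_t\rangle-\langle\mathbf X_{s,t}\star h,\mathbf Z_s\rangle$. $\mathscr D^\alpha_{\mathbf X}$ is the set of $\mathbf Z$ with $\|R^h\|_{(N-|h|)\alpha}<\infty$ for all $h\in\mathcal F_{(N-1)}$. For $\mathbf Z,\tilde{\mathbf Z}$ with remainders $R^h,\tilde R^h$ with respect to $\mathbf X$, $|||\mathbf Z;\tilde{\mathbf Z}|||_\beta=\sum_{h\in\mathcal F_{(N-1)}}(|\langle h,\mathbf Z_0-\tilde{\mathbf Z}_0\rangle|+\|R^h-\tilde R^h\|_{(N-|h|)\beta})$. Primitive basis and integrals. For forests, $h\top h'$ is $\frac1{|h'|}$ times the sum over nodes $v$ of $h'$ of the forest obtained by grafting all trees of $h$ at $v$ (bilinear extension). $\mathcal P$ is a basis of homogeneous elements of the primitive elements $\{h\in\bigoplus_{n\ge1}\mathcal H_n:\Delta h=h\otimes\mathbf 1+\mathbf 1\otimes h\}$. Then $\mathcal P^\top$, the set of $(\cdots(p_1\top p_2)\cdots)\top p_k$, $p_i\in\mathcal P$, $k\ge1$, together with $\mathbf 1$, is a basis of $\mathcal H$; $\rho^*$ denotes the dual basis element of $\rho\in\mathcal P^\top$ in the graded dual, i.e. in the span of forests. For $h$ of degree $<N-1$ and $p\in\mathcal P$, $|p|\le N-|h|-1$, the integral $\int_{t_k}^t\tilde Z^{k,p^*\star h}_u\,d\mathbf X^p_u$ is $\lim_{|\varpi|\to0}\sum_{[a,b]\in\varpi}\sum_{\rho\in\mathcal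 P^\top,|\rho|<N-|h|-|p|}\tilde Z^{k,\rho^*\star p^*\star h}_a\mathbf X^{\rho\top p}_{a,b}$ over partitions $\varpi$ of $[t_k,t]$ (the limit exists; $\mathbf 1\top p=p$). *)

(* Defs.v *)
From HB Require Import structures.
From mathcomp Require Import all_boot all_order all_algebra.
From mathcomp Require Import all_classical all_reals all_analysis.
From mathcomp Require Import finmap.
(* The notations of monalg clash with those of analysis. *)
From mathcomp Require Import -(notations) monalg.

Set Implicit Arguments.
Unset Strict Implicit.
Unset Printing Implicit Defensive.

Import Order.TTheory GRing.Theory Num.Theory.
Import numFieldNormedType.Exports.

Local Open Scope classical_set_scope.
Local Open Scope ring_scope.

(* Non-planar forests are encoded as planar ones (sequences of planar trees)
   that are sorted, recursively at every node, for a fixed total order on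
   planar trees. *)

Inductive ptree (A : Type) := PNode of A & seq (ptree A).

Section Trees.
Variable A : finType.
Implicit Types (t : ptree A) (c s : seq (ptree A)).

Lemma ptree_ind' (Q : ptree A -> Prop) :
  (forall a c, foldr (fun t acc => Q t /\ acc) True c -> Q (PNode a c)) ->
  forall t, Q t.
Proof.
move=> IH; fix F 1 => -[a c]; apply: IH.
by elim: c => [|t c IHc]; [|split; [exact: F|]].
Qed.

Fixpoint ptree_encode t : GenTree.tree A :=
  let: PNode a c := t in
  GenTree.Node 0 (GenTree.Leaf a :: map ptree_encode c).

Fixpoint ptree_decode (g : GenTree.tree A) : option (ptree A) :=
  if g is GenTree.Node _ (GenTree.Leaf a :: c)
  then Some (PNode a (pmap ptree_decode c)) else None.

Lemma ptree_encodeK : pcancel ptree_encode ptree_decode.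
Proof.
elim/ptree_ind' => a c /= IH; congr (Some (PNode a _)).
by elim: c IH => //= t c IHc [-> /IHc ->].
Qed.

HB.instance Definition _ := Countable.copy (ptree A) (pcan_type ptree_encodeK).

Definition ple : rel (ptree A) := fun t t' => (choice.pickle t <= choice.pickle t')%N.

Lemma ple_total : total ple.
Proof. by move=> t t'; exact: leq_total. Qed.

Lemma ple_trans : transitive ple.
Proof. by move=> t t' t''; exact: leq_trans. Qed.

Lemma ple_anti : antisymmetric ple.
Proof.
move=> t t'; rewrite /ple => /anti_leq e.
exact: (pcan_inj choice.pickleK).
Qed.

Fixpoint tnorm t : ptree A :=
  let: PNode a c := t in PNode a (sort ple (map tnorm c)).

Definition fnorm s : seq (ptree A) := sort ple (map tnorm s).

Lemma map_fixed (f : ptree A -> ptree A) s :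
  {in s, forall t, f t = t} -> map f s = s.
Proof. by move=> fs; rewrite -[RHS]map_id; exact/eq_in_map. Qed.

Lemma tnorm_idem t : tnorm (tnorm t) = tnorm t.
Proof.
elim/ptree_ind': t => a c IH /=; congr PNode.
rewrite map_fixed; first by rewrite (sorted_sort ple_trans)// (sort_sorted ple_total).
move=> t; rewrite mem_sort.
elim: c IH => //= u c IHc [uK /IHc {}IHc].
by rewrite inE => /orP[/eqP ->|/IHc].
Qed.

Lemma map_tnorm_fnorm s : map tnorm (fnorm s) = fnorm s.
Proof.
apply: map_fixed => t; rewrite mem_sort => /mapP[u _ ->].
exact: tnorm_idem.
Qed.

Lemma fnorm_idem s : fnorm (fnorm s) = fnorm s.
Proof.
rewrite {1}/fnorm map_tnorm_fnorm (sorted_sort ple_trans)//.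
exact: sort_sorted ple_total _.
Qed.

Lemma fnorm_perm s s' :
  perm_eq (map tnorm s) (map tnorm s') -> fnorm s = fnorm s'.
Proof. by move/(perm_sortP ple_total ple_trans ple_anti). Qed.

Record forest := Forest { fseq : seq (ptree A); _ : fnorm fseq == fseq }.

HB.instance Definition _ := [isSub for fseq].
HB.instance Definition _ := [Countable of forest by <:].

Implicit Types f g : forest.

Definition mkforest s : forest := Forest (introT eqP (fnorm_idem s)).

Definition fone : forest := mkforest [::].

Definition fmul f g : forest := mkforest (fseq f ++ fseq g).

(* The grafting operator [h]_a *)
Definition fgraft (a : A) f : forest := mkforest [:: PNode a (fseq f)].

Fixpoint tsize t : nat :=
  let: PNode _ c := t in (sumn (map tsize c)).+1.

Definition fsize f : nat := sumn (map tsize (fseq f)).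

Lemma fseqK f : fnorm (fseq f) = fseq f.
Proof. by case: f => s /= /eqP. Qed.

Lemma mkforest_perm s s' :
  perm_eq (map tnorm s) (map tnorm s') -> mkforest s = mkforest s'.
Proof. by move=> ss'; apply: val_inj => /=; exact: fnorm_perm. Qed.

Lemma perm_map_fnorm s : perm_eq (map tnorm (fnorm s)) (map tnorm s).
Proof. by rewrite map_tnorm_fnorm /fnorm perm_sort. Qed.

Lemma fmulA : associative fmul.
Proof.
move=> f g h; apply: mkforest_perm; rewrite !map_cat /=.
have gh := perm_map_fnorm (fseq g ++ fseq h).
have fg := perm_map_fnorm (fseq f ++ fseq g).
rewrite map_cat in gh; rewrite map_cat in fg.
apply: (@perm_trans _ (map tnorm (fseq f) ++ map tnorm (fseq g)
  ++ map tnorm (fseq h))); first by rewrite perm_cat2l.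
by rewrite catA perm_cat2r perm_sym.
Qed.

Lemma fmulC : commutative fmul.
Proof. by move=> f g; apply: mkforest_perm; rewrite !map_cat perm_catC. Qed.

Lemma fmul1f : left_id fone fmul.
Proof. by move=> f; apply: val_inj => /=; exact: fseqK. Qed.

Lemma fmulf1 : right_id fone fmul.
Proof. by move=> f; rewrite fmulC fmul1f. Qed.

Lemma fmul_unit f g : fmul f g = fone -> f = fone /\ g = fone.
Proof.
move/(congr1 (fun h => size (fseq h))); rewrite /= !size_sort !size_map size_cat /=.
by move=> /eqP; rewrite addn_eq0 => /andP[/nilP f0 /nilP g0]; split;
  apply: val_inj; rewrite /= ?f0 ?g0.
Qed.

(* With this instance, malg (forest A) R is the commutative ring H. *)
HB.instance Definition _ :=
  Choice_isMonomialDef.Build forest fmulA fmul1f fmulf1 fmul_unit.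
HB.instance Definition _ := MonomialDef_isConomialDef.Build forest fmulC.

(* The coproduct of a planar tree or forest, as the list of its terms; each
   term is a pair of planar forests. *)
Fixpoint tcop t : seq (seq (ptree A) * seq (ptree A)) :=
  let: PNode a c := t in
  rcons [seq (u.1, [:: PNode a u.2]) |
           u <- (fix fcop c := if c is t' :: c' then
                   [seq (u.1 ++ v.1, u.2 ++ v.2) | u <- tcop t', v <- fcop c']
                 else [:: ([::], [::])]) c]
        ([:: PNode a c], [::]).

Fixpoint scop s : seq (seq (ptree A) * seq (ptree A)) :=
  if s is t :: s' then
    [seq (u.1 ++ v.1, u.2 ++ v.2) | u <- tcop t, v <- scop s']
  else [:: ([::], [::])].

Definition cop f : seq (forest * forest) :=
  [seq (mkforest u.1, mkforest u.2) | u <- scop (fseq f)].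

Lemma tcopE a c : tcop (PNode a c) =
  rcons [seq (u.1, [:: PNode a u.2]) | u <- scop c] ([:: PNode a c], [::]).
Proof. by []. Qed.

Lemma map_tnorm_fseq f : map tnorm (fseq f) = fseq f.
Proof. by rewrite -[in LHS]fseqK map_tnorm_fnorm fseqK. Qed.

Lemma fseq_fgraft a f : fseq (fgraft a f) = [:: PNode a (fseq f)].
Proof.
by rewrite /= /fnorm /= map_tnorm_fseq -{1}(map_tnorm_fseq f) -/(fnorm _) fseqK. Qed.

Lemma mkforest_fgraft a s : mkforest [:: PNode a s] = fgraft a (mkforest s).
Proof. by apply: val_inj => /=; rewrite /fnorm /= -/(fnorm _) -/(fnorm _) fnorm_idem. Qed.

Lemma scop1 t : scop [:: t] = tcop t.
Proof. by rewrite /=; elim: (tcop t) => //= -[u1 u2] w ->; rewrite !cats0. Qed.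

Lemma cop_fgraft a f :
  cop (fgraft a f) =
    rcons [seq (u.1, fgraft a u.2) | u <- cop f] (fgraft a f, fone).
Proof.
rewrite /cop fseq_fgraft scop1 tcopE map_rcons -!map_comp; congr rcons.
by apply: eq_map => u /=; rewrite mkforest_fgraft.
Qed.

(* The results of grafting all the trees of s at a node of t (resp. of a
   planar forest), as a list with one item per node. *)
Fixpoint tgrafts s t : seq (ptree A) :=
  let: PNode a c := t in
  PNode a (s ++ c)
    :: [seq PNode a c' |
          c' <- (fix fgrafts c := if c is t' :: c' then
                   [seq u :: c' | u <- tgrafts s t']
                     ++ [seq t' :: v | v <- fgrafts c']
                 else [::]) c].

Definition sgrafts s : seq (ptree A) -> seq (seq (ptree A)) :=
  fix fgrafts c := if c is t' :: c' then
      [seq u :: c' | u <- tgrafts s t'] ++ [seq t' :: v | v <- fgrafts c']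
    else [::].

Lemma tgraftsE s a c : tgrafts s (PNode a c) =
  PNode a (s ++ c) :: [seq PNode a c' | c' <- sgrafts s c].
Proof. by []. Qed.

Definition grafts f g : seq forest :=
  [seq mkforest s | s <- sgrafts (fseq f) (fseq g)].

End Trees.

(* Elements of H, and of its graded dual (the span of forests in H^* ), are
   finitely supported functions malg (forest A) R; elements of the full dual
   H^* are functions forest A -> R, given by their values on the basis. *)
Section HopfAlgebra.
Variables (R : realType) (A : finType).
Local Notation H := (malg (forest A) R).

Definition fbasis (h : forest A) : H := mkmalgU h 1.

Definition fdual (x : H) : forest A -> R := fun h => mcoeff h x.

Definition delta (h : forest A) : forest A -> R := fdual (fbasis h).

Definition fpair (phi : forest A -> R) (x : H) : R :=
  \sum_(h <- msupp x) mcoeff h x * phi h.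

Definition star (phi psi : forest A -> R) : forest A -> R :=
  fun h => \sum_(u <- cop h) phi u.1 * psi u.2.

(* H (x) H has basis forest * forest. *)
Definition coproduct (x : H) : malg (forest A * forest A)%type R :=
  \sum_(h <- msupp x) \sum_(u <- cop h) mkmalgU u (mcoeff h x).

Definition tensor (x y : H) : malg (forest A * forest A)%type R :=
  \sum_(h <- msupp x) \sum_(k <- msupp y)
    mkmalgU (h, k) (mcoeff h x * mcoeff k y).

(* Normalised natural growth, extended bilinearly; for k = fone there are no
   grafts, so that the term vanishes although (fsize k)%:R is not invertible. *)
Definition ntop (x y : H) : H :=
  \sum_(h <- msupp x) \sum_(k <- msupp y)
    (mcoeff h x * mcoeff k y / (fsize k)%:R) *:
      \sum_(g <- grafts h k) fbasis g.

Definition homogeneous (x : H) : Prop :=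
  exists n, forall h, h \in msupp x -> fsize h = n.

(* This is the degree |x| when x is homogeneous and nonzero. *)
Definition deg (x : H) : nat := (\max_(h <- msupp x) fsize h)%N.

Definition primitive (x : H) : Prop :=
  mcoeff (fone A) x = 0 /\ coproduct x = tensor x 1 + tensor 1 x.

Definition lin_indep (B : set H) : Prop :=
  forall (s : seq H) (c : H -> R), uniq s -> (forall x, x \in s -> B x) ->
    \sum_(x <- s) c x *: x = 0 -> forall x, x \in s -> c x = 0.

Definition spans (B V : set H) : Prop :=
  forall y, V y -> exists (s : seq H) (c : H -> R),
    (forall x, x \in s -> B x) /\ y = \sum_(x <- s) c x *: x.

Definition primitive_basis (P : set H) : Prop :=
  [/\ forall p, P p -> primitive p /\ homogeneous p,
      lin_indep P & spans P [set x | primitive x]].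

Inductive Ptop (P : set H) : H -> Prop :=
| Ptop_one p : P p -> Ptop P p
| Ptop_top r p : Ptop P r -> P p -> Ptop P (ntop r p).

Definition Ptop1 (P : set H) : set H := [set x | x = 1 \/ Ptop P x].

(* The element r^* of the basis dual to Ptop1 P *)
Definition dual (P : set H) (r : H) : H :=
  xget 0 [set g | forall s, Ptop1 P s -> fpair (fdual g) s = (s == r)%:R].

End HopfAlgebra.

Section RoughPaths.
Variables (R : realType) (A : finType).
Local Notation H := (malg (forest A) R).

Definition holder (T gamma : R) (F : R -> R -> R) : \bar R :=
  ereal_sup [set e | exists s t, [/\ 0 <= s <= T, 0 <= t <= T, s != t &
    e = (`|F s t| / `|t - s| `^ gamma)%:E]].

Definition rough_path (T alpha : R) (X : R -> R -> forest A -> R) : Prop :=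
  [/\ forall s t, 0 <= s <= T -> 0 <= t <= T -> mmorphism (X s t),
      forall s u t, 0 <= s <= T -> 0 <= u <= T -> 0 <= t <= T ->
        star (X s u) (X u t) =1 X s t &
      forall h, (holder T (alpha * (fsize h)%:R) (fun s t => X s t h) < +oo)%E].

Definition remainder (X : R -> R -> forest A -> R) (Z : R -> H)
    (h : forest A) (s t : R) : R :=
  fpair (delta R h) (Z t) - fpair (star (X s t) (delta R h)) (Z s).

Definition controlled_path (T alpha : R) (N : nat)
    (X : R -> R -> forest A -> R) (Z : R -> H) : Prop :=
  (forall t h, 0 <= t <= T -> h \in msupp (Z t) -> (fsize h <= N.-1)%N) /\
  (forall h, (fsize h <= N.-1)%N ->
    (holder T ((N - fsize h)%N%:R * alpha) (remainder X Z h) < +oo)%E).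

Definition ctrl_dist (T beta : R) (N : nat) (X : R -> R -> forest A -> R)
    (Z Z' : R -> H) : \bar R :=
  (\sum_(h \in [set h : forest A | (fsize h <= N.-1)%N])
     ((`|fpair (delta R h) (Z 0 - Z' 0)|)%R%:E +
      holder T ((N - fsize h)%N%:R * beta)%R
        (fun s t => remainder X Z h s t - remainder X Z' h s t)%R))%E.

(* A partition of `[a, b] is given, as in itv_partition, by the sequence s of
   its points other than a. *)
Definition pieces (a : R) (s : seq R) : seq (R * R) := zip (a :: s) s.

Definition mesh (a : R) (s : seq R) : R :=
  \big[Num.max/0]_(I <- pieces a s) (I.2 - I.1).

Definition mesh_to0 (a b : R) : set_system (seq R) :=
  [set Q | exists2 d : R, 0 < d &
    forall s, itv_partition a b s -> mesh a s < d -> Q s].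

Section Interpolation.
Variables (P : set H) (N : nat) (X : R -> R -> forest A -> R) (Z : R -> H).

Definition rough_int (Y : R -> H) (h : forest A) (p : H) (a t : R) : R :=
  lim ((fun s : seq R => \sum_(I <- pieces a s)
          \sum_(r \in [set r | Ptop1 P r /\ (deg r + fsize h + deg p < N)%N])
            fpair (star (fdual (dual P r))
                        (star (fdual (dual P p)) (delta R h))) (Y I.1) *
            fpair (X I.1 I.2) (ntop r p))
       @ mesh_to0 a t).

Definition sum_int (Y : R -> H) (h : forest A) (a t : R) : R :=
  \sum_(p \in [set p | P p /\ (deg p + fsize h <= N.-1)%N])
    rough_int Y h p a t.

(* The components of degree >= N - 1 - m of the interpolation on `[a, b]; the
   integrands of the components of degree d only involve components of
   degree > d. *)
Fixpoint interp_upto (m : nat) (a b : R) : R -> H :=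
  match m with
  | 0 => fun t =>
      let z h u := fpair (delta R h) (Z u) in
      \sum_(h \in [set h : forest A | fsize h = N.-1])
        (z h a + (t - a) / (b - a) * (z h b - z h a)) *: fbasis R h
  | m'.+1 => fun t =>
      let Y := interp_upto m' a b in
      let z h u := fpair (delta R h) (Z u) in
      Y t +
      \sum_(h \in [set h : forest A | fsize h = (N.-1 - m'.+1)%N])
        (sum_int Y h a t + z h a +
         (t - a) / (b - a) * (z h b - z h a - sum_int Y h a b)) *: fbasis R h
  end.

(* The first piece [t_k, t_(k+1)] of the dissection pi containing t is used;
   the two interpolations agree at a common end point. *)
Definition interpolation (pi : seq R) (t : R) : H :=
  let k := find (fun x => t <= x) pi in
  interp_upto N.-1 (nth 0 (0 :: pi) k) (nth 0 (0 :: pi) k.+1) t.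

End Interpolation.
End RoughPaths.

(* Main.v *)
(* Natural growth on a primitive element is a 1-cocycle for the coproduct, so
   comparing first tensor factors of maximal degree shows that every element of
   the augmentation ideal is uniquely a sum of terms x top p with p in P.  Hence
   P^top with 1 is a basis, and, <., .> being the pairing and * the product of
   functionals,
     \sum_r phi(r) r^* = phi,   \sum_p (phi o (- top p)) * p^* = phi - phi(1) 1^*
   on elements of bounded degree.

   Write v(d) = d^alpha, and let [a, b] be a piece of the dissection, of length l.
   Both Z and its interpolation Y agree at a and b, and by decreasing induction
   on |h| the remainder of Y satisfies
     |R^h_(s,t)| <= C (t - s) / l v(l)^(N - |h|)   for a <= s <= t <= b.
   Indeed, the germ of the p-th integral has the increment
     - \sum_r <X_(u,t), r top p> R^(r^* * p^* * h)_(s,u),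
   which is of order (t - s)^(1 + alpha), so that the integrals exist by sewing,
   and the germs sum up to <X_(s,t) * h, Y_s>.  As N alpha <= 1, this gives
   |R^h_(s,t)| <= C v(t - s)^(N - |h|) on each piece, hence on [0, T], since
     R^h_(s,t) = R^h_(u,t) + \sum_k <X_(u,t) * h, k> R^k_(s,u).
   So the difference of the remainders of Z and of the interpolation is bounded
   by C v(|t - s|)^(N - |h|), and also by C v(theta), because the two paths agree
   at the points of the dissection.  Interpolating between the two bounds yields
   a distance of at most C theta^(alpha - beta). *)
From HB Require Import structures.
Require Import Defs.
From mathcomp Require Import all_boot all_order all_algebra.
From mathcomp Require Import all_classical all_reals all_analysis.
From mathcomp Require Import finmap ring lra zify.
From mathcomp Require Import -(notations) monalg.
Import Order.TTheory GRing.Theory Num.Theory.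
Import numFieldNormedType.Exports.

Set Implicit Arguments.
Unset Strict Implicit.
Unset Printing Implicit Defensive.

Local Open Scope classical_set_scope.
Local Open Scope ring_scope.

(** * Forests, coproduct and natural growth *)

(** The usual estimate [(t - s)^((N - |k|) alpha)] of the remainders would only give germ increments
    of order [(t - s)^((N - |h|) alpha)], an exponent at most 1, out of reach of sewing. This is why
    the induction on a piece carries a bound that is linear in [t - s] and pays for it with the
    length [l] of the piece: the remainder then supplies exponent 1, and one factor [v] of the rough
    path supplies the missing [alpha]. The second concern is uniformity in the dissection. Constants
    are fixed before the piece is, and two times in distant pieces are joined through the dissection
    points next to them, between which the remainder is that of Z; the number of pieces in between
    never enters. The algebra is forced by the definitions: dual elements are obtained by choice
    with a default value, and sums over P and P^top mean something only for finite index sets, so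
    existence of the former and finiteness of the latter have to be proved. *)

Section ForestCombinatorics.
Variable A : finType.
Implicit Types (t : ptree A) (c s : seq (ptree A)) (f g h k : forest A).

Lemma mkforestK f : mkforest (fseq f) = f.
Proof. by apply: val_inj => /=; exact: fseqK. Qed.

Lemma mkforest_cat s c : mkforest (s ++ c) = fmul (mkforest s) (mkforest c).
Proof.
apply: mkforest_perm; rewrite /= !map_cat /=.
by rewrite perm_sym; apply: perm_cat; exact: perm_map_fnorm.
Qed.

Lemma forest_ind (Q : forest A -> Prop) :
    Q (fone A) -> (forall a f, Q f -> Q (fgraft a f)) ->
    (forall f g, Q f -> Q g -> Q (fmul f g)) ->
  forall f, Q f.
Proof.
move=> Q1 Qg Qm f; rewrite -(mkforestK f).
have Qt t : Q (mkforest [:: t]).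
  elim/ptree_ind': t => a c IH; rewrite mkforest_fgraft; apply: Qg.
  elim: c IH => [//|t c IHc [Qt /IHc Qc]].
  by rewrite -cat1s mkforest_cat; exact: Qm.
by elim: (fseq f) => // t s IHs; rewrite -cat1s mkforest_cat; exact: Qm.
Qed.

Lemma tsize_tnorm t : Defs.tsize (tnorm t) = Defs.tsize t.
Proof.
elim/ptree_ind': t => a c /= IH; congr _.+1.
have /perm_sumn -> : perm_eq (map (@Defs.tsize A) (sort (@ple A) (map (@tnorm A) c)))
    (map (@Defs.tsize A) (map (@tnorm A) c)) by apply: perm_map; rewrite perm_sort.
by elim: c IH => //= t c IHc [-> /IHc ->].
Qed.

Lemma fsize_mkforest s : fsize (mkforest s) = sumn (map (@Defs.tsize A) s).
Proof.
rewrite /fsize /= /fnorm.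
have /perm_sumn -> : perm_eq (map (@Defs.tsize A) (sort (@ple A) (map (@tnorm A) s)))
    (map (@Defs.tsize A) (map (@tnorm A) s)) by apply: perm_map; rewrite perm_sort.
by rewrite -map_comp (eq_map (g := @Defs.tsize A))// => t /=; exact: tsize_tnorm.
Qed.

Lemma fsize1 : fsize (fone A) = 0%N.
Proof. by rewrite fsize_mkforest. Qed.

Lemma fsizeM f g : fsize (fmul f g) = (fsize f + fsize g)%N.
Proof. by rewrite fsize_mkforest map_cat sumn_cat. Qed.

Lemma fsize_graft a f : fsize (fgraft a f) = (fsize f).+1.
Proof. by rewrite fsize_mkforest /= addn0. Qed.

Lemma fsize_eq0 f : (fsize f == 0%N) = (f == fone A).
Proof.
apply/eqP/eqP => [|->]; last exact: fsize1.
rewrite -{2}(mkforestK f) /fsize; case: (fseq f) => [//|[a c] s] /=.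
by rewrite addSn.
Qed.

Section Sums.
Variable V : nmodType.

(** Lists of terms matter only up to permutation, so identities between them are stated as
    equalities of sums of an arbitrary [F] with values in a commutative monoid. Here the terms come
    from any planar list, sorted or not. *)
Let S (F : forest A -> forest A -> V) s :=
  \sum_(u <- scop s) F (mkforest u.1) (mkforest u.2).

Let scop_cons F t s : S F (t :: s) =
  \sum_(u <- tcop t) S (fun x y => F (fmul (mkforest u.1) x) (fmul (mkforest u.2) y)) s.
Proof.
rewrite /S /= big_allpairs_dep; apply: eq_bigr => u _.
by apply: eq_bigr => v _ /=; rewrite !mkforest_cat.
Qed.

Let scop_cat F s s' : S F (s ++ s') =
  \sum_(u <- scop s) S (fun x y => F (fmul (mkforest u.1) x) (fmul (mkforest u.2) y)) s'.
Proof.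
elim: s F => [|t s IHs] F.
  by rewrite /= big_seq1; apply: eq_bigr => u _; rewrite !fmul1f.
rewrite cat_cons scop_cons /= big_allpairs_dep; apply: eq_bigr => u _.
rewrite IHs; apply: eq_bigr => v _ /=; apply: eq_bigr => w _.
by rewrite !mkforest_cat !fmulA.
Qed.

Let scop_perm F s s' : perm_eq s s' -> S F s = S F s'.
Proof.
move=> ss'; move: s s' ss' (erefl (S F s)) => s s' ss'; rewrite {2}/S -/(S F s).
(* It suffices to exchange two leading blocks, where exchanging sums and commutativity of [fmul]
   apply. *)
apply: (@catCA_perm_ind _ (fun s' => S F s = S F s') _ s s' ss') => s1 s2 s3 ->.
rewrite scop_cat [RHS]scop_cat.
under eq_bigr do rewrite scop_cat.
under [RHS]eq_bigr do rewrite scop_cat.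
rewrite exchange_big; apply: eq_bigr => u _; apply: eq_bigr => v _.
apply: eq_bigr => w _; congr F.
  by rewrite !fmulA (fmulC (mkforest u.1)).
by rewrite !fmulA (fmulC (mkforest u.2)).
Qed.

Let scop_map s : 
  foldr (fun t acc => (forall F, S F [:: tnorm t] = S F [:: t]) /\ acc) True s ->
  forall F, S F (map (@tnorm A) s) = S F s.
Proof.
elim: s => //= t s IHs [IHt /IHs IH] F.
rewrite -cat1s scop_cat -[t :: s]cat1s scop_cat.
under eq_bigr do rewrite IH.
exact: (IHt (fun x y => S (fun x' y' => F (fmul x x') (fmul y y')) s)).
Qed.

Let scop_fnorm1 s :
  foldr (fun t acc => (forall F, S F [:: tnorm t] = S F [:: t]) /\ acc) True s ->
  forall F, S F (fnorm s) = S F s.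
Proof.
move=> /scop_map IH F; rewrite -IH; apply: scop_perm.
by rewrite /fnorm perm_sort.
Qed.

Let scop_node F a s : S F [:: PNode a s] =
  S (fun x y => F x (fgraft a y)) s + F (fgraft a (mkforest s)) (fone A).
Proof.
rewrite /S scop1 tcopE -cats1 big_cat big_seq1 /= big_map mkforest_fgraft.
by congr (_ + _); apply: eq_bigr => u _ /=; rewrite mkforest_fgraft.
Qed.

Let scop_tnorm t F : S F [:: tnorm t] = S F [:: t].
Proof.
elim/ptree_ind': t F => a c /scop_fnorm1 IH F.
rewrite /= -/(fnorm c) !scop_node IH; congr (_ + F (fgraft a _) _).
by apply: val_inj => /=; exact: fnorm_idem.
Qed.

(** [fmul] is [mkforest] of an unsorted concatenation, so multiplicativity of the coproduct requires
    computing it on any planar representative. *)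
Lemma cop_mkforest (F : forest A * forest A -> V) s :
  \sum_(u <- cop (mkforest s)) F u =
  \sum_(u <- scop s) F (mkforest u.1, mkforest u.2).
Proof.
rewrite big_map /= -[LHS]/(S (fun x y => F (x, y)) _) scop_fnorm1//.
by elim: s => //= t s IHs; split=> // F'; exact: scop_tnorm.
Qed.

Lemma cop_fone (F : forest A * forest A -> V) :
  \sum_(u <- cop (fone A)) F u = F (fone A, fone A).
Proof. by rewrite cop_mkforest big_seq1. Qed.

Lemma cop_fmul (F : forest A * forest A -> V) f g :
  \sum_(u <- cop (fmul f g)) F u =
  \sum_(u <- cop f) \sum_(v <- cop g) F (fmul u.1 v.1, fmul u.2 v.2).
Proof.
rewrite cop_mkforest -[LHS]/(S (fun x y => F (x, y)) _) scop_cat big_map.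
by apply: eq_bigr => u _; rewrite big_map.
Qed.

Lemma cop_graft (F : forest A * forest A -> V) a f :
  \sum_(u <- cop (fgraft a f)) F u =
  \sum_(u <- cop f) F (u.1, fgraft a u.2) + F (fgraft a f, fone A).
Proof. by rewrite cop_fgraft -cats1 big_cat big_seq1 big_map. Qed.

(** For a tree, the terms whose last factor is [fone] agree on both sides, and the others are the
    induction hypothesis below the root. *)
Lemma coassoc (F : forest A -> forest A -> forest A -> V) h :
  \sum_(u <- cop h) \sum_(v <- cop u.1) F v.1 v.2 u.2 =
  \sum_(u <- cop h) \sum_(v <- cop u.2) F u.1 v.1 v.2.
Proof.
elim/forest_ind: h F => [|a f IH|f g IHf IHg] F.
- by rewrite !cop_fone.
- rewrite !cop_graft cop_fone /= (IH (fun x y z => F x y (fgraft a z))) addrA.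
  congr (_ + _); rewrite -big_split /=; apply: eq_bigr => u _.
  by rewrite cop_graft.
- rewrite !cop_fmul /=.
  transitivity (\sum_(u <- cop f) \sum_(w <- cop u.1) \sum_(v <- cop g)
      \sum_(z <- cop v.2) F (fmul w.1 v.1) (fmul w.2 z.1) (fmul u.2 z.2)).
    apply: eq_bigr => u _; rewrite [RHS]exchange_big /=.
    under eq_bigr do rewrite cop_fmul.
    rewrite exchange_big /= [RHS]exchange_big; apply: eq_bigr => w _ /=.
    exact: (IHg (fun x y z => F (fmul w.1 x) (fmul w.2 y) (fmul u.2 z))).
  rewrite (IHf (fun x y z => \sum_(v <- cop g) \sum_(w <- cop v.2)
    F (fmul x v.1) (fmul y w.1) (fmul z w.2))).
  apply: eq_bigr => u _; rewrite exchange_big; apply: eq_bigr => v _ /=.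
  by rewrite cop_fmul.
Qed.

(** * Grafting at the nodes of a forest *)

Let G s (F : forest A -> V) c := \sum_(x <- sgrafts s c) F (mkforest x).

Let sgrafts_cons s F t c : G s F (t :: c) =
  \sum_(x <- tgrafts s t) F (fmul (mkforest [:: x]) (mkforest c)) +
  G s (fun x => F (fmul (mkforest [:: t]) x)) c.
Proof.
rewrite /G /= big_cat !big_map; congr (_ + _); apply: eq_bigr => x _.
  by rewrite -mkforest_cat.
by rewrite -mkforest_cat.
Qed.

Let sgrafts_cat s F c c' : G s F (c ++ c') =
  G s (fun x => F (fmul x (mkforest c'))) c +
  G s (fun x => F (fmul (mkforest c) x)) c'.
Proof.
elim: c F => [|t c IHc] F.
  rewrite /= /G big_nil add0r; apply: eq_bigr => x _.
  by rewrite fmul1f.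
rewrite cat_cons !sgrafts_cons IHc -!addrA mkforest_cat; congr (_ + _).
  by apply: eq_bigr => x _; rewrite fmulA.
congr (_ + _); apply: eq_bigr => x _; first by rewrite fmulA.
by rewrite -[t :: c]cat1s mkforest_cat fmulA.
Qed.

Let sgrafts_perm s F c c' : perm_eq c c' -> G s F c = G s F c'.
Proof.
move=> cc'; move: c c' cc' (erefl (G s F c)) => c c' cc'; rewrite {2}/G -/(G s F c).
apply: (@catCA_perm_ind _ (fun c' => G s F c = G s F c') _ c c' cc') => s1 s2 s3 ->.
rewrite !sgrafts_cat mkforest_cat addrCA; congr (_ + (_ + _)).
- by apply: eq_bigr => x _; rewrite mkforest_cat !fmulA (fmulC (mkforest s1)).
- by apply: eq_bigr => x _; rewrite !fmulA (fmulC (mkforest x)).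
- by apply: eq_bigr => x _; rewrite !fmulA (fmulC (mkforest s1)).
Qed.

Let sgrafts_fnorm1 s c :
  foldr (fun t acc => (forall F, G s F [:: tnorm t] = G s F [:: t]) /\ acc) True c ->
  forall F, G s F (fnorm c) = G s F c.
Proof.
move=> IH F; transitivity (G s F (map (@tnorm A) c)).
  by apply: sgrafts_perm; rewrite /fnorm perm_sort.
elim: c IH F => //= t c IHc [IHt /IHc IH] F.
rewrite -cat1s sgrafts_cat -[t :: c]cat1s sgrafts_cat IHt IH.
have mkn (u : seq (ptree A)) : mkforest (map (@tnorm A) u) = mkforest u.
  apply: mkforest_perm; rewrite -map_comp.
  by rewrite (eq_map (g := @tnorm A))// => x /=; exact: tnorm_idem.
rewrite mkn; congr (_ + _); apply: eq_bigr => x _.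
by rewrite -[[:: tnorm t]]/(map (@tnorm A) [:: t]) mkn.
Qed.

Let sgrafts_node s F a c : G s F [:: PNode a c] =
  F (fgraft a (fmul (mkforest s) (mkforest c))) + G s (fun x => F (fgraft a x)) c.
Proof.
have E t : sgrafts s [:: t] = [seq [:: u] | u <- tgrafts s t] by rewrite /= cats0.
rewrite /G E big_map tgraftsE big_cons big_map.
rewrite mkforest_fgraft mkforest_cat; congr (_ + _).
by apply: eq_bigr => x _; rewrite mkforest_fgraft.
Qed.

Let sgrafts_tnorm s t F : G s F [:: tnorm t] = G s F [:: t].
Proof.
elim/ptree_ind': t F => a c /sgrafts_fnorm1 IH F.
rewrite /= -/(fnorm c) !sgrafts_node IH; congr (F (fgraft a (fmul _ _)) + _).
by apply: val_inj => /=; exact: fnorm_idem.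
Qed.

Let grafts_mkforest (F : forest A -> V) f c :
  \sum_(x <- grafts f (mkforest c)) F x = G (fseq f) F c.
Proof.
rewrite big_map /= -[LHS]/(G _ F _) sgrafts_fnorm1//.
by elim: c => //= t c IHc; split=> // F'; exact: sgrafts_tnorm.
Qed.

Lemma grafts_fone (F : forest A -> V) f : \sum_(x <- grafts f (fone A)) F x = 0.
Proof. by rewrite grafts_mkforest /G big_nil. Qed.

Lemma grafts_fmul (F : forest A -> V) f g k :
  \sum_(x <- grafts f (fmul g k)) F x =
  \sum_(x <- grafts f g) F (fmul x k) + \sum_(x <- grafts f k) F (fmul g x).
Proof.
rewrite grafts_mkforest sgrafts_cat !mkforestK.
by rewrite -(mkforestK g) -(mkforestK k) !grafts_mkforest !mkforestK.
Qed.

Lemma grafts_graft (F : forest A -> V) f a k :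
  \sum_(x <- grafts f (fgraft a k)) F x =
  F (fgraft a (fmul f k)) + \sum_(x <- grafts f k) F (fgraft a x).
Proof.
by rewrite -{1}(mkforestK k) -mkforest_fgraft grafts_mkforest sgrafts_node big_map !mkforestK.
Qed.

(* Cutting a forest obtained by grafting f at a node of g: either the node is cut
   off, together with f, or it stays in the trunk and f is cut as well. *)
Lemma cop_grafts (F : forest A * forest A -> V) f g :
  \sum_(h <- grafts f g) \sum_(w <- cop h) F w =
  \sum_(u <- cop g) \sum_(h <- grafts f u.1) F (h, u.2) +
  \sum_(u <- cop g) \sum_(v <- cop f) \sum_(h <- grafts v.2 u.2)
    F (fmul v.1 u.1, h).
Proof.
elim/forest_ind: g F => [|a k IH|g k IHg IHk] F.
- rewrite grafts_fone !cop_fone /= grafts_fone add0r big1// => v _.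
  by rewrite grafts_fone.
- rewrite grafts_graft !cop_graft /=.
  rewrite [X in _ = _ + (_ + X)]big1 ?addr0; last by move=> v _; rewrite grafts_fone.
  rewrite grafts_graft cop_fmul /=.
  under [X in _ + X = _]eq_bigr do rewrite cop_graft.
  rewrite big_split /= (IH (fun w => F (w.1, fgraft a w.2))) /=.
  under [X in _ = _ + X]eq_bigr do under eq_bigr do rewrite grafts_graft.
  under [X in _ = _ + X]eq_bigr do rewrite big_split /=.
  rewrite big_split /= [X in X + _ + _ = _]exchange_big /=.
  set a1 := \sum_(j <- _) _; set a2 := F _.
  set a3 := \sum_(j <- _) _; set a4 := \sum_(j <- _) _; set a5 := \sum_(j <- _) _.
  by rewrite [LHS](AC (2*(2*1)) ((3*(2*5))*(1*4))).
- rewrite grafts_fmul !cop_fmul.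
  under eq_bigr do rewrite cop_fmul.
  under [X in _ + X = _]eq_bigr do rewrite cop_fmul.
  rewrite (IHg (fun w => \sum_(v <- cop k) F (fmul w.1 v.1, fmul w.2 v.2))).
  rewrite [X in _ + X = _]exchange_big /=.
  under [X in _ + X = _]eq_bigr => u _ do
    rewrite (IHk (fun w => F (fmul u.1 w.1, fmul u.2 w.2))) /=.
  rewrite [X in _ + X = _]big_split /=.
  rewrite addrACA; congr (_ + _).
    rewrite -big_split; apply: eq_bigr => u _ /=.
    rewrite exchange_big -big_split; apply: eq_bigr => v _ /=.
    by rewrite grafts_fmul.
  rewrite -big_split; apply: eq_bigr => u _ /=.
  under [X in X + _]eq_bigr do rewrite exchange_big /=.
  rewrite exchange_big -big_split; apply: eq_bigr => v _ /=.
  rewrite -big_split; apply: eq_bigr => w _ /=.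
  rewrite grafts_fmul; congr (_ + _); apply: eq_bigr => x _.
    by rewrite !fmulA.
  by rewrite !fmulA (fmulC u.1).
Qed.

Lemma grafts_cop_fone (F : forest A -> V) g :
  \sum_(x <- grafts (fone A) g) F x = F g *+ fsize g.
Proof.
elim/forest_ind: g F => [|a k IH|g k IHg IHk] F.
- by rewrite grafts_fone fsize1.
- by rewrite grafts_graft fmul1f (IH (fun x => F (fgraft a x))) fsize_graft mulrS.
- rewrite grafts_fmul (IHg (fun x => F (fmul x k))).
  by rewrite (IHk (fun x => F (fmul g x))) fsizeM mulrnDr.
Qed.

End Sums.

(** Counting the violations of [Q] by a sum in [nat] makes the rules for coproducts of grafts and
    products applicable to statements about all terms. *)
Lemma sum_cop_all (Q : pred (forest A * forest A)) h :
  all Q (cop h) <-> (\sum_(u <- cop h) ~~ Q u = 0)%N.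
Proof.
split=> [/allP H|]; first by rewrite big_seq big1// => u /H ->.
move=> /eqP; rewrite sum_nat_seq_eq0 => /allP H; apply/allP => u /H /=.
by rewrite eqb0 negbK.
Qed.

Lemma fsize_cop h u : u \in cop h -> (fsize u.1 + fsize u.2 = fsize h)%N.
Proof.
suff /allP H : all (fun v => fsize v.1 + fsize v.2 == fsize h)%N (cop h).
  by move=> /H /eqP.
elim/forest_ind: h => [|a f /allP IH|f g /allP IHf /allP IHg]; apply/sum_cop_all.
- by rewrite cop_fone fsize1.
- rewrite cop_graft /= fsize1 addn0 eqxx addr0 big_seq big1// => v /IH/eqP.
  by rewrite !fsize_graft addnS => ->; rewrite eqxx.
- rewrite cop_fmul big_seq big1// => v /IHf/eqP vf.
  rewrite big_seq big1// => w /IHg/eqP wg /=.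
  by rewrite !fsizeM addnACA vf wg eqxx.
Qed.

Lemma cop_fone_snd (V : nmodType) (F : forest A * forest A -> V) h :
  \sum_(u <- cop h | u.2 == fone A) F u = F (h, fone A).
Proof.
rewrite big_mkcond; elim/forest_ind: h F => [|a f IH|f g IHf IHg] F.
- by rewrite cop_fone; case: eqP.
- rewrite cop_graft; cbv beta; case: eqP => // _; by rewrite big1 ?add0r.
- rewrite cop_fmul -(IHf (fun u => F (fmul u.1 g, u.2))); apply: eq_bigr => u _ /=.
  case: eqP => [u1|/eqP un1]; last first.
    rewrite big1// => v _ /=; rewrite -fsize_eq0 fsizeM addn_eq0 fsize_eq0.
    by rewrite (negbTE un1).
  rewrite u1 -(IHg (fun v => F (fmul u.1 v.1, v.2))); apply: eq_bigr => v _ /=.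
  by rewrite fmul1f.
Qed.

Lemma cop_fone_fst (V : nmodType) (F : forest A * forest A -> V) h :
  \sum_(u <- cop h | u.1 == fone A) F u = F (fone A, h).
Proof.
rewrite big_mkcond; elim/forest_ind: h F => [|a f IH|f g IHf IHg] F.
- by rewrite cop_fone; case: eqP.
- rewrite cop_graft; cbv beta; case: eqP => [/eqP|_].
    by rewrite -fsize_eq0 fsize_graft.
  by rewrite addr0 -(IH (fun u => F (u.1, fgraft a u.2))).
- rewrite cop_fmul -(IHf (fun u => F (u.1, fmul u.2 g))); apply: eq_bigr => u _ /=.
  case: eqP => [u1|/eqP un1]; last first.
    rewrite big1// => v _ /=; rewrite -fsize_eq0 fsizeM addn_eq0 fsize_eq0.
    by rewrite (negbTE un1).
  rewrite u1 -(IHg (fun v => F (v.1, fmul u.2 v.2))); apply: eq_bigr => v _ /=.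
  by rewrite fmul1f.
Qed.

Lemma grafts_fsize f g h : h \in grafts f g -> fsize h = (fsize f + fsize g)%N.
Proof.
move=> hfg; apply/eqP; move: hfg; apply: contraTT => hn; apply/negP => hfg.
suff : (\sum_(h <- grafts f g) (fsize h != fsize f + fsize g) = 0)%N.
  by move/eqP; rewrite sum_nat_seq_eq0 => /allP/(_ _ hfg) /=; rewrite hn.
elim/forest_ind: g {h hn hfg} => [|a k IH|g k IHg IHk].
- by rewrite grafts_fone.
- rewrite grafts_graft !fsize_graft fsizeM addnS eqxx add0r -[RHS]IH.
  by apply: eq_bigr => h _; rewrite fsize_graft eqSS.
- rewrite grafts_fmul; apply/eqP; rewrite addn_eq0; apply/andP; split; apply/eqP.
    by rewrite -[RHS]IHg; apply: eq_bigr => h _; rewrite !fsizeM addnA eqn_add2r.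
  by rewrite -[RHS]IHk; apply: eq_bigr => h _; rewrite !fsizeM addnCA eqn_add2l.
Qed.

Lemma finite_bounded_seq (T : eqType) (D : set T) m : finite_set D ->
  finite_set [set s : seq T | (size s <= m)%N /\ forall x, x \in s -> D x].
Proof.
move=> Dfin; elim: m => [|m IHm].
  by apply: (@sub_finite_set _ _ [set [::]]) => // -[|x s] [].
apply: (@sub_finite_set _ _ ([set [::]] `|`
  (fun p => p.1 :: p.2) @` (D `*` [set s : seq T | (size s <= m)%N /\ forall x, x \in s -> D x]))).
  move=> [|x s] [/= sm sD]; [by left|right].
  exists (x, s) => //=; split=> /=; first by apply: sD; rewrite mem_head.
  by split=> // y ys; apply: sD; rewrite inE ys orbT.
rewrite finite_setU; split=> //.
by apply: finite_image; exact: finite_setX.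
Qed.

Lemma bounded_forest m c : (sumn (map (@Defs.tsize A) c) <= m)%N ->
  (size c <= m)%N /\ forall t, t \in c -> (Defs.tsize t <= m)%N.
Proof.
elim: c m => [//|[a d] c IHc] m /= dcm.
have [|cm ctm] := IHc m.-1; first by lia.
split; first by lia.
move=> t; rewrite inE => /orP[/eqP -> /=|/ctm tm].
  by apply: leq_trans dcm; rewrite leq_addr.
by rewrite (leq_trans tm)// leq_pred.
Qed.

(** A [\sum_(h \in ...)] with infinite support is 0 by default, so finiteness is needed to unfold
    the definitions. A tree is a label from a finite set with a list of boundedly many smaller
    trees. *)
Lemma finite_forest n : finite_set [set h : forest A | (fsize h <= n)%N].
Proof.
have treefin m : finite_set [set t : ptree A | (Defs.tsize t <= m)%N].
  elim: m => [|m IHm].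
    by apply: (@sub_finite_set _ _ set0) => // -[].
  apply: (@sub_finite_set _ _ ((fun p => PNode p.1 p.2) @` ([set: A] `*`
      [set s | (size s <= m)%N /\ forall x, x \in s -> (Defs.tsize x <= m)%N]))).
    move=> [a c] /= cm; exists (a, c) => //=; split => //=.
    exact: bounded_forest.
  apply: finite_image; apply: finite_setX; first exact: finite_finset.
  exact: finite_bounded_seq.
apply: (@sub_finite_set _ _ ((@mkforest A) @` [set s |
    (size s <= n)%N /\ forall x, x \in s -> (Defs.tsize x <= n)%N])).
  move=> h hn; exists (fseq h); last exact: mkforestK.
  exact: (@bounded_forest n (fseq h) hn).
by apply: finite_image; exact: (finite_bounded_seq n (treefin n)).
Qed.

End ForestCombinatorics.

(** * Linear extension and the coproduct of a natural growth *)

Section LinearExtension.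
Variables (R : realType) (K : choiceType).
Local Notation H := (malg K R).

Lemma mcoeff_sum (k : K) I (s : seq I) (Q : pred I) (F : I -> H) :
  mcoeff k (\sum_(i <- s | Q i) F i) = \sum_(i <- s | Q i) mcoeff k (F i).
Proof. exact: (raddf_sum (@mcoeff K R k)). Qed.

Lemma malgUZ (k : K) (c : R) : mkmalgU k c = c *: mkmalgU k 1 :> H.
Proof. by apply/malgP => j; rewrite mcoeffZ !mcoeffU mulr_natr. Qed.

Variable V : lmodType R.
Implicit Types (phi psi : K -> V) (x y : H).

Definition lext phi x : V := \sum_(k <- msupp x) mcoeff k x *: phi k.

Lemma lextEw (s : seq K) phi x : uniq s ->
  (forall k, k \in msupp x -> k \in s) -> lext phi x = \sum_(k <- s) mcoeff k x *: phi k.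
Proof.
move=> us xs; rewrite /lext [RHS](bigID (mem (msupp x))) /=.
rewrite [X in _ = _ + X]big1 ?addr0; last first.
  by move=> k kx; rewrite mcoeff_outdom// scale0r.
rewrite -[RHS]big_filter; apply: perm_big; apply: uniq_perm; rewrite ?fset_uniq//.
  exact: filter_uniq.
by move=> k; rewrite mem_filter; case: (boolP (k \in msupp x)) => //= /xs ->.
Qed.

Lemma lext_linear phi : linear (lext phi).
Proof.
move=> a x y; pose s := undup (msupp x ++ msupp y ++ msupp (a *: x + y)).
have us : uniq s by exact: undup_uniq.
rewrite !(@lextEw s)//; try by move=> k; rewrite mem_undup !mem_cat => ->; rewrite ?orbT.
rewrite scaler_sumr -big_split; apply: eq_bigr => k _ /=.
by rewrite mcoeffD mcoeffZ scalerDl scalerA.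
Qed.

HB.instance Definition _ phi := GRing.isLinear.Build R H V _ (lext phi) (lext_linear phi).

Lemma lextU phi k : lext phi (mkmalgU k 1) = phi k.
Proof. by rewrite /lext msuppU oner_eq0 big_seq_fset1 mcoeffUU scale1r. Qed.

Lemma eq_lext_in phi psi x :
  (forall k, k \in msupp x -> phi k = psi k) -> lext phi x = lext psi x.
Proof. by move=> e; apply: eq_big_seq => k /e ->. Qed.

Lemma eq_lext phi psi : phi =1 psi -> lext phi =1 lext psi.
Proof. by move=> e x; exact: eq_lext_in. Qed.

Lemma lextZr a phi x : lext phi (a *: x) = a *: lext phi x.
Proof. exact: linearZ. Qed.

Lemma lextDr phi x y : lext phi (x + y) = lext phi x + lext phi y.
Proof. exact: linearD. Qed.

Lemma lext_sumr I (s : seq I) (Q : pred I) (F : I -> H) phi :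
  lext phi (\sum_(i <- s | Q i) F i) = \sum_(i <- s | Q i) lext phi (F i).
Proof. exact: linear_sum. Qed.

Lemma lext0 x : lext (fun=> 0) x = 0.
Proof. by rewrite /lext big1// => k _; rewrite scaler0. Qed.

Lemma lextD phi psi x : lext (fun k => phi k + psi k) x = lext phi x + lext psi x.
Proof. by rewrite /lext -big_split; apply: eq_bigr => k _; rewrite /= scalerDr. Qed.

Lemma lextZ a phi x : lext (fun k => a *: phi k) x = a *: lext phi x.
Proof.
by rewrite /lext scaler_sumr; apply: eq_bigr => k _; rewrite !scalerA mulrC.
Qed.

Lemma lext_sum I (s : seq I) (Q : pred I) (F : I -> K -> V) x :
  lext (fun k => \sum_(i <- s | Q i) F i k) x = \sum_(i <- s | Q i) lext (F i) x.
Proof.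
rewrite /lext exchange_big; apply: eq_bigr => k _.
by rewrite scaler_sumr.
Qed.

End LinearExtension.

Lemma lext_id (R : realType) (K : choiceType) (x : malg K R) :
  lext (fun k => mkmalgU k 1) x = x.
Proof.
by rewrite [RHS]monalgE; apply: eq_bigr => k _; rewrite -malgUZ.
Qed.

Lemma lext_comp (R : realType) (K : choiceType) (V W : lmodType R)
    (f : {linear V -> W}) (phi : K -> V) (x : malg K R) :
  f (lext phi x) = lext (fun k => f (phi k)) x.
Proof. by rewrite linear_sum; apply: eq_bigr => k _; rewrite linearZ. Qed.

Lemma lext_lext (R : realType) (K L : choiceType) (V : lmodType R)
    (phi : L -> V) (psi : K -> malg L R) (x : malg K R) :
  lext phi (lext psi x) = lext (fun k => lext phi (psi k)) x.
Proof. exact: lext_comp. Qed.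

Section Hopf.
Variables (R : realType) (A : finType).
Local Notation H := (malg (forest A) R).
Local Notation e := (fbasis R).
Implicit Types (x y p q r : H) (f g h k : forest A) (n : nat).

Lemma fbasis_coef h k : mcoeff k (e h) = (h == k)%:R.
Proof. by rewrite mcoeffU1. Qed.

Lemma one_fbasis : (1 : H) = e (fone A).
Proof. by []. Qed.

Lemma fpairE (phi : forest A -> R) x : fpair phi x = lext (phi : _ -> R^o) x.
Proof. by []. Qed.

Definition homog n x := forall h, h \in msupp x -> fsize h = n.

Lemma homogP n x : homog n x <-> forall h, fsize h <> n -> mcoeff h x = 0.
Proof.
split=> [nx h hn|nx h]; last first.
  by rewrite -mcoeff_neq0 => /eqP hx; apply: contrapT => hn; exact: (hx (nx h hn)).
by apply/eqP; rewrite mcoeff_eq0; apply/negP => /nx.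
Qed.

Lemma homog0 n : homog n 0.
Proof. by move=> h; rewrite msupp0. Qed.

Lemma homogD n x y : homog n x -> homog n y -> homog n (x + y).
Proof.
by move=> /homogP nx /homogP ny; apply/homogP => h hn; rewrite mcoeffD nx ?ny ?addr0.
Qed.

Lemma homogZ n (a : R) x : homog n x -> homog n (a *: x).
Proof. by move=> /homogP nx; apply/homogP => h hn; rewrite mcoeffZ nx// mulr0. Qed.

Lemma homog_sum n (I : eqType) (s : seq I) (F : I -> H) :
  (forall i, i \in s -> homog n (F i)) -> homog n (\sum_(i <- s) F i).
Proof.
move=> sF; rewrite big_seq; elim/big_ind: _ => //; first exact: homog0.
exact: homogD.
Qed.

Lemma homog_lext n (K : choiceType) (phi : K -> H) (x : malg K R) :
  (forall i, i \in msupp x -> homog n (phi i)) -> homog n (lext phi x).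
Proof. by move=> xn; apply: homog_sum => k kx; apply: homogZ; exact: xn. Qed.

Lemma homog_fbasis h : homog (fsize h) (e h).
Proof. by move=> k; rewrite msuppU oner_eq0 in_fset1 => /eqP ->. Qed.

Lemma homog_deg n x : x <> 0 -> homog n x -> deg x = n.
Proof.
move=> x0 nx; have /fset0Pn[h hx] : msupp x != fset0.
  by rewrite msupp_eq0; exact/eqP.
apply/eqP; rewrite eqn_leq; apply/andP; split.
  by apply/bigmax_leqP_seq => k /nx ->.
by rewrite -(nx h hx); apply: (@leq_bigmax_seq _ _ _ (@fsize A)).
Qed.

Definition ngraft h k : H := (fsize k)%:R^-1 *: \sum_(g <- grafts h k) e g.

Lemma ntopE x y : ntop x y = lext (fun h => lext (ngraft h) y) x.
Proof.
apply: eq_bigr => h _; rewrite scaler_sumr; apply: eq_bigr => k _.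
by rewrite /ngraft !scalerA.
Qed.

Definition ntopr p x : H := ntop x p.

Lemma ntopr_linear p : linear (ntopr p).
Proof. by move=> a x y; rewrite /ntopr !ntopE linearP. Qed.

HB.instance Definition _ p := GRing.isLinear.Build R H H _ (ntopr p) (ntopr_linear p).

Lemma ntop_lext p x : ntop x p = lext (fun h => ntop (e h) p) x.
Proof. by rewrite ntopE; apply: eq_lext => h; rewrite ntopE lextU. Qed.

Lemma ntop_homogE n h p : homog n p ->
  ntop (e h) p = n%:R^-1 *: lext (fun k => \sum_(g <- grafts h k) e g) p.
Proof.
move=> np; rewrite ntopE lextU -lextZ; apply: eq_lext_in => k /np.
by rewrite /ngraft => ->.
Qed.

Lemma homog_ntop m n x p : homog m x -> homog n p -> homog (m + n) (ntop x p).
Proof.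
move=> mx np; rewrite ntopE; apply: homog_lext => h /mx hm.
apply: homog_lext => k /np kn; apply: homogZ; apply: homog_sum => g /grafts_fsize.
by rewrite hm kn => <-; exact: homog_fbasis.
Qed.

Lemma ntop1 n p : (0 < n)%N -> homog n p -> ntop 1 p = p.
Proof.
move=> n0 np; rewrite one_fbasis (ntop_homogE _ np) -lextZ -[RHS]lext_id.
apply: eq_lext_in => k /np kn; rewrite grafts_cop_fone kn -[e k *+ n]scaler_nat scalerA.
by rewrite mulVf ?scale1r// pnatr_eq0 -lt0n.
Qed.

Lemma coproductE x :
  coproduct x = lext (fun h => \sum_(u <- cop h) mkmalgU u (1 : R)) x.
Proof.
apply: eq_bigr => h _; rewrite scaler_sumr; apply: eq_bigr => u _.
exact: malgUZ.
Qed.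

Lemma tensorx1 x : tensor x 1 = lext (fun h => mkmalgU (h, fone A) (1 : R)) x.
Proof.
apply: eq_bigr => h _; rewrite msuppU oner_eq0 big_seq_fset1 mcoeffUU mulr1.
exact: malgUZ.
Qed.

Lemma tensor1x x : tensor 1 x = lext (fun h => mkmalgU (fone A, h) (1 : R)) x.
Proof.
rewrite /tensor msuppU oner_eq0 big_seq_fset1; apply: eq_bigr => h _.
rewrite mcoeffUU mul1r.
exact: malgUZ.
Qed.

Section Coproduct.
Variable V : lmodType R.

(** The linear map [F] evaluated on the coproduct of [x]; letting [F] vary replaces computations
    with elements of H tensor H. *)
Definition copair (F : forest A * forest A -> V) x : V :=
  lext (fun h => \sum_(u <- cop h) F u) x.

HB.instance Definition _ F := GRing.isLinear.Build R H V _ (copair F) (lext_linear _).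

Lemma primitive_copair (F : forest A * forest A -> V) p : primitive p ->
  copair F p = lext (fun h => F (h, fone A) + F (fone A, h)) p.
Proof.
move=> [_ /(congr1 (lext F))].
rewrite coproductE tensorx1 tensor1x.
rewrite (raddfD (lext F)) !lext_lext lextD => E.
transitivity (lext F (lext (fun h => \sum_(u <- cop h) mkmalgU u (1 : R)) p)).
  rewrite lext_lext; apply: eq_lext => h; rewrite (raddf_sum (lext F)).
  by apply: eq_bigr => u _; apply/esym; exact: lextU.
rewrite lext_lext E.
congr (_ + _); (apply: etrans; first exact: lext_lext).
  by apply: eq_lext => h; exact: lextU.
by apply: eq_lext => h; exact: lextU.
Qed.

(* Natural growth on a primitive p is a Hochschild 1-cocycle:
   Delta (x top p) = (x top p) (x) 1 + (id (x) (- top p)) (Delta x). *)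
Lemma ntop_cocycle (F : forest A * forest A -> V) n x p :
    primitive p -> homog n p ->
  copair F (ntop x p) = lext (fun h => F (h, fone A)) (ntop x p) +
    copair (fun u => lext (fun g => F (u.1, g)) (ntop (e u.2) p)) x.
Proof.
move=> pp np; rewrite !(ntop_lext p x) /copair !lext_lext -lextD.
apply: eq_lext => f; rewrite (ntop_homogE _ np) !lextZr !lext_lext.
transitivity (n%:R^-1 *: copair (fun u => \sum_(h <- grafts f u.1) F (h, u.2) +
    \sum_(v <- cop f) \sum_(h <- grafts v.2 u.2) F (fmul v.1 u.1, h)) p).
  congr (_ *: _); apply: eq_lext => k; rewrite lext_sumr.
  under eq_bigr do rewrite lextU.
  by rewrite cop_grafts big_split.
rewrite primitive_copair// !lextD scalerDr; congr (_ + _).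
  congr (_ *: _); rewrite -lextD; apply: eq_lext => k /=.
  rewrite lext_sumr [X in _ + X]big1 ?addr0; last by move=> v _; rewrite grafts_fone.
  by apply: eq_bigr => g _; rewrite lextU.
rewrite -lextD; under eq_lext => k do rewrite /= grafts_fone add0r.
rewrite lext_sum scaler_sumr; apply: eq_bigr => v _.
rewrite (ntop_homogE _ np) lextZr lext_lext; congr (_ *: _).
apply: eq_lext => k; rewrite lext_sumr; apply: eq_bigr => g _.
by rewrite lextU fmulf1.
Qed.

End Coproduct.

End Hopf.

(** * Decomposition of the augmentation ideal along natural growth *)

Lemma big_pred1_seq (V : nmodType) (I : eqType) (s : seq I) i (F : I -> V) :
  uniq s -> i \in s -> \sum_(j <- s | j == i) F j = F i.
Proof.
move=> us si; rewrite big_mkcond (bigD1_seq i)//= eqxx big1 ?addr0// => j.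
by move=> /negbTE ->.
Qed.

Section PrimitiveBasis.
Variables (R : realType) (A : finType) (P : set (malg (forest A) R)).
Hypothesis hP : primitive_basis P.
Local Notation H := (malg (forest A) R).
Local Notation e := (fbasis R).
Implicit Types (x y p q r : H) (f g h k : forest A) (n : nat).

Definition forests n : seq (forest A) := fset_set [set h | (fsize h <= n)%N].

Lemma mem_forests n h : (h \in forests n) = (fsize h <= n)%N.
Proof.
rewrite in_fset_set; last exact: finite_forest.
by apply/idP/idP => [/set_mem|hn]; last exact/mem_set.
Qed.

Lemma forests_uniq n : uniq (forests n).
Proof. exact: fset_uniq. Qed.

Lemma P_prim p : P p -> primitive p.
Proof. by case: hP => H _ _ /H[]. Qed.

Lemma P_neq0 p : P p -> p <> 0.
Proof.
move=> Pp p0; have [_ indep _] := hP.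
have := indep [:: p] (fun=> 1) isT; rewrite big_seq1 scale1r.
move=> /(_ _ p0 p (mem_head _ _)) => H; have := oner_neq0 R.
by rewrite H ?eqxx// => x; rewrite inE => /eqP ->.
Qed.

(** An element of degree 0 would be a multiple of 1, but primitive elements have no constant
    term. *)
Lemma P_homog p : P p -> exists2 n, (0 < n)%N & homog n p.
Proof.
move=> Pp; have [H _ _] := hP; have [[p1 _] [n np]] := H p Pp.
exists n => //; rewrite lt0n; apply/eqP => n0; apply: (P_neq0 Pp).
apply/malgP => h; rewrite mcoeff0; have [hp|/mcoeff_outdom//] := boolP (h \in msupp p).
have := np h hp; rewrite n0 => /eqP; rewrite fsize_eq0 => /eqP ->; exact: p1.
Qed.

(* cl k x = (k^* (x) id) (Delta x) *)
Definition cl k x : H := copair (fun u => (u.1 == k)%:R *: e u.2) x.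

Lemma cl_sum (I : Type) (s : seq I) (F : I -> H) k :
  cl k (\sum_(i <- s) F i) = \sum_(i <- s) cl k (F i).
Proof. exact: lext_sumr. Qed.

Lemma clB x y k : cl k (x - y) = cl k x - cl k y.
Proof. by rewrite /cl raddfB. Qed.

Lemma clE (V : lmodType R) (G : forest A -> V) h k : (fsize h <= fsize k)%N ->
  \sum_(u <- cop h) (u.1 == k)%:R *: G u.2 = (h == k)%:R *: G (fone A).
Proof.
move=> hk; rewrite -(cop_fone_snd (fun u => (u.1 == k)%:R *: G u.2)) [RHS]big_mkcond.
rewrite !big_seq; apply: eq_bigr => u /fsize_cop uh; case: (u.2 =P _) => // /eqP.
rewrite -fsize_eq0 => u2; case: (u.1 =P _) => [uk|_]; last by rewrite scale0r.
by rewrite -uk -uh in hk; lia.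
Qed.

Lemma lext_delta (V : lmodType R) (v : V) k x :
  lext (fun h => (h == k)%:R *: v) x = mcoeff k x *: v.
Proof.
rewrite -[in RHS](lext_id x) mcoeff_sum scaler_suml.
by apply: eq_bigr => h _; rewrite mcoeffZ mcoeffU1 scalerA.
Qed.

Lemma homog_cl m n k x : homog n x -> fsize k = m -> homog (n - m) (cl k x).
Proof.
move=> nx km; apply: homog_lext => h /nx hn; apply: homog_sum => u /fsize_cop uh.
case: eqP => [uk|_]; last by rewrite scale0r; exact: homog0.
by rewrite -hn -uh -km uk addKn; apply: homogZ; exact: homog_fbasis.
Qed.

Lemma copair_cl (V : lmodType R) (F : forest A * forest A -> V) n x : homog n x ->
  copair F x = \sum_(j <- forests n) lext (fun g => F (j, g)) (cl j x).
Proof.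
move=> nx; rewrite /cl /copair.
under [RHS]eq_bigr do rewrite lext_lext.
rewrite -lext_sum; apply: eq_lext_in => h /nx hn.
under [RHS]eq_bigr do rewrite lext_sumr.
rewrite exchange_big !big_seq; apply: eq_bigr => u /fsize_cop uh /=.
rewrite (bigD1_seq u.1) ?forests_uniq//=; last by rewrite mem_forests -hn -uh leq_addr.
rewrite eqxx scale1r lextU -surjective_pairing big1 ?addr0// => j ju.
by rewrite eq_sym (negbTE ju) scale0r linear0.
Qed.

(** As [k] is at least as large as every forest of [x], a cut of [x] with first factor [k] has empty
    second factor, which the cocycle formula turns into [1 top p]. The other term comes from cutting
    off [x top p] entirely. *)
Lemma cl_ntop n k x p : primitive p -> homog n p ->
    (forall h, h \in msupp x -> (fsize h <= fsize k)%N) ->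
  cl k (ntop x p) = mcoeff k (ntop x p) *: 1 + mcoeff k x *: ntop 1 p.
Proof.
move=> pp np xk; rewrite /cl (ntop_cocycle _ _ pp np); congr (_ + _).
  by rewrite one_fbasis -lext_delta.
rewrite -lext_delta /copair; apply: eq_lext_in => h /xk hk.
rewrite -(clE (fun g => ntop (e g) p) hk); apply: eq_bigr => u _.
by rewrite /= lextZ lext_id.
Qed.

(* Compare the terms of Delta (\sum_i y_i top p_i) whose first factor has
   maximal degree: they are the k (x) \sum_p y_p(k) p. *)
Lemma ntop_inj (l : seq (H * H)) : (forall i, i \in l -> P i.1) ->
    \sum_(i <- l) ntop i.2 i.1 = 0 ->
  forall p, \sum_(i <- l | i.1 == p) i.2 = 0.
Proof.
move=> lP l0; pose ps := undup (map fst l).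
pose S p := \sum_(i <- l | i.1 == p) i.2.
have psP p : p \in ps -> P p by rewrite mem_undup => /mapP[i /lP + ->].
have sumS : \sum_(p <- ps) ntop (S p) p = 0.
  rewrite -[RHS]l0.
  have -> : \sum_(p <- ps) ntop (S p) p = \sum_(p <- ps) \sum_(i <- l | i.1 == p) ntop i.2 i.1.
    apply: eq_bigr => p _; rewrite -[ntop _ _]/(ntopr p _) linear_sum.
    by apply: eq_bigr => i /eqP ->.
  rewrite (exchange_big_dep xpredT)//= !big_seq; apply: eq_bigr => i il.
  under eq_bigl do rewrite eq_sym.
  by rewrite big_pred1_seq ?undup_uniq// mem_undup map_f.
pose M := (\max_(p <- ps) deg (S p))%N.
have SM p h : p \in ps -> h \in msupp (S p) -> (fsize h <= M)%N.
  move=> pps hS; apply: (@leq_trans (deg (S p))).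
    exact: (@leq_bigmax_seq _ _ _ (@fsize A)).
  exact: (@leq_bigmax_seq _ _ _ (fun p => deg (S p))).
(* Decreasing induction on the size of [k]: at stage [j] the coefficients of size above [M - j]
   vanish. *)
suff S0 j p k : (M < fsize k + j)%N -> p \in ps -> mcoeff k (S p) = 0.
  move=> p; have [pps|pps] := boolP (p \in ps).
    apply/malgP => k; rewrite mcoeff0; apply: (S0 M.+1) => //.
    by rewrite addnS ltnS leq_addl.
  rewrite big_seq_cond big1// => i /andP[il /eqP ip].
  by move: pps; rewrite mem_undup -ip map_f.
elim: j p k => [|j IHj] p k Mk pps.
  by apply/eqP; rewrite mcoeff_eq0; apply: contraL Mk => /(SM _ _ pps); lia.
have [_ indep _] := hP.
apply: (indep ps (fun p => mcoeff k (S p)) _ psP _ p pps); first exact: undup_uniq.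
have E : \sum_(q <- ps) cl k (ntop (S q) q) = 0.
  by rewrite -cl_sum sumS /cl linear0.
have clk q : q \in ps -> cl k (ntop (S q) q) = mcoeff k (ntop (S q) q) *: 1 + mcoeff k (S q) *: q.
  move=> qps; have [n n0 nq] := P_homog (psP q qps).
  rewrite (cl_ntop (P_prim (psP q qps)) nq) ?(ntop1 n0 nq)// => h hS.
  rewrite leqNgt; apply/negP => kh; move: hS; rewrite -mcoeff_neq0 IHj ?eqxx//.
  by lia.
(* The constant terms add up to the [k]-coefficient of a zero sum, so a linear relation between
   elements of P remains. *)
have E0 : \sum_(q <- ps) mcoeff k (ntop (S q) q) = 0.
  by rewrite -(mcoeff_sum k ps xpredT (fun q => ntop (S q) q)) sumS mcoeff0.
have E' : \sum_(q <- ps) (mcoeff k (ntop (S q) q) *: (1 : H) + mcoeff k (S q) *: q) = 0.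
  by rewrite -[RHS]E; apply: eq_big_seq => q /clk ->.
by rewrite big_split /= -scaler_suml E0 scale0r add0r in E'.
Qed.

End PrimitiveBasis.

Lemma lext_eqD (R : realType) (K L : choiceType) (a b c : L -> malg K R)
    (x : malg L R) :
  (forall v, lext (fun h => mcoeff v (a h) : R^o) x =
    lext (fun h => mcoeff v (b h) + mcoeff v (c h) : R^o) x) ->
  lext a x = lext b x + lext c x.
Proof.
move=> abc; apply/malgP => v; have := abc v; rewrite lextD mcoeffD /lext !mcoeff_sum.
have E (d : L -> malg K R) : \sum_(k <- msupp x) mcoeff v (mcoeff k x *: d k) =
    \sum_(k <- msupp x) mcoeff k x *: (mcoeff v (d k) : R^o).
  by apply: eq_bigr => k _; rewrite mcoeffZ.
by rewrite !E.
Qed.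

Lemma mcoeff_sumU1 (R : realType) (K : choiceType) (s : seq K) (v : K) :
  mcoeff v (\sum_(u <- s) mkmalgU u (1 : R)) = \sum_(u <- s) (u == v)%:R.
Proof. by rewrite mcoeff_sum; apply: eq_bigr => u _; rewrite mcoeffU. Qed.

Section Decomposition.
Variables (R : realType) (A : finType) (P : set (malg (forest A) R)).
Hypothesis hP : primitive_basis P.
Local Notation H := (malg (forest A) R).
Local Notation e := (fbasis R).
Implicit Types (x y p q r : H) (f g h k : forest A) (n : nat).

Lemma cl_size_eq n x j : homog n x -> fsize j = n -> cl j x = mcoeff j x *: 1.
Proof.
move=> nx jn; rewrite one_fbasis -lext_delta; apply: eq_lext_in => h /nx hn.
by rewrite (clE (fun u => e u)) ?hn ?jn.
Qed.

Lemma copairP p : mcoeff (fone A) p = 0 ->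
    (forall F : forest A * forest A -> R^o,
      copair F p = lext (fun h => F (h, fone A) + F (fone A, h)) p) ->
  primitive p.
Proof.
move=> p1 pF; split=> //; rewrite coproductE tensorx1 tensor1x.
apply: lext_eqD => v; have := pF (fun u => (u == v)%:R); rewrite /copair => E.
apply: etrans (etrans E _); apply: eq_lext => h; first exact: mcoeff_sumU1.
by congr (_ + _); apply/esym; exact: mcoeffU.
Qed.

(* The terms of Delta x whose first factor has maximal degree below n have
   primitive second factors, by coassociativity. *)
Lemma primitive_cl n k x : homog n x -> (fsize k < n)%N ->
    (forall j, (fsize k < fsize j)%N -> (fsize j < n)%N -> cl j x = 0) ->
  primitive (cl k x).
Proof.
move=> nx kn clx; apply: copairP => [|F].
  have /homogP := homog_cl nx (erefl (fsize k)); apply.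
  by rewrite fsize1; lia.
pose Psi (u : forest A * forest A) : R^o :=
  \sum_(v <- cop u.1) (v.1 == k)%:R *: F (v.2, u.2).
have -> : copair F (cl k x) = copair Psi x.
  rewrite /cl /copair lext_lext; apply: eq_lext => h.
  rewrite lext_sumr [RHS](coassoc (fun a b c => (a == k)%:R *: F (b, c))).
  apply: eq_bigr => u _; rewrite lextZr lextU scaler_sumr.
  by apply: eq_bigr => v _; rewrite -surjective_pairing.
(* In the sum over the first factor [j] only two kinds of terms survive: [j = k], which gives
   [F (fone A, g)], and [fsize j = n], where [cl j x] is a scalar and which gives
   [F (g, fone A)]. *)
rewrite (copair_cl _ nx) lextD addrC.
rewrite (bigID (fun j => fsize j == n)) /= addrC; congr (_ + _).
  have kJ : k \in forests A n by rewrite mem_forests ltnW.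
  rewrite big_mkcond (bigD1_seq k) ?forests_uniq//= big_seq_cond big1 => [|j /andP[jn jk]].
    rewrite addr0 ifT; last by lia.
    apply: eq_lext => g; rewrite /Psi /= (clE (fun w => F (w, g)))// eqxx.
    by rewrite scale1r.
  rewrite mem_forests in jn; case: ifP => // jnn.
  have [kj|jk'] := ltnP (fsize k) (fsize j).
    by rewrite clx ?linear0// ltn_neqAle jnn.
  rewrite -[RHS](lext0 _ (cl j x)); apply: eq_lext => g.
  by rewrite /Psi /= (clE (fun w => F (w, g)))// (negbTE jk) scale0r.
transitivity (lext (fun h => Psi (h, fone A)) x).
  rewrite (@lextEw _ _ _ (forests A n)) ?forests_uniq//; last first.
    by move=> h /nx hn; rewrite mem_forests hn.
  rewrite [RHS](bigID (fun j => fsize j == n)) /= [X in _ = _ + X]big1 ?addr0; last first.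
    move=> j /eqP jn; have /homogP/(_ _ jn) -> := nx; exact: scale0r.
  by apply: eq_bigr => j /eqP jn; rewrite (cl_size_eq nx jn) lextZr lextU.
rewrite /cl /copair lext_lext; apply: eq_lext => h.
rewrite lext_sumr; apply: eq_bigr => u _.
by rewrite lextZr lextU.
Qed.

Lemma primitive_homog_span n p : primitive p -> homog n p ->
  exists l : seq (R * H), (forall i, i \in l -> P i.2 /\ homog n i.2) /\
    p = \sum_(i <- l) i.1 *: i.2.
Proof.
move=> pp np; have [_ _ sp] := hP.
have [s [c [sP pE]]] := sp p pp.
pose isn (q : H) := `[< homog n q >].
exists [seq (c q, q) | q <- s & isn q]; split.
  move=> _ /mapP[q + ->]; rewrite mem_filter => /andP[/asboolP qn qs].
  by split => //; exact: sP.
rewrite big_map big_filter /=; apply/malgP => h.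
have [hn|hn] := eqVneq (fsize h) n; last first.
  have /homogP -> := np; last exact/eqP.
  rewrite mcoeff_sum big1// => q /asboolP /homogP qn.
  by rewrite mcoeffZ qn ?mulr0//; exact/eqP.
rewrite {1}pE !mcoeff_sum [RHS]big_mkcond !big_seq; apply: eq_bigr => q qs.
rewrite /isn; case: asboolP => // qn; rewrite mcoeffZ.
have [m _ mq] := P_homog hP (sP q qs).
have /homogP -> := mq; first by rewrite mulr0.
by move=> hm; apply: qn; rewrite -hn hm.
Qed.

Definition graded_sum n (l : seq (H * H)) := forall i, i \in l -> P i.1 /\
  exists a b, [/\ (0 < a)%N, homog a i.1, homog b i.2 & (a + b = n)%N].

(** Induction on a strict bound for the sizes, below [n], of the first factors that occur. Those of
    the largest size [m] have primitive cofactors [cl k x], and subtracting the sum of the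
    [k top cl k x] cancels these terms without creating larger ones. *)
Lemma homog_decomp n x : (0 < n)%N -> homog n x ->
  exists2 l, graded_sum n l & x = \sum_(i <- l) ntop i.2 i.1.
Proof.
move=> n0 nx; suff : forall m, (m <= n)%N -> forall x, homog n x ->
    (forall k, (m <= fsize k)%N -> (fsize k < n)%N -> cl k x = 0) ->
    exists2 l, graded_sum n l & x = \sum_(i <- l) ntop i.2 i.1.
  by move=> /(_ n (leqnn n) x nx); apply => k; lia.
elim=> [_|m IHm mn] {nx}x nx clx.
  exists [::]; first by [].
  (* [cl (fone A) x] is [x] itself, so nothing is left to decompose. *)
  rewrite big_nil -(clx (fone A)) ?fsize1// -[LHS]lext_id; apply: eq_lext => h.
  apply: etrans (esym (cop_fone_fst (fun u => e u.2) h)) _.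
  rewrite big_mkcond; apply: eq_bigr => u _.
  by case: eqP => _; rewrite ?scale1r ?scale0r.
pose K := [seq k <- forests A m | fsize k == m].
have KP k : (k \in K) = (fsize k == m).
  by rewrite mem_filter mem_forests; lia.
have /choice[L HL] (k : forest A) : exists l : seq (R * H), fsize k = m ->
    (forall i, i \in l -> P i.2 /\ homog (n - m) i.2) /\
    cl k x = \sum_(i <- l) i.1 *: i.2.
  have [km|] := eqVneq (fsize k) m; last by move=> /eqP km; exists [::] => /km.
  have [||l Hl] := @primitive_homog_span (n - m) (cl k x); last by exists l.
    apply: (primitive_cl nx) => [|j kj jn]; first by rewrite km.
    by apply: clx => //; rewrite -km.
  exact: homog_cl.
pose l0 := [seq (i.2, i.1 *: e k) | k <- K, i <- L k].
have l0n : graded_sum n l0.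
  move=> _ /allpairsPdep[k [i [kK iL ->]]] /=.
  move: kK; rewrite KP => /eqP km; have [/(_ i iL)[Pi ni] _] := HL k km.
  split=> //; exists (n - m)%N, m; split=> //; [by lia| |by lia].
  by apply: homogZ; rewrite -km; exact: homog_fbasis.
pose x0 := \sum_(i <- l0) ntop i.2 i.1.
have nx0 : homog n x0.
  apply: homog_sum => i /l0n[_ [a [b [_ ai bi abn]]]].
  by rewrite -abn addnC; exact: homog_ntop.
have [] := IHm (ltnW mn) (x - x0).
- by apply: homogD => //; rewrite -scaleN1r; exact: homogZ.
- move=> k mk kn; rewrite clB; apply/eqP; rewrite subr_eq0; apply/eqP.
  have clx0 : cl k x0 = \sum_(j <- K) \sum_(i <- L j) ((j == k)%:R * i.1) *: i.2.
    rewrite /x0 big_allpairs_dep cl_sum !big_seq; apply: eq_bigr => j.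
    rewrite KP => /eqP jm; rewrite cl_sum !big_seq; apply: eq_bigr => i iL /=.
    have [/(_ i iL)[Pi ni] _] := HL j jm.
    have ej : homog m (i.1 *: e j) by rewrite -jm; apply: homogZ; exact: homog_fbasis.
    rewrite (cl_ntop (P_prim hP Pi) ni); last first.
      by move=> h /ej ->.
    rewrite (ntop1 _ ni); last by lia.
    have /homogP -> : homog n (ntop (i.1 *: e j) i.2).
    + by have := homog_ntop ej ni; rewrite subnKC// ltnW.
    + by rewrite scale0r add0r mcoeffZ fbasis_coef mulrC.
    + by lia.
  rewrite clx0; have [km|km] := eqVneq (fsize k) m; last first.
    rewrite clx ?big_seq ?big1//; last by rewrite ltn_neqAle eq_sym km.
    move=> j; rewrite KP => /eqP jm; rewrite big1// => i _.
    have [jk|_] := eqVneq j k; first by rewrite -jk jm eqxx in km.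
    by rewrite mul0r scale0r.
  have [_ ->] := HL k km.
  rewrite (bigD1_seq k) ?KP ?km//=; last by rewrite filter_uniq// forests_uniq.
  rewrite eqxx [X in _ + X]big1 ?addr0; last first.
    by move=> j /negbTE ->; apply: big1 => i _; rewrite mul0r scale0r.
  by apply: eq_bigr => i _; rewrite mul1r.
- move=> l ln lE; exists (l0 ++ l).
    by move=> i; rewrite mem_cat => /orP[/l0n|/ln].
  by rewrite big_cat /= -lE addrC subrK.
Qed.

End Decomposition.

(** * The basis of iterated natural growths and its dual *)

Section DualBasis.
Variables (R : realType) (A : finType) (P : set (malg (forest A) R)).
Hypothesis hP : primitive_basis P.
Local Notation H := (malg (forest A) R).
Local Notation e := (fbasis R).
Implicit Types (x y p q r s : H) (f g h k : forest A) (n : nat).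

Lemma ntop1P p : P p -> ntop 1 p = p.
Proof. by move=> /(P_homog hP)[n n0 np]; exact: ntop1 n0 np. Qed.

Lemma Ptop1_top r p : Ptop1 P r -> P p -> Ptop P (ntop r p).
Proof.
move=> [->|Pr] Pp; first by rewrite ntop1P//; exact: Ptop_one.
exact: Ptop_top.
Qed.

Lemma Ptop_ind1 (Q : H -> Prop) :
    (forall r p, Ptop1 P r -> (r <> 1 -> Q r) -> P p -> Q (ntop r p)) ->
  forall r, Ptop P r -> Q r.
Proof.
move=> QS r; elim=> [p Pp|{}r p Pr Qr Pp].
  by rewrite -(ntop1P Pp); apply: QS => //; left.
by apply: QS => //; right.
Qed.

Lemma ntop_eq0 r p : P p -> ntop r p = 0 -> r = 0.
Proof.
move=> Pp rp; have := @ntop_inj _ _ _ hP [:: (p, r)].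
rewrite big_seq1 => /(_ _ rp p); rewrite big_cons/= eqxx big_nil addr0; apply.
by move=> i; rewrite inE => /eqP ->.
Qed.

Lemma Ptop_homog r : Ptop P r -> exists2 n, (0 < n)%N & homog n r /\ r <> 0.
Proof.
have one0 : 1 <> 0 :> H by apply/eqP; exact: oner_neq0.
elim/Ptop_ind1=> {}r p Pr Qr Pp; have [m m0 mp] := P_homog hP Pp.
have [n [nr r0]] : exists n, homog n r /\ r <> 0.
  have [->|/Qr[n _ nr]] := pselect (r = 1); last by exists n.
  by exists 0%N; split=> //; rewrite -(fsize1 A); exact: homog_fbasis.
exists (n + m)%N; first by rewrite addn_gt0 m0 orbT.
by split; [exact: homog_ntop|move=> /(ntop_eq0 Pp)].
Qed.

Lemma homog_1 : homog 0 (1 : H).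
Proof. by rewrite -(fsize1 A); exact: homog_fbasis. Qed.

Lemma Ptop1_homog r : Ptop1 P r -> homog (deg r) r /\ r <> 0.
Proof.
have one0 : 1 <> 0 :> H by apply/eqP; exact: oner_neq0.
move=> [->|/Ptop_homog[n _ [nr r0]]]; last by rewrite (homog_deg r0 nr).
by rewrite (homog_deg one0 homog_1); split => //; exact: homog_1.
Qed.

Lemma P_deg p : P p -> homog (deg p) p /\ (0 < deg p)%N.
Proof.
move=> Pp; have [n n0 np] := P_homog hP Pp.
by rewrite (homog_deg (P_neq0 hP Pp) np).
Qed.

Lemma deg1 : deg (1 : H) = 0%N.
Proof. by apply: homog_deg homog_1; apply/eqP; exact: oner_neq0. Qed.

Lemma deg_ntop r p : Ptop1 P r -> P p -> deg (ntop r p) = (deg r + deg p)%N.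
Proof.
move=> Pr Pp; have [nr r0] := Ptop1_homog Pr; have [np _] := P_deg Pp.
by apply: homog_deg (homog_ntop nr np) => /(ntop_eq0 Pp).
Qed.

Lemma ntop_eq r p s q : Ptop1 P r -> P p -> Ptop1 P s -> P q ->
  ntop r p = ntop s q -> r = s /\ p = q.
Proof.
move=> Pr Pp Ps Pq E; have [_ r0] := Ptop1_homog Pr.
have := @ntop_inj _ _ _ hP [:: (p, r); (q, - s)].
have Nn : ntop (- s) q = - ntop r p by rewrite E; exact: (linearN (ntopr q)).
rewrite big_cons big_seq1 Nn subrr => /(_ _ erefl p); rewrite !big_cons big_nil /= eqxx addr0 => H0.
have {H0} : r + (if q == p then - s else 0) = 0.
  rewrite -[RHS]H0; first by case: ifP => // _; rewrite addr0.
  by move=> i; rewrite !inE => /orP[] /eqP ->.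
case: ifP => [/eqP ->|_] rs; first exact: (conj (subr0_eq rs) erefl).
by case: r0; exact: (etrans (esym (addr0 r)) rs).
Qed.

Definition Pspan n x := exists l : seq (R * H),
  (forall i, i \in l -> Ptop1 P i.2 /\ homog n i.2) /\ x = \sum_(i <- l) i.1 *: i.2.

Lemma Pspan_sum n (I : eqType) (s : seq I) (F : I -> H) :
  (forall i, i \in s -> Pspan n (F i)) -> Pspan n (\sum_(i <- s) F i).
Proof.
elim: s => [|i s IHs] sF; first by exists [::]; rewrite !big_nil.
have [l [lP lE]] := sF i (mem_head _ _).
have [|l' [lP' lE']] := IHs; first by move=> j js; apply: sF; rewrite inE js orbT.
exists (l ++ l'); split; last by rewrite big_cons big_cat lE lE'.
by move=> j; rewrite mem_cat => /orP[/lP|/lP'].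
Qed.

Lemma Pspan_ntop m n x p : Pspan m x -> P p -> homog n p -> Pspan (m + n) (ntop x p).
Proof.
move=> [l [lP ->]] Pp np; exists [seq (i.1, ntop i.2 p) | i <- l]; split.
  move=> _ /mapP[i /lP[Pi ni] ->]; split; last exact: homog_ntop.
  by right; exact: Ptop1_top.
rewrite big_map -[LHS]/(ntopr p _) linear_sum; apply: eq_bigr => i _.
by rewrite linearZ.
Qed.

Lemma homog_Pspan n x : homog n x -> Pspan n x.
Proof.
have [m] := ubnP n; elim: m n x => // m IHm n x nm nx.
have [n0|n0] := posnP n.
  exists [:: (mcoeff (fone A) x, 1)]; split.
    by move=> i; rewrite inE => /eqP ->; rewrite n0; split; [left|exact: homog_1].
  rewrite big_seq1 -[LHS]lext_id one_fbasis -lext_delta; apply: eq_lext_in => h /nx.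
  by rewrite n0 => /eqP; rewrite fsize_eq0 => /eqP ->; rewrite eqxx scale1r.
have [l ln ->] := homog_decomp hP n0 nx.
apply: Pspan_sum => i /ln[Pi [a [b [a0 ai bi abn]]]].
by rewrite -abn addnC; apply: Pspan_ntop => //; apply: IHm => //; lia.
Qed.

Lemma mcoeff_sum_fbasis (s : seq (forest A)) (c : forest A -> R) k : uniq s ->
  mcoeff k (\sum_(f <- s) c f *: e f) = if k \in s then c k else 0.
Proof.
move=> us; rewrite mcoeff_sum.
have -> : \sum_(f <- s) mcoeff k (c f *: e f) = \sum_(f <- s) c f * (f == k)%:R.
  by apply: eq_bigr => f _; rewrite mcoeffZ fbasis_coef.
case: ifP => [ks|/negbT ks]; last first.
  rewrite big_seq big1// => j js; case: eqP => [jk|_]; last exact: mulr0.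
  by rewrite -jk js in ks.
rewrite (bigD1_seq k)//= eqxx mulr1 big1 ?addr0// => j /negbTE ->; exact: mulr0.
Qed.

Definition is_dual r (g : H) := forall s, Ptop1 P s -> fpair (fdual g) s = (s == r)%:R.

Lemma fpair_fdual (g x : H) : fpair (fdual g) x = lext (fun h => mcoeff h g : R^o) x.
Proof. by []. Qed.

Lemma fpair_sumZ (phi : forest A -> R) (I : Type) (l : seq I) (c : I -> R) (F : I -> H) :
  fpair phi (\sum_(i <- l) c i *: F i) = \sum_(i <- l) c i * fpair phi (F i).
Proof.
by rewrite !fpairE linear_sum; apply: eq_bigr => i _; rewrite linearZ.
Qed.

Lemma fpairU (phi : forest A -> R) f : fpair phi (e f) = phi f.
Proof. exact: lextU. Qed.

Lemma ex_dual1 : is_dual 1 (e (fone A)).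
Proof.
move=> s Ps; have -> : fpair (fdual (e (fone A))) s = mcoeff (fone A) s.
  have := lext_delta (1 : R^o) (fone A) s; rewrite -[RHS]/(_ * 1 : R) mulr1 => <-.
  rewrite fpair_fdual; apply: eq_lext => h.
  by rewrite fbasis_coef eq_sym -[RHS]/(_ * 1 : R) mulr1.
have [->|s1] := eqVneq s 1; first by rewrite fbasis_coef eqxx.
case: Ps => [/eqP|/Ptop_homog[n n0 [/homogP -> //]]]; first by rewrite (negbTE s1).
by rewrite fsize1; lia.
Qed.

(** Each forest [f] of the degree of [r top p] is a sum of terms [y top q]; let [D f] be the total
    factor at [p]. Uniqueness of such decompositions shows that the linear extension of [D] maps
    [s top p] to [s] and [s top q] to 0 for [q] other than [p]. Hence [g] composed with [D] is the
    required dual element. *)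
Lemma ex_dual_top r p (g : H) : Ptop1 P r -> P p -> is_dual r g ->
  exists g' : H, is_dual (ntop r p) g'.
Proof.
move=> Pr Pp rg; have Prp := Ptop1_top Pr Pp.
have [n n0 [nrp rp0]] := Ptop_homog Prp.
have /choice[L HL] (f : forest A) : exists l : seq (H * H), fsize f = n ->
    (forall i, i \in l -> P i.1) /\ e f = \sum_(i <- l) ntop i.2 i.1.
  have [fn|/eqP fn] := eqVneq (fsize f) n; last by exists [::].
  have [||l ln lE] := @homog_decomp _ _ _ hP n (e f); last 1 first.
  - by exists l => _; split=> // i /ln[].
  - exact: n0.
  - by rewrite -fn; exact: homog_fbasis.
pose D f := \sum_(i <- L f | i.1 == p) i.2.
pose g' := \sum_(f <- [seq f <- forests A n | fsize f == n]) fpair (fdual g) (D f) *: e f.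
have g'E f : mcoeff f g' = if fsize f == n then fpair (fdual g) (D f) else 0.
  rewrite mcoeff_sum_fbasis ?filter_uniq ?forests_uniq// mem_filter mem_forests.
  by case: eqP => [->|//]; rewrite leqnn.
exists g' => s Ps; have [hs s0] := Ptop1_homog Ps.
have [sn|sn] := eqVneq (deg s) n; last first.
  rewrite fpair_fdual (@eq_lext_in _ _ _ _ (fun=> 0)); last first.
    by move=> h /hs hn; rewrite g'E hn (negbTE sn).
  rewrite lext0; case: eqP => // srp.
  by rewrite srp (homog_deg rp0 nrp) eqxx in sn.
have {}Ps : Ptop P s by case: Ps => [s1|//]; move: sn n0; rewrite s1 deg1 => <-.
elim/Ptop_ind1: Ps sn hs {s0} => {}s q Ps _ Pq sn hs.
have -> : fpair (fdual g') (ntop s q) = fpair (fdual g) (lext D (ntop s q)).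
  rewrite !fpair_fdual lext_lext; apply: eq_lext_in => f /hs; rewrite sn => fn.
  by rewrite g'E fn eqxx.
pose K := msupp (ntop s q).
(* The decomposition of [s top q] forest by forest, minus [s top q]: a vanishing sum to which
   uniqueness applies. *)
pose l := (q, - s) :: flatten [seq [seq (i.1, mcoeff f (ntop s q) *: i.2) | i <- L f] | f <- K].
have := @ntop_inj _ _ _ hP l.
have lP i : i \in l -> P i.1.
  rewrite inE => /orP[/eqP -> //|/flatten_mapP[f fK /mapP[j jL ->]]].
  by have /hs := fK; rewrite sn => /HL[/(_ j jL)].
have l0 : \sum_(i <- l) ntop i.2 i.1 = 0.
  have Nn : ntop (- s) q = - ntop s q by exact: (linearN (ntopr q)).
  rewrite big_cons big_flatten big_map Nn.
  rewrite addrC; apply/eqP; rewrite subr_eq0 -[eqbRHS]lext_id; apply/eqP.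
  apply: eq_big_seq => f; rewrite -/K => /hs; rewrite sn => fn; rewrite big_map.
  have [_ fE] := HL f fn; rewrite -[mkmalgU f 1]/(e f) fE scaler_sumr.
  by apply: eq_bigr => i _; rewrite -[LHS]/(ntopr i.1 _) linearZ.
move=> /(_ lP l0 p); rewrite big_cons big_flatten big_map /=.
have -> : \sum_(f <- K)
    \sum_(i <- [seq (i.1, mcoeff f (ntop s q) *: i.2) | i <- L f] | i.1 == p) i.2 =
  lext D (ntop s q).
  apply: eq_bigr => f _; rewrite big_map scaler_sumr.
  by apply: eq_bigr.
have srp : (ntop s q == ntop r p) = (s == r) && (q == p).
  apply/eqP/andP => [E|[/eqP -> /eqP ->]//].
  by have [-> ->] := ntop_eq Ps Pq Pr Pp E; split; exact: eqxx.
rewrite srp; case: eqP => [qp|_] DE.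
  by rewrite andbT -(rg s Ps); congr fpair; apply/eqP; rewrite -subr_eq0 addrC; apply/eqP.
by rewrite DE andbF fpairE linear0.
Qed.

(** [dual] is chosen by [xget] with default 0, so its characteristic property holds only once a
    candidate is exhibited; candidates are built along the construction of [r]. *)
Lemma dualP r : Ptop1 P r -> is_dual r (dual P r).
Proof.
move=> Pr; suff [g rg] : exists g : H, is_dual r g by exact: (xgetPex 0 (ex_intro _ g rg)).
have [->|r1] := pselect (r = 1); first by exists (e (fone A)); exact: ex_dual1.
case: Pr => // {r1}; elim/Ptop_ind1 => {}r p Pr Qr Pp.
have [g rg] : exists g : H, is_dual r g.
  have [->|/Qr//] := pselect (r = 1).
  by exists (e (fone A)); exact: ex_dual1.
exact: ex_dual_top Pr Pp rg.
Qed.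

Lemma homog_dual r : Ptop1 P r -> homog (deg r) (dual P r).
Proof.
move=> Pr; have [nr r0] := Ptop1_homog Pr; apply/homogP => h hn.
have [l [lP hE]] := homog_Pspan (@homog_fbasis R A h).
have -> : mcoeff h (dual P r) = fpair (fdual (dual P r)) (e h).
  by rewrite fpair_fdual lextU.
rewrite hE fpair_sumZ big_seq big1// => i /lP[Pi ni].
rewrite (dualP Pr Pi); case: eqP => [ir|_]; last by rewrite mulr0.
by case: hn; rewrite -ir (homog_deg _ ni)// ir.
Qed.

(** Elements of P of degree at most [n] are independent vectors in the span of finitely many
    forests. If there were more of them than forests, their coefficient matrix would have a nonzero
    left kernel vector. *)
Lemma finite_P n : finite_set [set p | P p /\ (deg p <= n)%N].
Proof.
apply: contrapT => /infinite_set_fset.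
pose J := forests A n; pose m := size J.
move=> /(_ m.+1)[B BP Bm]; have [_ indep _] := hP.
set t := enum_fset B in Bm; pose b (i : 'I_(size t)) := nth 0 t i.
have tP x : x \in t -> P x /\ (deg x <= n)%N by exact: BP.
have bt i : b i \in t by apply: mem_nth; exact: ltn_ord.
pose M := \matrix_(i < size t, j < m) mcoeff (nth (fone A) J j) (b i).
have /rowV0Pn[v + v0] : kermx M != 0.
  rewrite -mxrank_eq0 mxrank_ker subn_eq0 -ltnNge.
  by apply: leq_trans Bm; rewrite ltnS; exact: rank_leq_col.
rewrite sub_kermx => /eqP vM.
pose c x := \sum_(i < size t) (b i == x)%:R * v 0 i.
have cb i : c (b i) = v 0 i.
  rewrite /c (bigD1 i)//= eqxx mul1r big1 ?addr0// => j ji.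
  by rewrite /b nth_uniq ?fset_uniq ?ltn_ord// (negbTE ji : (j == i :> nat) = false) mul0r.
case/eqP: v0; apply/rowP => i; rewrite mxE -cb.
apply: (indep t c (fset_uniq _) (fun x xt => (tP x xt).1) _ _ (bt i)).
rewrite (big_nth 0) big_mkord -/b; apply/malgP => h; rewrite mcoeff_sum mcoeff0.
have -> : \sum_(j < size t) mcoeff h (c (nth 0 t j) *: nth 0 t j) =
    \sum_(j < size t) v 0 j * mcoeff h (b j).
  by apply: eq_bigr => j _; rewrite mcoeffZ -/(b j) cb.
have [hJ|hJ] := boolP (h \in J); last first.
  rewrite big1// => j _; have [Pb bn] := tP _ (bt j); have [nb _] := P_deg Pb.
  have /homogP -> := nb; first by rewrite mulr0.
  by move=> hb; move: hJ; rewrite mem_forests hb bn.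
have jm : (index h J < m)%N by rewrite index_mem.
have /rowP/(_ (Ordinal jm)) := vM; rewrite !mxE => vMj; rewrite -[RHS]vMj.
by apply: eq_bigr => j _; rewrite mxE /= nth_index.
Qed.

Lemma finite_Ptop1 n : finite_set [set r | Ptop1 P r /\ (deg r <= n)%N].
Proof.
have [m] := ubnP n; elim: m n => // m IHm n nm.
apply: (@sub_finite_set _ _ ([set 1] `|` ((fun i => ntop i.1 i.2) @`
   ([set r | Ptop1 P r /\ (deg r <= n.-1)%N /\ (0 < n)%N] `*` [set p | P p /\ (deg p <= n)%N])))).
  move=> r [[->|Pr] rn]; [by left|right].
  elim/Ptop_ind1: Pr rn => {}r p Pr _ Pp; rewrite deg_ntop// => rpn.
  have [_ p0] := P_deg Pp.
  by exists (r, p) => //=; split=> //=; split=> //; [split; lia|lia].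
rewrite finite_setU; split; first exact: finite_set1.
apply: finite_image; apply: finite_setX; last exact: finite_P.
case: n nm => [|n] nm; first by apply: (@sub_finite_set _ _ set0) => // r [_ []].
by apply: sub_finite_set (IHm n nm) => r [? []].
Qed.

Definition Ptop1s n : seq H := fset_set [set r | Ptop1 P r /\ (deg r <= n)%N].

Definition Ps n : seq H := fset_set [set p | P p /\ (deg p <= n)%N].

Lemma Ptop1sP n r : (r \in Ptop1s n) <-> (Ptop1 P r /\ (deg r <= n)%N).
Proof.
rewrite in_fset_set; last exact: finite_Ptop1.
by split=> [/set_mem|/mem_set].
Qed.

Lemma PsP n p : (p \in Ps n) <-> (P p /\ (deg p <= n)%N).
Proof.
rewrite in_fset_set; last exact: finite_P.
by split=> [/set_mem|/mem_set].
Qed.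

Lemma Ptop1_expand n (phi : forest A -> R) f : (fsize f <= n)%N ->
  \sum_(r <- Ptop1s n) fpair phi r * mcoeff f (dual P r) = phi f.
Proof.
move=> fn; have fE r : mcoeff f (dual P r) = fpair (fdual (dual P r)) (e f).
  by rewrite fpair_fdual lextU.
have [l [lP lE]] := homog_Pspan (@homog_fbasis R A f).
under eq_bigr do rewrite fE lE fpair_sumZ mulr_sumr.
rewrite exchange_big; have -> : phi f = fpair phi (e f) by rewrite fpairE lextU.
rewrite lE fpair_sumZ !big_seq; apply: eq_bigr => i /lP[Pi ni].
have [_ i0] := Ptop1_homog Pi.
have iT : i.2 \in Ptop1s n by apply/Ptop1sP; rewrite (homog_deg i0 ni).
rewrite (bigD1_seq i.2) ?fset_uniq//= big_seq_cond big1 ?addr0.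
  by rewrite (dualP Pi Pi) eqxx mulr1 mulrC.
move=> r /andP[/Ptop1sP[Pr _] ri]; rewrite (dualP Pr Pi).
by rewrite eq_sym (negbTE ri) !mulr0.
Qed.

(** For a basis element [r] other than 1, [r top q] is a basis element different from [p = 1 top p];
    so only the constant term of [x] counts. *)
Lemma dual_P_ntop p q x : P p -> P q ->
  fpair (fdual (dual P p)) (ntop x q) = (q == p)%:R * mcoeff (fone A) x.
Proof.
move=> Pp Pq; have P1p : Ptop1 P p by right; exact: Ptop_one.
rewrite ntop_lext fpairE lext_lext -[RHS]mulrC -[RHS]/(mcoeff (fone A) x *: ((q == p)%:R : R^o)).
rewrite -lext_delta; apply: eq_lext => f.
have [l [lP lE]] := homog_Pspan (@homog_fbasis R A f).
have [->|f1] := eqVneq f (fone A).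
  rewrite scale1r -one_fbasis (ntop1P Pq) -fpairE (dualP P1p)//.
  by right; exact: Ptop_one.
rewrite lE; have -> : ntop (\sum_(i <- l) i.1 *: i.2) q = \sum_(i <- l) i.1 *: ntop i.2 q.
  rewrite -[LHS]/(ntopr q _) linear_sum; apply: eq_bigr => i _.
  by rewrite linearZ.
rewrite -fpairE fpair_sumZ scale0r big_seq big1// => i /lP[Pi ni].
rewrite (dualP P1p); last by right; exact: Ptop1_top.
case: eqP => [E|_]; last by rewrite mulr0.
have P1 : Ptop1 P 1 by left.
have := ntop_eq Pi Pq P1 Pp; rewrite (ntop1P Pp) => /(_ E)[i1 _].
have [_ i0] := Ptop1_homog Pi; move: ni; rewrite i1 => ni.
by move: f1; rewrite -fsize_eq0 -(homog_deg _ ni) ?deg1// -i1.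
Qed.

(* In functional form: every x satisfies
   x - x(1) 1 = \sum_p (id (x) p^* ) (Delta x) top p. *)
Lemma P_expand n (phi : forest A -> R) f : (fsize f <= n)%N ->
  \sum_(p <- Ps n) \sum_(u <- cop f) fpair phi (ntop (e u.1) p) * mcoeff u.2 (dual P p) =
  phi f - phi (fone A) * (f == fone A)%:R.
Proof.
move=> fn; have [l [lP lE]] := homog_Pspan (@homog_fbasis R A f).
pose F p (u : forest A * forest A) : R^o := fpair phi (ntop (e u.1) p) * mcoeff u.2 (dual P p).
transitivity (\sum_(p <- Ps n) copair (F p) (e f)).
  by apply: eq_bigr => p _; rewrite /copair lextU.
have -> : phi f - phi (fone A) * (f == fone A)%:R =
    fpair phi (e f) - phi (fone A) * mcoeff (fone A) (e f).
  by rewrite fpairE lextU fbasis_coef.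
rewrite lE mcoeff_sum mulr_sumr fpair_sumZ -sumrB.
have cpE p : copair (F p) (\sum_(i <- l) i.1 *: i.2) = \sum_(i <- l) i.1 * copair (F p) i.2.
  by rewrite linear_sum; apply: eq_bigr => i _; rewrite linearZ.
under eq_bigr do rewrite cpE.
rewrite exchange_big !big_seq; apply: eq_bigr => i /lP[Pi ni].
rewrite -mulr_sumr mcoeffZ mulrCA -mulrBr; congr (_ * _).
have [_ i0] := Ptop1_homog Pi.
have : (deg i.2 <= n)%N by rewrite (homog_deg i0 ni).
case: Pi => [->|Pi] idn.
  rewrite one_fbasis fpairU fbasis_coef eqxx mulr1 subrr big_seq big1// => p /PsP[Pp _].
  rewrite /copair lextU cop_fone /F /=; have [np p0] := P_deg Pp.
  have -> : mcoeff (fone A) (dual P p) = 0.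
    have P1p : Ptop1 P p by right; exact: Ptop_one.
    by have /homogP -> := homog_dual P1p; rewrite ?fsize1//; lia.
  exact: mulr0.
have [m m0 [mi _]] := Ptop_homog Pi.
have -> : mcoeff (fone A) i.2 = 0 by have /homogP -> := mi; rewrite ?fsize1//; lia.
rewrite mulr0 subr0; elim/Ptop_ind1: Pi idn {lP lE ni i0 m m0 mi} => {}i q Pi _ Pq.
rewrite deg_ntop// => idn.
(* In the cocycle formula, pairing the second factor with [p^*] kills every cut with nonempty second
   factor and forces [q = p]; the counit then returns [i]. *)
have copF p : p \in Ps n -> copair (F p) (ntop i q) = (q == p)%:R * fpair phi (ntop i p).
  move=> /PsP[Pp _]; have [np p0] := P_deg Pp; have [nq _] := P_deg Pq.
  have P1p : Ptop1 P p by right; exact: Ptop_one.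
  rewrite (ntop_cocycle _ _ (P_prim hP Pq) nq).
  have d1 : mcoeff (fone A) (dual P p) = 0.
    by have /homogP -> := homog_dual P1p; rewrite ?fsize1//; lia.
  rewrite (@eq_lext _ _ _ _ (fun=> 0)) ?lext0 ?add0r; last by move=> h; rewrite /F /= d1 mulr0.
  rewrite [in RHS]ntop_lext fpairE lext_lext -[RHS]/(_ *: (_ : R^o)) -lextZ; apply: eq_lext => f'.
  transitivity (\sum_(u <- cop f' | u.2 == fone A)
    (q == p)%:R * fpair phi (ntop (e u.1) p)); last first.
    by rewrite (cop_fone_snd (fun u => (q == p)%:R * fpair phi (ntop (e u.1) p))).
  rewrite [RHS]big_mkcond; apply: eq_bigr => u _.
  have -> : lext (fun g => F p (u.1, g)) (ntop (e u.2) q) =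
      fpair phi (ntop (e u.1) p) * fpair (fdual (dual P p)) (ntop (e u.2) q).
    exact: (lextZ (fpair phi (ntop (e u.1) p)) (fun g => mcoeff g (dual P p) : R^o)
      (ntop (e u.2) q)).
  rewrite (dual_P_ntop _ Pp Pq) fbasis_coef.
  by case: (u.2 =P _) => _; rewrite ?mulr1 ?mulr0 // mulrC.
rewrite (eq_big_seq _ copF).
have qT : q \in Ps n by apply/PsP; split=> //; lia.
rewrite (bigD1_seq q) ?fset_uniq//= eqxx mul1r big1 ?addr0// => p pq.
by rewrite eq_sym (negbTE pq) mul0r.
Qed.

End DualBasis.

(** * Sewing *)

Section Sewing.
Variable R : realType.
Implicit Types (a b s t u d : R) (p q r : seq R) (Xi : R -> R -> R).

Definition riemann Xi a p := \sum_(I <- pieces a p) Xi I.1 I.2.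

Definition fine d a p := forall I, I \in pieces a p -> I.2 - I.1 <= d.

Lemma riemann_cons Xi a x p : riemann Xi a (x :: p) = Xi a x + riemann Xi x p.
Proof. by rewrite /riemann /pieces /= big_cons. Qed.

Lemma riemann_nil Xi a : riemann Xi a [::] = 0.
Proof. by rewrite /riemann big_nil. Qed.

Lemma riemann_cat Xi a p q :
  riemann Xi a (p ++ q) = riemann Xi a p + riemann Xi (last a p) q.
Proof.
elim: p a => [|x p IHp] a /=; first by rewrite riemann_nil add0r.
by rewrite !riemann_cons IHp addrA.
Qed.

Lemma pieces_cat a p q : pieces a (p ++ q) = pieces a p ++ pieces (last a p) q.
Proof. by elim: p a => //= x p IHp a; rewrite /pieces /= -/(pieces x _) IHp. Qed.

Lemma fine_mesh a p : fine (mesh a p) a p.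
Proof.
rewrite /fine /mesh; elim: (pieces a p) => //= J l IHl I.
by rewrite inE big_cons le_max => /orP[/eqP ->|/IHl ->]; rewrite ?lexx ?orbT.
Qed.

Lemma mesh_ge0 a p : 0 <= mesh a p.
Proof.
by rewrite /mesh; elim: (pieces a p) => [|I l IHl]; rewrite ?big_nil// big_cons le_max IHl orbT.
Qed.

Lemma le_mesh d a p : 0 <= d -> fine d a p -> mesh a p <= d.
Proof.
move=> d0 dp; rewrite /mesh big_seq; elim/big_ind: _ => // x y.
by rewrite ge_max => -> ->.
Qed.

Lemma fine_cat d a p q : fine d a p -> fine d (last a p) q -> fine d a (p ++ q).
Proof. by move=> dp dq I; rewrite pieces_cat mem_cat => /orP[/dp|/dq]. Qed.

Lemma fine_partition d a t : 0 < d -> a <= t ->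
  exists2 p, itv_partition a t p & fine d a p.
Proof.
move=> d0; have [n] : exists n : nat, t - a <= d *+ n.
  exists (Num.truncn ((t - a) / d)).+1; rewrite -mulr_natr mulrC -ler_pdivrMr//.
  exact/ltW/truncnS_gt.
elim: n a => [|n IHn] a nt.
  move: nt; rewrite mulr0n subr_le0 => ta at_.
  by exists [::]; [split=> //=; rewrite eq_le at_ ta|].
rewrite le_eqVlt => /predU1P[->|at_]; first by exists [::] => //; split => /=.
have [td|dt] := leP (t - a) d.
  by exists [:: t]; [split => //=; rewrite at_|move=> I; rewrite inE => /eqP ->].
have [||p [pa pt] dp] := IHn (a + d).
- by rewrite mulrS in nt; lra.
- by lra.
exists (a + d :: p); first by split => //=; rewrite pa andbT; lra.
move=> I; rewrite /pieces /= inE => /orP[/eqP -> /=|/dp//].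
by rewrite addrC addKr.
Qed.

Lemma le_last_path a p x : path <%R a p -> x \in a :: p -> x <= last a p.
Proof.
elim: p a x => [|y p IHp] a x /=; first by rewrite inE => _ /eqP ->.
move=> /andP[ay py]; rewrite inE => /orP[/eqP ->|/(IHp _ _ py)//].
exact: le_trans (ltW ay) (IHp _ _ py (mem_head _ _)).
Qed.

Lemma refine_cons a x p r : path <%R a (x :: p) -> path <%R a r ->
    {subset x :: p <= r} ->
  exists r1 r2, [/\ r = rcons r1 x ++ r2, path <%R a (rcons r1 x), path <%R x r2 &
    {subset p <= r2}].
Proof.
move=> /= /andP[ax xp] ar pr; have xr : x \in r by apply: pr; rewrite mem_head.
case/path.splitP: xr ar pr => r1 r2; rewrite cat_path last_rcons => /andP[ar1 xr2] pr.
exists r1, r2; split=> // y yp.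
have xy : x < y by move/(order_path_min lt_trans)/allP/(_ y yp): xp.
have := pr y; rewrite inE yp orbT mem_cat => /(_ isT)/orP[yr1|//].
have := @le_last_path a (rcons r1 x) y ar1; rewrite inE yr1 orbT last_rcons.
by move=> /(_ isT); rewrite leNgt xy.
Qed.

Lemma common_refinement a b p q : itv_partition a b p -> itv_partition a b q ->
  exists r, [/\ itv_partition a b r, {subset p <= r} & {subset q <= r}].
Proof.
move=> [ap lp] [aq lq]; pose r := sort <=%R (undup (p ++ q)).
have mr x : (x \in r) = (x \in p) || (x \in q) by rewrite mem_sort mem_undup mem_cat.
exists r; split; [|by move=> x xp; rewrite mr xp|by move=> x xq; rewrite mr xq orbT].
have ar : path <%R a r.
  rewrite lt_path_sortedE sort_lt_sorted undup_uniq andbT; apply/allP => x.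
  rewrite mr => /orP[].
    by move/(order_path_min lt_trans)/allP : ap => /[apply].
  by move/(order_path_min lt_trans)/allP : aq => /[apply].
split=> //; rewrite eq_le; apply/andP; split.
  have := mem_last a r; rewrite inE => /predU1P[->|].
    by rewrite -(eqP lp); apply: le_last_path => //; exact: mem_head.
  rewrite mr => /orP[xp|xq].
    by rewrite -[leRHS](eqP lp); apply: le_last_path => //; rewrite inE xp orbT.
  by rewrite -[leRHS](eqP lq); apply: le_last_path => //; rewrite inE xq orbT.
apply: le_last_path => //; rewrite inE mr.
by have := mem_last a p; rewrite (eqP lp) inE => /orP[] ->; rewrite ?orbT.
Qed.

Lemma powR_le (alpha d d' : R) : 0 <= alpha -> 0 <= d -> d <= d' ->
  d `^ alpha <= d' `^ alpha.
Proof.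
move=> a0 d0 dd'; apply: ge0_ler_powR; rewrite ?nnegrE//.
exact: le_trans dd'.
Qed.

Section SewingLemma.
Variables (alpha K a b : R) (Xi : R -> R -> R).
Hypotheses (alpha0 : 0 < alpha) (K0 : 0 <= K).
Hypothesis XiK : forall s u t, a <= s -> s <= u -> u <= t -> t <= b ->
  `|Xi s t - Xi s u - Xi u t| <= K * ((t - s) * (t - s) `^ alpha).
Local Definition w d : R := d `^ alpha.
Local Definition lam : R := 2^-1 `^ alpha.

Lemma sewing_lam_lt1 : lam < 1.
Proof.
suff : lam < 1 `^ alpha by rewrite powR1.
by rewrite /lam gt0_ltr_powR ?nnegrE//; lra.
Qed.

(** Makes [M] the fixed point of [M = M * lam + 2 * K]: the two halves of a partition contribute
    [lam / 2] each, and inserting the two division points costs [K] twice. *)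
Definition sewing_const : R := 2 / (1 - lam).
Local Definition M : R := sewing_const * K.

Lemma sewing_const_ge0 : 0 <= sewing_const.
Proof. by rewrite divr_ge0// subr_ge0 ltW// sewing_lam_lt1. Qed.

Local Lemma M0 : 0 <= M. Proof. by rewrite mulr_ge0// sewing_const_ge0. Qed.

Local Lemma ME : M * lam + 2 * K = M.
Proof.
have l1 := sewing_lam_lt1; rewrite /M /sewing_const.
by field; rewrite subr_eq0 gt_eqF.
Qed.

Local Lemma w_half d : 0 <= d -> d / 2 * w (d / 2) = d * w d * (lam / 2).
Proof. by move=> d0; rewrite /w powRM// ?invr_ge0//; rewrite -/lam; ring. Qed.

Local Lemma w_le d d' : 0 <= d -> d <= d' -> w d <= w d'.
Proof. exact: powR_le (ltW alpha0). Qed.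

Local Lemma ww_le d d' : 0 <= d -> d <= d' -> d * w d <= d' * w d'.
Proof.
move=> d0 dd'; apply: ler_pM => //; first exact: powR_ge0.
exact: w_le.
Qed.

(* Split at the two consecutive points u, x of the partition that enclose the
   midpoint: the partitions of [s, u] and [x, t] live on intervals of at most half
   the length, where the bound gains a factor lam / 2 < 1 / 2. *)
Lemma sewing_max s p : a <= s -> path <%R s p -> last s p <= b ->
  `|riemann Xi s p - Xi s (last s p)| <=
    M * ((last s p - s) * (last s p - s) `^ alpha).
Proof.
have [n] := ubnP (size p); elim: n s p => // n IHn s [|y p] /=.
  move=> _ as_ _ sb; rewrite riemann_nil add0r normrN subrr mul0r mulr0.
  by have := XiK as_ (lexx s) (lexx s) sb; rewrite !subrr mul0r mulr0 sub0r normrN.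
rewrite ltnS => pn as_ sp tb; set t := last y p in tb *.
have st : s < t.
  by case/andP: sp => sy yp; apply: lt_le_trans sy _; apply: le_last_path => //; exact: mem_head.
pose mid := (s + t) / 2; have hm : has (fun x => mid < x) (y :: p).
  by apply/hasP; exists t; [exact: mem_last|rewrite /mid; lra].
have tE : t = last s (y :: p) by [].
move: tE sp pn; rewrite -[(_ < _) && _]/(path <%R s (y :: p)).
rewrite -[(size p < n)%N]/(size (y :: p) <= n)%N.
case/split_find: hm => x p1 p2 midx hp1; rewrite last_cat last_rcons => tE.
rewrite cat_path rcons_path last_rcons => /andP[/andP[sp1 ux] xp2].
rewrite size_cat size_rcons addSn => pn.
set u := last s p1 in ux.
have su : s <= u by apply: le_last_path => //; exact: mem_head.
have umid : u <= mid.
  have := mem_last s p1; rewrite -/u inE => /predU1P[->|up1]; first by rewrite /mid; lra.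
  by rewrite leNgt; apply/negP => um; move/negP: hp1; apply; apply/hasP; exists u.
have xt : x <= t by rewrite tE; apply: le_last_path => //; exact: mem_head.
have I1 := IHn s p1 _ as_ sp1 _; rewrite -/u in I1.
have I2 := IHn x p2 _ _ xp2 _; rewrite -tE in I2.
have {}I1 : `|riemann Xi s p1 - Xi s u| <= M * ((t - s) * w (t - s) * (lam / 2)).
  apply: le_trans (I1 _ _) _; [by rewrite (leq_ltn_trans (leq_addr _ _) pn)|by lra|].
  rewrite ler_wpM2l ?M0// -w_half; last by lra.
  by apply: ww_le; rewrite /mid in umid; lra.
have {}I2 : `|riemann Xi x p2 - Xi x t| <= M * ((t - s) * w (t - s) * (lam / 2)).
  apply: le_trans (I2 _ _ _) _ => //; [by rewrite (leq_ltn_trans (leq_addl _ _) pn)|by lra|].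
  rewrite ler_wpM2l ?M0// -w_half; last by lra.
  by apply: ww_le; rewrite /mid in midx; lra.
have D1 : `|Xi s x - Xi s u - Xi u x| <= K * ((t - s) * w (t - s)).
  apply: le_trans (XiK as_ su (ltW ux) _) _; first by lra.
  by rewrite ler_wpM2l ?M0//; apply: ww_le; lra.
have D2 : `|Xi s t - Xi s x - Xi x t| <= K * ((t - s) * w (t - s)).
  by apply: XiK => //; lra.
rewrite cat_rcons riemann_cat riemann_cons -/u.
have -> : riemann Xi s p1 + (Xi u x + riemann Xi x p2) - Xi s t =
    (riemann Xi s p1 - Xi s u) + (riemann Xi x p2 - Xi x t)
    - (Xi s x - Xi s u - Xi u x) - (Xi s t - Xi s x - Xi x t) by ring.
set W := (t - s) * w (t - s) in I1 I2 D1 D2 *.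
have -> : M * W = M * (W * (lam / 2)) + M * (W * (lam / 2)) + K * W + K * W.
  by rewrite -[in LHS]ME; field.
do 2 ?[apply: le_trans (ler_normB _ _) _; apply: lerD => //].
by apply: le_trans (ler_normD _ _) _; apply: lerD.
Qed.

Lemma sum_pieces_le d s p : path <%R s p -> fine d s p ->
  \sum_(I <- pieces s p) M * ((I.2 - I.1) * w (I.2 - I.1)) <= M * (w d * (last s p - s)).
Proof.
elim: p s => [|x p IHp] s /=; first by rewrite /pieces big_nil subrr !mulr0.
move=> /andP[sx xp] sd; rewrite /pieces /= big_cons /=.
have /IHp {}IHp : fine d x p by move=> I Ip; apply: sd; rewrite /pieces /= inE Ip orbT.
have xsd : x - s <= d by apply: (sd (s, x)); rewrite mem_head.
apply: le_trans (lerD (lexx _) (IHp xp)) _.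
rewrite -mulrDr ler_wpM2l ?M0//.
have -> : w d * (last x p - s) = (x - s) * w d + w d * (last x p - x) by ring.
rewrite lerD2r ler_wpM2l//; first by lra.
by apply: w_le; lra.
Qed.

Lemma sewing_refine s p r : a <= s -> path <%R s p -> path <%R s r ->
    {subset p <= r} -> last s r = last s p -> last s p <= b ->
  `|riemann Xi s r - riemann Xi s p| <=
    \sum_(I <- pieces s p) M * ((I.2 - I.1) * w (I.2 - I.1)).
Proof.
elim: p s r => [|x p IHp] s r as_ sp sr pr lr lb.
  have -> : r = [::].
    case: r sr {pr} lr => //= y r /andP[sy yr] ys.
    by have := lt_le_trans sy (le_last_path yr (mem_head _ _)); rewrite ys ltxx.
  by rewrite riemann_nil subrr normr0 /pieces big_nil.
have [r1 [r2 [rE sr1 xr2 pr2]]] := refine_cons sp sr pr.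
move: sp lb => /= /andP[sx xp] lb.
rewrite rE riemann_cat last_rcons riemann_cons /pieces /= big_cons /=.
have xl : x <= last x p by apply: le_last_path => //; exact: mem_head.
have -> : riemann Xi s (rcons r1 x) + riemann Xi x r2 - (Xi s x + riemann Xi x p) =
  (riemann Xi s (rcons r1 x) - Xi s x) + (riemann Xi x r2 - riemann Xi x p) by ring.
apply: le_trans (ler_normD _ _) _; apply: lerD.
  have := @sewing_max s (rcons r1 x) as_ sr1; rewrite last_rcons; apply; lra.
apply: IHp => //; first by lra.
by move: lr; rewrite rE last_cat last_rcons.
Qed.

(** Through a common refinement, every [riemann Xi s p - c p] lies below every
    [riemann Xi s q + c q]. The supremum of the former is therefore within [c p] of each sum, and no
    sequence of partitions has to be chosen. *)
Lemma sewing_integral s t : a <= s -> s <= t -> t <= b -> exists J, forall p d,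
  itv_partition s t p -> fine d s p -> `|riemann Xi s p - J| <= M * (w d * (t - s)).
Proof.
move=> as_ st tb; pose c p := M * (w (mesh s p) * (t - s)).
have cmp p q : itv_partition s t p -> itv_partition s t q ->
    riemann Xi s p - c p <= riemann Xi s q + c q.
  move=> sp sq; have [r [[sr rt] pr qr]] := common_refinement sp sq.
  have H p' : itv_partition s t p' -> {subset p' <= r} ->
      `|riemann Xi s r - riemann Xi s p'| <= c p'.
    move=> [sp' pt'] p'r; apply: le_trans (sewing_refine as_ sp' sr p'r _ _) _.
    - by rewrite (eqP rt) (eqP pt').
    - by rewrite (eqP pt').
    by have := sum_pieces_le sp' (@fine_mesh s p'); rewrite (eqP pt').
  have := H p sp pr; have := H q sq qr; rewrite !ler_norml; lra.
pose E := [set riemann Xi s p - c p | p in itv_partition s t].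
have [p0 sp0 _] := @fine_partition 1 s t ltr01 st.
have E0 : E !=set0 by exists (riemann Xi s p0 - c p0); exists p0.
have Eq q : itv_partition s t q -> ubound E (riemann Xi s q + c q).
  by move=> sq _ [p sp <-]; exact: cmp.
exists (sup E) => p d sp pd.
have [lo hi] : riemann Xi s p - c p <= sup E /\ sup E <= riemann Xi s p + c p.
  split; last by apply: ge_sup => //; exact: Eq.
  apply: ub_le_sup; first by exists (riemann Xi s p + c p); exact: Eq.
  by exists p.
have cd : c p <= M * (w d * (t - s)).
  (* An empty partition means [s = t]; any other one forces [0 <= d]. *)
  have [p_nil|p_n0] := eqVneq p [::].
    move: sp; rewrite /c p_nil => -[_ /= /eqP ->].
    by rewrite subrr !mulr0.
  have d0 : 0 <= d.
    case: p sp pd p_n0 {lo hi} => // x p [/= /andP[sx _] _] pd _.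
    have := pd (s, x); rewrite /pieces /= mem_head => /(_ isT) /=; lra.
  rewrite ler_wpM2l ?M0// ler_wpM2r//; first by lra.
  by apply: w_le; [exact: mesh_ge0|exact: le_mesh].
by rewrite ler_norml; apply/andP; split; lra.
Qed.

Lemma powR_small e : 0 < e -> exists2 d : R, 0 < d & w d <= e.
Proof.
move=> e0; exists (e `^ alpha^-1); first exact: powR_gt0.
by rewrite /w -powRrM mulVf ?gt_eqF// powRr1// ltW.
Qed.

Lemma riemann_limit_unique s t (I1 I2 c : R) : s <= t -> 0 <= c ->
  (forall d, 0 < d -> exists2 x : R, `|x - I1| <= c * w d & `|x - I2| <= c * w d) ->
  I1 = I2.
Proof.
move=> st c0 H; apply/eqP; rewrite -subr_eq0 -normr_le0; apply/ler_addgt0Pl => e e0.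
rewrite addr0; have [d d0 de] := @powR_small (e / (2 * (c + 1))) ltac:(by rewrite divr_gt0//; lra).
have [x x1 x2] := H d d0.
have -> : I1 - I2 = (x - I2) - (x - I1) by ring.
apply: le_trans (ler_normB _ _) _; apply: le_trans (lerD x2 x1) _.
rewrite -mulrDr -[leRHS]mul1r; have -> : 1 * e = (c + 1) * (e / (2 * (c + 1)) + e / (2 * (c + 1))).
  by field; lra.
by apply: ler_pM => //; [rewrite addr_ge0// powR_ge0|lra|apply: lerD].
Qed.

(** The sum over concatenated fine partitions of [[s, u]] and [[u, t]] approximates both sides. *)
Lemma sewing_add s u t (I1 I2 I3 : R) : a <= s -> s <= u -> u <= t -> t <= b ->
  (forall p d, itv_partition s u p -> fine d s p ->
    `|riemann Xi s p - I1| <= M * (w d * (u - s))) ->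
  (forall p d, itv_partition u t p -> fine d u p ->
    `|riemann Xi u p - I2| <= M * (w d * (t - u))) ->
  (forall p d, itv_partition s t p -> fine d s p ->
    `|riemann Xi s p - I3| <= M * (w d * (t - s))) ->
  I3 = I1 + I2.
Proof.
move=> as_ su ut tb H1 H2 H3; have M0' := M0.
apply: (@riemann_limit_unique s t _ _ (M * (t - s))); first by lra.
  by rewrite mulr_ge0//; lra.
move=> d d0; have [p sp pd] := fine_partition d0 su; have [q uq qd] := fine_partition d0 ut.
have [_ /eqP pu] := sp.
have spq : itv_partition s t (p ++ q) by exact: itv_partition_cat sp uq.
have pqd : fine d s (p ++ q) by apply: fine_cat => //; rewrite pu.
exists (riemann Xi s (p ++ q)); first by rewrite mulrAC -mulrA; exact: H3.
rewrite riemann_cat pu.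
have -> : riemann Xi s p + riemann Xi u q - (I1 + I2) =
  (riemann Xi s p - I1) + (riemann Xi u q - I2) by ring.
apply: le_trans (ler_normD _ _) _; apply: le_trans (lerD (H1 _ _ sp pd) (H2 _ _ uq qd)) _.
by rewrite -mulrDr -mulrDr -mulrA ler_wpM2l// mulrC; have := powR_ge0 d alpha; rewrite -/(w d); nra.
Qed.

Theorem sewing : exists J : R -> R, [/\ J a = 0,
    forall s t, a <= s -> s <= t -> t <= b ->
      `|J t - J s - Xi s t| <= M * ((t - s) * (t - s) `^ alpha) &
    forall t p d, a <= t -> t <= b -> itv_partition a t p -> fine d a p ->
      `|riemann Xi a p - J t| <= M * (d `^ alpha * (t - a))].
Proof.
have /choice[I HI] (st : R * R) : exists J, a <= st.1 -> st.1 <= st.2 -> st.2 <= b ->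
    forall p d, itv_partition st.1 st.2 p -> fine d st.1 p ->
      `|riemann Xi st.1 p - J| <= M * (w d * (st.2 - st.1)).
  have [/and3P[as_ ss sb]|n] := boolP [&& a <= st.1, st.1 <= st.2 & st.2 <= b].
    have [J HJ] := sewing_integral as_ ss sb; exists J => _ _ _; exact: HJ.
  by exists 0 => h1 h2 h3; move: n; rewrite h1 h2 h3.
exists (fun t => if a <= b then I (a, t) else 0); split.
- case: ifP => // ab; have := HI (a, a) (lexx _) (lexx _) ab [::] 0.
  rewrite /= riemann_nil sub0r normrN subrr !mulr0.
  by move=> /(_ _ _)H; apply/eqP; rewrite -normr_le0; apply: H => //; split=> /=.
- move=> s t as_ st tb; have at_ := le_trans as_ st; rewrite (le_trans at_ tb).
  have sb := le_trans st tb.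
  have -> : I (a, t) - I (a, s) = I (s, t).
    rewrite (@sewing_add a s t (I (a, s)) (I (s, t)) (I (a, t)) (lexx a) as_ st tb
      (HI (a, s) (lexx a) as_ sb) (HI (s, t) as_ st tb) (HI (a, t) (lexx a) at_ tb)).
    by rewrite addrC addKr.
  move: st; rewrite le_eqVlt => /predU1P[st|st].
    have := HI (s, t) as_ _ tb [::] 0; have := XiK as_ (lexx s) (lexx s) sb.
    rewrite -st /= riemann_nil !sub0r !normrN !subrr mul0r !mulr0 sub0r normrN !normr_le0.
    by move=> /eqP -> H; rewrite subr0; apply: H => //; split=> /=.
  (* The partition of [[s, t]] into a single interval turns the convergence rate into the estimate
     of increments. *)
  rewrite distrC; have := HI (s, t) as_ (ltW st) tb [:: t] (t - s).
  rewrite riemann_cons riemann_nil addr0 [_ * (_ - _)]mulrC; apply.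
    by split; rewrite //= st.
  by move=> i; rewrite /pieces /= inE => /eqP ->.
- move=> t p d at_ tb pt pd; rewrite (le_trans at_ tb).
  exact: (HI (a, t) (lexx a) at_ tb).
Qed.

End SewingLemma.

End Sewing.

(** * Remainders and germs *)

Section StarAlgebra.
Variables (R : realType) (A : finType).
Local Notation H := (malg (forest A) R).
Local Notation e := (fbasis R).
Implicit Types (x y p q r : H) (f g h k : forest A) (n : nat) (phi psi G : forest A -> R).

Lemma fpair_delta h x : fpair (delta R h) x = mcoeff h x.
Proof.
have := lext_delta (1 : R^o) h x; rewrite -[RHS]/(_ * 1 : R) mulr1 => <-.
apply: eq_lext => k; rewrite -[RHS]/(_ * 1 : R) mulr1 /delta /fdual fbasis_coef.
by rewrite eq_sym.
Qed.

Lemma fpair_forests n phi x : (forall k, k \in msupp x -> (fsize k <= n)%N) ->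
  fpair phi x = \sum_(k <- forests A n) mcoeff k x * phi k.
Proof.
move=> xn; rewrite fpairE (@lextEw _ _ _ (forests A n)) ?forests_uniq// => k /xn.
by rewrite mem_forests.
Qed.

Lemma eq_fpair phi psi x : (forall k, k \in msupp x -> phi k = psi k) ->
  fpair phi x = fpair psi x.
Proof. exact: (@eq_lext_in _ _ _ (phi : _ -> R^o)). Qed.

Lemma fpairD phi x y : fpair phi (x + y) = fpair phi x + fpair phi y.
Proof. exact: (lextDr (phi : _ -> R^o)). Qed.

Lemma fpair_suml (I : Type) (s : seq I) (c : I -> R) (F : I -> forest A -> R) x :
  fpair (fun f => \sum_(i <- s) c i * F i f) x = \sum_(i <- s) c i * fpair (F i) x.
Proof.
rewrite fpairE (lext_sum s xpredT (fun i f => c i * F i f : R^o)).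
by apply: eq_bigr => i _; rewrite (lextZ (c i) (F i : _ -> R^o)).
Qed.

Lemma starA phi psi chi : star (star phi psi) chi =1 star phi (star psi chi).
Proof.
move=> h; rewrite /star.
under eq_bigr do rewrite mulr_suml.
under [RHS]eq_bigr do rewrite mulr_sumr.
rewrite (coassoc (fun a b c => phi a * psi b * chi c)).
by apply: eq_bigr => u _; apply: eq_bigr => v _; rewrite mulrA.
Qed.

Lemma eq_star phi phi' psi psi' : phi =1 phi' -> psi =1 psi' ->
  star phi psi =1 star phi' psi'.
Proof. by move=> e1 e2 h; apply: eq_bigr => u _; rewrite e1 e2. Qed.

Lemma star_sumr (I : Type) (s : seq I) (c : I -> R) phi (F : I -> forest A -> R) k :
  star phi (fun f => \sum_(i <- s) c i * F i f) k = \sum_(i <- s) c i * star phi (F i) k.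
Proof.
rewrite /star; under eq_bigr do rewrite mulr_sumr.
rewrite exchange_big; apply: eq_bigr => i _; rewrite mulr_sumr.
by apply: eq_bigr => u _; rewrite mulrCA.
Qed.

Lemma fpair_star phi psi x :
  fpair (star phi psi) x = copair (fun u => phi u.1 * psi u.2 : R^o) x.
Proof. by []. Qed.

Lemma deltaE h k : delta R h k = (h == k)%:R.
Proof. by rewrite /delta /fdual fbasis_coef. Qed.

Lemma star_eq0 phi G k : (forall u, u \in cop k -> G u.2 = 0) -> star phi G k = 0.
Proof. by move=> G0; rewrite /star big_seq big1// => u /G0 ->; rewrite mulr0. Qed.

Lemma star_delta_lt phi h k : (fsize k < fsize h)%N -> star phi (delta R h) k = 0.
Proof.
move=> kh; apply: star_eq0 => u /fsize_cop uk; rewrite deltaE.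
case: eqP => // hu; move: kh; rewrite -uk -hu; lia.
Qed.

(** Together with [star_delta_lt]: convolution by a functional with value 1 at [fone] is
    unitriangular in the degree, which permits a recursion by decreasing degree. *)
Lemma star_delta_eq phi h k : phi (fone A) = 1 -> fsize k = fsize h ->
  star phi (delta R h) k = (k == h)%:R.
Proof.
move=> phi1 kh; rewrite eq_sym -(deltaE h k) -[RHS]mul1r -phi1.
rewrite -(cop_fone_fst (fun u => phi u.1 * delta R h u.2)) [RHS]big_mkcond.
rewrite /star !big_seq; apply: eq_bigr => u /fsize_cop uk.
case: eqP => // /eqP; rewrite -fsize_eq0 deltaE => u1.
case: (h =P _) => [hu|_] /=; last by rewrite mulr0.
by move: uk; rewrite kh hu => /eqP; rewrite -[eqbRHS]add0n eqn_add2r (negbTE u1).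
Qed.

Lemma star_expand n phi G k : (fsize k <= n)%N ->
  star phi G k = \sum_(j <- forests A n) G j * star phi (delta R j) k.
Proof.
move=> kn; rewrite -star_sumr /star !big_seq; apply: eq_bigr => u /fsize_cop uk.
congr (_ * _); rewrite (bigD1_seq u.2) ?forests_uniq//=; last first.
  by rewrite mem_forests (leq_trans _ kn)// -uk leq_addl.
rewrite deltaE eqxx mulr1 big1 ?addr0// => j ju.
by rewrite deltaE (negbTE ju) mulr0.
Qed.

Section Remainder.
Variables (X : R -> R -> forest A -> R) (n : nat).

(** Expanding [G] in forests, up to the degree of the paths, reduces an arbitrary functional to
    single remainders; the germs need this for the product of [r^*], [p^*] and [h]. *)
Lemma remainder_pairing G (Y : R -> H) s t :
    (forall k, k \in msupp (Y s) -> (fsize k <= n)%N) ->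
    (forall k, k \in msupp (Y t) -> (fsize k <= n)%N) ->
  fpair G (Y t) - fpair (star (X s t) G) (Y s) =
  \sum_(k <- forests A n) G k * remainder X Y k s t.
Proof.
move=> Ys Yt; rewrite /remainder.
under eq_bigr do rewrite fpair_delta mulrBr.
rewrite sumrB (fpair_forests _ Yt); congr (_ - _).
  by apply: eq_bigr => k _; rewrite mulrC.
rewrite -fpair_suml; apply: eq_fpair => k /Ys; exact: star_expand.
Qed.

(* The remainder of a concatenation; with t = s it reverses time. *)
Lemma remainder_chen h (Y : R -> H) s u t :
    (forall k, k \in msupp (Y s) -> (fsize k <= n)%N) ->
    (forall k, k \in msupp (Y u) -> (fsize k <= n)%N) ->
    star (X s u) (X u t) =1 X s t ->
  remainder X Y h s t = remainder X Y h u t +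
    \sum_(k <- forests A n) star (X u t) (delta R h) k * remainder X Y k s u.
Proof.
move=> Ys Yu chen; rewrite -(remainder_pairing _ Ys Yu) /remainder.
have -> : fpair (star (X s t) (delta R h)) (Y s) =
    fpair (star (X s u) (star (X u t) (delta R h))) (Y s).
  by apply: eq_fpair => k _; rewrite -starA; apply: eq_star => // f; rewrite chen.
by rewrite addrA subrK.
Qed.

End Remainder.

(** * Germs of the rough integrals *)

Section Germ.
Variables (P : set H) (hP : primitive_basis P).

Definition topf phi p : forest A -> R := fun f => fpair phi (ntop (e f) p).

Lemma fpair_topf phi p x : fpair (topf phi p) x = fpair phi (ntop x p).
Proof. by rewrite (ntop_lext p x) [RHS]fpairE lext_lext. Qed.

(** The dual form of the cocycle property of natural growth. *)
Lemma topf_star phi psi p : P p -> psi (fone A) = 1 ->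
  topf (star phi psi) p =1 (fun f => topf phi p f + star phi (topf psi p) f).
Proof.
move=> Pp psi1 f; have [np _] := P_deg hP Pp.
rewrite /topf fpair_star (ntop_cocycle _ _ (P_prim hP Pp) np); congr (_ + _).
  by apply: eq_lext => h; rewrite psi1 mulr1.
rewrite /copair lextU; apply: eq_bigr => u _ /=.
exact: (lextZ (phi u.1) (psi : _ -> R^o)).
Qed.

(** The sum resolves the identity up to degree [m]. This suffices: a cut of [k] on whose second
    factor [G] does not vanish has a first factor of size at most [n - fsize u.2], hence at most
    [m]. *)
Lemma Ptop1_star n m phi G k : (fsize k <= n)%N ->
    (forall j, G j != 0 -> (n <= m + fsize j)%N) ->
  \sum_(r <- Ptop1s P m) fpair phi r * star (fdual (dual P r)) G k = star phi G k.
Proof.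
move=> kn Gm; rewrite /star; under eq_bigr do rewrite mulr_sumr.
rewrite exchange_big !big_seq; apply: eq_bigr => u /fsize_cop uk /=.
under eq_bigr do rewrite mulrA.
rewrite -mulr_suml; have [->|/Gm Gu] := eqVneq (G u.2) 0; first by rewrite !mulr0.
by rewrite Ptop1_expand// -(leq_add2r (fsize u.2)) uk (leq_trans kn).
Qed.

Lemma star_dual_supp r G d k : Ptop1 P r -> (forall j, G j != 0 -> fsize j = d) ->
  star (fdual (dual P r)) G k != 0 -> fsize k = (deg r + d)%N.
Proof.
move=> Pr Gd; apply: contraNeq => krd; rewrite /star big_seq big1// => u /fsize_cop uk.
have [->|/Gd Gu] := eqVneq (G u.2) 0; first by rewrite mulr0.
have /homogP ru := homog_dual hP Pr.
rewrite /fdual ru ?mul0r// => ur; move: krd; rewrite -uk Gu ur eqxx.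
by [].
Qed.

Definition germ_dual p h := star (fdual (dual P p)) (delta R h).

Lemma germ_dual_supp p h k : P p -> germ_dual p h k != 0 -> fsize k = (deg p + fsize h)%N.
Proof.
move=> Pp; apply: star_dual_supp; first by right; exact: Ptop_one.
by move=> j; rewrite deltaE; case: (h =P j) => [->//|]; rewrite eqxx.
Qed.

(** The constant term subtracted in [P_expand] only concerns cuts with empty first factor, and
    [fsize h < fsize k] rules these out. *)
Lemma P_star n h phi k : (fsize h < fsize k)%N -> (fsize k <= n)%N ->
  \sum_(p <- Ps P (n - fsize h)) star (topf phi p) (germ_dual p h) k =
  star phi (delta R h) k.
Proof.
move=> hk kn; under eq_bigr do rewrite -starA.
rewrite /star exchange_big !big_seq; apply: eq_bigr => u /fsize_cop uk /=.
rewrite -mulr_suml deltaE; case: eqP => [hu|_] /=; last by rewrite !mulr0.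
rewrite !mulr1 (P_expand hP); last first.
  have u2n : (fsize u.2 <= n)%N by rewrite (leq_trans _ kn)// -uk leq_addl.
  by rewrite hu leq_subRL// addnC uk.
case: eqP => [u1|_] /=; last by rewrite mulr0 subr0.
by move: hk; rewrite -uk u1 fsize1 hu ltnn.
Qed.

Section Path.
Variables (X : R -> R -> forest A -> R) (n : nat) (Y : R -> H) (h : forest A).
Hypothesis Yn : forall v k, k \in msupp (Y v) -> (fsize k <= n)%N.

(** With [n = N - 1] and [m = n - (deg p + fsize h)] this is the contribution of one interval to the
    sums that define the integral against X^p. *)
Definition germ p m s t := \sum_(r <- Ptop1s P m)
  fpair (star (fdual (dual P r)) (germ_dual p h)) (Y s) * fpair (X s t) (ntop r p).

Lemma germE p s t : P p -> (deg p + fsize h <= n)%N ->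
  germ p (n - (deg p + fsize h)) s t = fpair (star (topf (X s t) p) (germ_dual p h)) (Y s).
Proof.
move=> Pp phn; rewrite /germ.
under eq_bigr do rewrite -fpair_topf mulrC.
rewrite -fpair_suml; apply: eq_fpair => k /Yn kn.
by apply: Ptop1_star kn _ => j /(germ_dual_supp Pp) ->; lia.
Qed.

Lemma sum_germ s t : (forall k, k \in msupp (Y s) -> (fsize h < fsize k)%N) ->
    (fsize h <= n)%N ->
  \sum_(p <- Ps P (n - fsize h)) germ p (n - (deg p + fsize h)) s t =
  fpair (star (X s t) (delta R h)) (Y s).
Proof.
move=> Yh hn; have -> : \sum_(p <- Ps P (n - fsize h)) germ p (n - (deg p + fsize h)) s t =
    \sum_(p <- Ps P (n - fsize h)) 1 * fpair (star (topf (X s t) p) (germ_dual p h)) (Y s).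
  by apply: eq_big_seq => p /PsP[//|Pp pn]; rewrite germE ?mul1r//; lia.
rewrite -fpair_suml; apply: eq_fpair => k ky.
rewrite -(P_star _ (Yh _ ky) (Yn ky)).
by apply: eq_bigr => p _; rewrite mul1r.
Qed.

(** Chen's relation and [topf_star] turn the left-hand side into a pairing transported from time [s]
    minus the same pairing at time [u]. Resolved along [r], this difference consists of
    remainders. *)
Lemma germ_delta p s u t : P p -> (deg p + fsize h <= n)%N ->
    star (X s u) (X u t) =1 X s t -> X u t (fone A) = 1 ->
  germ p (n - (deg p + fsize h)) s t - germ p (n - (deg p + fsize h)) s u
    - germ p (n - (deg p + fsize h)) u t =
  - \sum_(r <- Ptop1s P (n - (deg p + fsize h))) fpair (X u t) (ntop r p) *
      \sum_(k <- forests A n) star (fdual (dual P r)) (germ_dual p h) k * remainder X Y k s u.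
Proof.
move=> Pp phn chen X1; set m := (n - _)%N.
have E r : \sum_(k <- forests A n) star (fdual (dual P r)) (germ_dual p h) k * remainder X Y k s u =
    fpair (star (fdual (dual P r)) (germ_dual p h)) (Y u) -
    fpair (star (X s u) (star (fdual (dual P r)) (germ_dual p h))) (Y s).
  by rewrite (remainder_pairing _ _ (Yn (v := s)) (Yn (v := u))).
under eq_bigr do rewrite E mulrBr.
rewrite sumrB opprB addrC -[RHS]addrC; congr (_ + _).
  by congr (- _); apply: eq_bigr => r _; rewrite mulrC.
rewrite !germE// -fpair_suml.
have st f : topf (X s t) p f = topf (X s u) p f + star (X s u) (topf (X u t) p) f.
  rewrite -(topf_star _ Pp X1); apply: eq_fpair => k _; exact/esym/chen.
transitivity (fpair (star (star (X s u) (topf (X u t) p)) (germ_dual p h)) (Y s)).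
  apply/eqP; rewrite subr_eq addrC; apply/eqP.
  rewrite !fpairE -lextD; apply: eq_lext => k; rewrite /star -big_split.
  by apply: eq_bigr => v _ /=; rewrite st mulrDl.
apply: eq_fpair => k /Yn kn; rewrite starA -star_sumr.
rewrite /star !big_seq; apply: eq_bigr => v /fsize_cop vk; congr (_ * _).
have vn : (fsize v.2 <= n)%N by rewrite (leq_trans _ kn)// -vk leq_addl.
have Gm j : germ_dual p h j != 0 -> (n <= m + fsize j)%N.
  by move=> /(germ_dual_supp Pp) ->; rewrite /m; lia.
rewrite -[LHS]/(star (topf (X u t) p) (germ_dual p h) v.2) -(Ptop1_star _ vn Gm).
by apply: eq_bigr => r _; rewrite fpair_topf.
Qed.

End Path.
End Germ.
End StarAlgebra.

(** * Limits along partitions and Hoelder seminorms *)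

Section MeshFilter.
Variable R : realType.
Implicit Types (a t : R).

Lemma mesh_to0_proper a t : a <= t -> ProperFilter (mesh_to0 a t).
Proof.
move=> at_; apply: Build_ProperFilter_ex => [Q [d d0 dQ]|].
  have d20 : 0 < d / 2 by rewrite divr_gt0.
  have [p ap pd] := fine_partition d20 at_; exists p; apply: dQ => //.
  by apply: le_lt_trans (le_mesh (ltW d20) pd) _; lra.
split=> [|Q1 Q2 [d1 d10 H1] [d2 d20 H2]|Q1 Q2 Q12 [d d0 H]].
- by exists 1.
- exists (Num.min d1 d2); first by rewrite lt_min d10.
  by move=> p ap; rewrite lt_min => /andP[p1 p2]; split; [exact: H1|exact: H2].
- by exists d => // p ap pd; apply: Q12; exact: H.
Qed.

(** The rate given by sewing yields convergence, and properness of the filter makes the limit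
    unique, so that [lim] is the sewn integral. *)
Lemma lim_mesh_to0 a t alpha M J (f : seq R -> R) : a <= t -> 0 < alpha -> 0 <= M ->
    (forall p d, itv_partition a t p -> fine d a p -> `|f p - J| <= M * (d `^ alpha * (t - a))) ->
  lim (f @ mesh_to0 a t) = J.
Proof.
move=> at_ alpha0 M0 fJ; have PF := mesh_to0_proper at_.
apply: cvg_lim => //; apply/cvgrPdist_le => e e0.
have c0 : 0 < M * (t - a) + 1 by rewrite ltr_wpDl// mulr_ge0// subr_ge0.
have [d d0 de] := powR_small alpha0 (divr_gt0 e0 c0).
exists d => // p ap pd; rewrite distrC.
have pfd : fine d a p by move=> I Ip; apply: le_trans (fine_mesh Ip) (ltW pd).
apply: le_trans (fJ p d ap pfd) _; rewrite mulrCA.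
apply: (@le_trans _ _ (e / (M * (t - a) + 1) * (M * (t - a) + 1))).
  by apply: ler_pM => //; rewrite ?powR_ge0 ?mulr_ge0 ?subr_ge0// lerDl.
by rewrite divfK// gt_eqF.
Qed.

Lemma holder_bound (T gamma : R) (F : R -> R -> R) : (holder T gamma F < +oo)%E ->
  exists C : R, 0 <= C /\ forall s t, 0 <= s <= T -> 0 <= t <= T -> s != t ->
    `|F s t| <= C * `|t - s| `^ gamma.
Proof.
move=> Foo; have H s t : 0 <= s <= T -> 0 <= t <= T -> s != t ->
    ((`|F s t| / `|t - s| `^ gamma)%:E <= holder T gamma F)%E.
  by move=> s0 t0 st; apply: ereal_sup_ubound; exists s, t; split.
case: (holder T gamma F) Foo H => [r _ H|//|_ H].
- exists (Num.max 0 r); split; first by rewrite le_max lexx.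
  move=> s t s0 t0 st; have := H s t s0 t0 st; rewrite lee_fin => sr.
  rewrite -ler_pdivrMr; last by rewrite powR_gt0// normr_gt0 subr_eq0 eq_sym.
  by rewrite le_max sr orbT.
- by exists 0; split=> // s t s0 t0 st; have := H s t s0 t0 st; rewrite leeNy_eq.
Qed.

End MeshFilter.

(** * Bounds for characters and convolutions *)

Section Bounds.
Variables (R : realType) (A : finType).
Implicit Types (f g h k : forest A).

Lemma powR_mulnr (x a : R) j : 0 <= x -> x `^ (a * j%:R) = (x `^ a) ^+ j.
Proof. by move=> x0; rewrite powRrM powR_mulrn// powR_ge0. Qed.

(** In [star X X] the two extreme cuts of [f] contribute [X f] each and the others vanish by
    induction on the size, so [2 X f = X f]. This determines [X s s], about which [holder] says
    nothing. *)
Lemma character_id (X : forest A -> R) : X (fone A) = 1 -> star X X =1 X ->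
  forall f, X f = (f == fone A)%:R.
Proof.
move=> X1 XX f; have [m] := ubnP (fsize f); elim: m f => // m IHm f fm.
have [->//|f1] := eqVneq f (fone A).
have /eqP := XX f; rewrite /star (bigID (fun u => u.2 == fone A)) /=.
rewrite (cop_fone_snd (fun u => X u.1 * X u.2)) /= X1 mulr1.
rewrite (bigID (fun u => u.1 == fone A)) /= [X in _ + (_ + X) == _]big1_seq ?addr0; last first.
  move=> u /andP[/andP[u2 u1] /fsize_cop uf].
  have u1f : (fsize u.1 < fsize f)%N.
    by rewrite -uf -[ltnLHS]addn0 ltn_add2l lt0n fsize_eq0.
  by rewrite (IHm u.1 (leq_trans u1f fm)) (negbTE u1) mul0r.
have -> : \sum_(u <- cop f | (u.2 != fone A) && (u.1 == fone A)) X u.1 * X u.2 = X f.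
  rewrite -[RHS]mul1r -X1 -(cop_fone_fst (fun u => X u.1 * X u.2)).
  rewrite big_seq_cond [RHS]big_seq_cond; apply: eq_bigl => u.
  case: (boolP (u \in cop f)) => //= /fsize_cop uf.
  case: (u.1 =P fone A) => [u1|]; rewrite ?andbF// andbT.
  move: uf; rewrite u1 fsize1 add0n -(fsize_eq0 u.2) => ->.
  by rewrite fsize_eq0.
by rewrite -subr_eq0 addrK => /eqP.
Qed.

Definition l1 (x : malg (forest A) R) : R := \sum_(f <- msupp x) `|mcoeff f x|.

Lemma l1_ge0 x : 0 <= l1 x.
Proof. exact: sumr_ge0. Qed.

Lemma fpair_homog_bound (phi : forest A -> R) j (c : R) x : homog j x ->
    (forall f, fsize f = j -> `|phi f| <= c) ->
  `|fpair phi x| <= l1 x * c.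
Proof.
move=> jx phic; apply: le_trans (ler_norm_sum _ _ _) _.
rewrite /l1 mulr_suml !big_seq; apply: ler_sum => f /jx fj.
by rewrite normrM ler_wpM2l// phic.
Qed.

Lemma star_delta_bound (phi : forest A -> R) h k (c x : R) : 0 <= c -> 0 <= x ->
    (forall f, (fsize f <= fsize k)%N -> `|phi f| <= c * x ^+ fsize f) ->
  `|star phi (delta R h) k| <= (size (cop k))%:R * c * x ^+ (fsize k - fsize h).
Proof.
move=> c0 x0 phic; apply: le_trans (ler_norm_sum _ _ _) _.
apply: (@le_trans _ _ (\sum_(u <- cop k) c * x ^+ (fsize k - fsize h))).
  rewrite !big_seq; apply: ler_sum => u /fsize_cop uk.
  rewrite normrM deltaE; case: (h =P _) => [->|_]; last first.
    by rewrite normr0 mulr0 mulr_ge0// exprn_ge0.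
  rewrite normr1 mulr1 -uk addnK; apply: phic.
  by rewrite -uk leq_addr.
by rewrite big_const_seq count_predT iter_addr_0 -mulrA mulr_natl.
Qed.

End Bounds.

(** * The interpolation on one piece *)

(** Here [x], [y], [z] are the degrees of [r], [p], [h]. One factor [v] coming from X is set aside
    for the exponent [alpha] of sewing, whence the predecessor. *)
Lemma degree_split (x y z n : nat) : (0 < y)%N -> (x + (y + z) <= n)%N ->
  (n - z = (x + y).-1 + (n.+1 - (x + (y + z))))%N.
Proof. lia. Qed.

Lemma bound_rearrange (F : fieldType) (l g x y w1 w2 c1 c2 d : F) :
  l * (c1 * (x * w1)) * (g * (c2 * (y / d) * w2)) =
  l * g * (c1 * c2) * (w1 * w2 / d) * (y * x).
Proof. ring. Qed.

Section LocalStep.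
Variables (R : realType) (A : finType) (P : set (malg (forest A) R)).
Local Notation H := (malg (forest A) R).
Local Notation e := (fbasis R).
Implicit Types (f g h k : forest A) (s t u a b : R) (n : nat).

Lemma rough_int_germE (X : R -> R -> forest A -> R) n (Y : R -> H) h p a t :
    primitive_basis P -> (deg p + fsize h <= n)%N ->
  rough_int P n.+1 X Y h p a t =
  lim ((fun q => riemann (germ P X Y h p (n - (deg p + fsize h))) a q) @ mesh_to0 a t).
Proof.
move=> hP phn; rewrite /rough_int.
set F := (X in lim (X @ _) = _).
suff -> : F = riemann (germ P X Y h p (n - (deg p + fsize h))) a by [].
apply/funext => q; apply: eq_bigr => I _.
have -> : [set r | Ptop1 P r /\ (deg r + fsize h + deg p < n.+1)%N] =
    [set r | Ptop1 P r /\ (deg r <= n - (deg p + fsize h))%N].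
  by apply/seteqP; split=> r /= [Pr rn]; split=> //; lia.
rewrite fsbig_finite; last exact: (finite_Ptop1 hP).
by [].
Qed.

Lemma sum_int_germE (X : R -> R -> forest A -> R) n (Y : R -> H) h a t :
    primitive_basis P -> (fsize h <= n)%N ->
  sum_int P n.+1 X Y h a t = \sum_(p <- Ps P (n - fsize h)) rough_int P n.+1 X Y h p a t.
Proof.
move=> hP hn; rewrite /sum_int.
have -> : [set p | P p /\ (deg p + fsize h <= n.+1.-1)%N] =
    [set p | P p /\ (deg p <= n - fsize h)%N].
  by apply/seteqP; split=> p /= [Pp pn]; split=> //; lia.
by rewrite fsbig_finite//; exact: (finite_P hP).
Qed.

Variables (hP : primitive_basis P) (T alpha : R) (n : nat).
Variables (X : R -> R -> forest A -> R) (Z : R -> H) (CX CZ : R).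
Hypothesis alpha0 : 0 < alpha.
Hypothesis X1 : forall s t, 0 <= s <= T -> 0 <= t <= T -> X s t (fone A) = 1.
Hypothesis chen : forall s u t, 0 <= s <= T -> 0 <= u <= T -> 0 <= t <= T ->
  star (X s u) (X u t) =1 X s t.
Hypothesis CX0 : 0 <= CX.
Hypothesis XB : forall s t f, 0 <= s <= T -> 0 <= t <= T -> (fsize f <= n)%N ->
  `|X s t f| <= CX * (`|t - s| `^ alpha) ^+ fsize f.
Hypothesis CZ0 : 0 <= CZ.
Hypothesis ZB : forall s t h, 0 <= s <= T -> 0 <= t <= T -> s != t -> (fsize h <= n)%N ->
  `|remainder X Z h s t| <= CZ * (`|t - s| `^ alpha) ^+ (n.+1 - fsize h).
Hypothesis Zn : forall t k, 0 <= t <= T -> k \in msupp (Z t) -> (fsize k <= n)%N.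

Local Definition v (d : R) : R := d `^ alpha.

Local Lemma v_ge0 d : 0 <= v d. Proof. exact: powR_ge0. Qed.

Local Lemma v_le d d' : 0 <= d -> d <= d' -> v d <= v d'.
Proof. exact: powR_le (ltW alpha0). Qed.

Definition germ_bound (CY : R) h p : R :=
  \sum_(r <- Ptop1s P (n - (deg p + fsize h))) \sum_(k <- forests A n)
    l1 (ntop r p) * `|star (fdual (dual P r)) (germ_dual P p h) k| * (CX * CY).

Lemma germ_bound_ge0 (CY : R) h p : 0 <= CY -> 0 <= germ_bound CY h p.
Proof.
move=> CY0; apply: sumr_ge0 => r _; apply: sumr_ge0 => k _.
by rewrite !mulr_ge0// ?l1_ge0.
Qed.

(** The remainder supplies the factor [t - s]. Since [0 < deg p], the pairing with [X u t] supplies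
    at least one [v (t - s)]; all other powers are estimated by [v (b - a)]. The constant
    [germ_bound] does not depend on the piece. *)
Lemma germ_delta_bound (CY : R) a b (Y : R -> H) h p s u t :
    0 <= CY -> 0 <= a -> a < b -> b <= T -> P p -> (deg p + fsize h <= n)%N ->
    (forall w k, k \in msupp (Y w) -> (fsize k <= n)%N) ->
    (forall k, (fsize h < fsize k <= n)%N -> forall s t, a <= s -> s <= t -> t <= b ->
      `|remainder X Y k s t| <= CY * ((t - s) / (b - a)) * v (b - a) ^+ (n.+1 - fsize k)) ->
    a <= s -> s <= u -> u <= t -> t <= b ->
  `|germ P X Y h p (n - (deg p + fsize h)) s t - germ P X Y h p (n - (deg p + fsize h)) s u
    - germ P X Y h p (n - (deg p + fsize h)) u t| <=
  germ_bound CY h p * (v (b - a) ^+ (n - fsize h) / (b - a)) * ((t - s) * v (t - s)).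
Proof.
move=> CY0 a0 ab bT Pp phn Yn YB as_ su ut tb.
have s01 : 0 <= s <= T by apply/andP; split; lra.
have u01 : 0 <= u <= T by apply/andP; split; lra.
have t01 : 0 <= t <= T by apply/andP; split; lra.
have l0 : 0 < b - a by lra.
have tu0 : 0 <= t - u by lra.
have tuts : t - u <= t - s by lra.
have tul : t - u <= b - a by lra.
have usts : u - s <= t - s by lra.
rewrite (germ_delta hP Yn Pp phn (chen s01 u01 t01) (X1 u01 t01)) normrN.
have [hp p0] := P_deg hP Pp.
apply: le_trans (ler_norm_sum _ _ _) _; rewrite /germ_bound !mulr_suml.
rewrite !big_seq; apply: ler_sum => r /(Ptop1sP hP)[Pr rm].
have [hr _] := Ptop1_homog hP Pr.
rewrite mulr_sumr !mulr_suml; apply: le_trans (ler_norm_sum _ _ _) _.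
rewrite !big_seq; apply: ler_sum => k; rewrite mem_forests => kn.
set g := star _ _ k; have [->|g0] := eqVneq g 0.
  by rewrite mul0r mulr0 normr0 mulr0 !mul0r.
have kE : fsize k = (deg r + (deg p + fsize h))%N.
  apply: (star_dual_supp hP Pr _ g0) => j; exact: germ_dual_supp.
have hk : (fsize h < fsize k <= n)%N.
  by rewrite kn kE andbT addnA -[ltnLHS]add0n ltn_add2r addn_gt0 p0 orbT.
have Rb := YB k hk s u as_ su (le_trans ut tb).
set j := (deg r + deg p)%N.
have Xb : `|fpair (X u t) (ntop r p)| <= l1 (ntop r p) * (CX * v (t - u) ^+ j).
  apply: (fpair_homog_bound (homog_ntop hr hp)) => f fj.
  have fn : (fsize f <= n)%N by rewrite fj (leq_trans _ kn)// kE addnA leq_addr.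
  by apply: le_trans (XB u01 t01 fn) _; rewrite fj ger0_norm// subr_ge0.
rewrite !normrM.
set V := v (b - a).
have V0 : 0 <= V by exact: v_ge0.
have vtu : v (t - u) ^+ j <= v (t - s) * V ^+ j.-1.
  have -> : j = j.-1.+1 by rewrite prednK// /j addn_gt0 p0 orbT.
  rewrite exprS /=; apply: ler_pM; rewrite ?v_ge0 ?exprn_ge0 ?v_ge0//.
    exact: v_le.
  by rewrite lerXn2r ?nnegrE ?v_ge0//; exact: v_le.
have us : (u - s) / (b - a) <= (t - s) / (b - a).
  by rewrite ler_pM2r ?invr_gt0.
apply: (@le_trans _ _ (l1 (ntop r p) * (CX * (v (t - s) * V ^+ j.-1)) *
   (`|g| * (CY * ((t - s) / (b - a)) * V ^+ (n.+1 - fsize k))))).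
  apply: ler_pM; [by []|by rewrite mulr_ge0| |].
    by apply: le_trans Xb _; rewrite ler_wpM2l ?l1_ge0// ler_wpM2l.
  rewrite ler_wpM2l//; apply: le_trans Rb _.
  by rewrite ler_wpM2r ?exprn_ge0// ler_wpM2l.
have nE : (n - fsize h = j.-1 + (n.+1 - fsize k))%N.
  by rewrite kE in kn *; exact: degree_split.
by rewrite nE exprD bound_rearrange.
Qed.

(** The sewing error enters twice, on [[s, t]] and through the linear correction on [[a, b]]; the
    remainder of Z enters once, through that correction. *)
Definition step_const (CY : R) h : R :=
  2 * (\sum_(p <- Ps P (n - fsize h)) sewing_const alpha * germ_bound CY h p) + CZ.

Lemma step_const_ge0 CY h : 0 <= CY -> 0 <= step_const CY h.
Proof.
move=> CY0; rewrite addr_ge0// mulr_ge0//; apply: sumr_ge0 => p _.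
by rewrite mulr_ge0 ?germ_bound_ge0// sewing_const_ge0.
Qed.

(* Since the germs sum up to <X_(s,t) * h, Y_s>, the remainder of W on [s, t] is
   the sewing error plus (t - s) / (b - a) times the correction, which is itself
   the remainder of Z on [a, b] up to a sewing error. *)
Lemma interp_step (CY : R) a b (Y : R -> H) h :
    0 <= CY -> 0 <= a -> a < b -> b <= T -> (fsize h <= n)%N ->
    (forall w k, k \in msupp (Y w) -> (fsize h < fsize k <= n)%N) ->
    (forall k, (fsize h < fsize k <= n)%N -> mcoeff k (Y a) = mcoeff k (Z a)) ->
    (forall k, (fsize h < fsize k <= n)%N -> forall s t, a <= s -> s <= t -> t <= b ->
      `|remainder X Y k s t| <= CY * ((t - s) / (b - a)) * v (b - a) ^+ (n.+1 - fsize k)) ->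
  let S := sum_int P n.+1 X Y h a in
  let W t := S t + mcoeff h (Z a) +
    (t - a) / (b - a) * (mcoeff h (Z b) - mcoeff h (Z a) - S b) in
  [/\ W a = mcoeff h (Z a), W b = mcoeff h (Z b) &
    forall s t, a <= s -> s <= t -> t <= b ->
      `|W t - W s - fpair (star (X s t) (delta R h)) (Y s)| <=
      step_const CY h * ((t - s) / (b - a)) * v (b - a) ^+ (n.+1 - fsize h)].
Proof.
move=> CY0 a0 ab bT hn Ysupp Ya YB S W; have l0 : 0 < b - a by lra.
have Yn w k : k \in msupp (Y w) -> (fsize k <= n)%N by move=> /Ysupp/andP[].
set V := v (b - a); have V0 : 0 <= V by exact: v_ge0.
pose m (p : H) := (n - (deg p + fsize h))%N.
pose K p : R := germ_bound CY h p * (V ^+ (n - fsize h) / (b - a)).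
have K0 p : 0 <= K p by rewrite mulr_ge0 ?germ_bound_ge0// divr_ge0 ?exprn_ge0// ltW.
have /choice[J HJ] (p : H) : exists J : R -> R, p \in Ps P (n - fsize h) -> [/\ J a = 0,
    forall s t, a <= s -> s <= t -> t <= b ->
      `|J t - J s - germ P X Y h p (m p) s t| <= sewing_const alpha * K p * ((t - s) * v (t - s)) &
    forall t, a <= t -> t <= b -> rough_int P n.+1 X Y h p a t = J t].
  have [pP|pP] := boolP (p \in Ps P (n - fsize h)); last by exists (fun=> 0).
  have /(PsP hP)[Pp pn] := pP; have phn : (deg p + fsize h <= n)%N by rewrite addnC -leq_subRL.
  have [J [Ja Js Jr]] := sewing alpha0 (K0 p) (fun s u t (H1 : a <= s) H2 H3 (H4 : t <= b) =>
    @germ_delta_bound CY a b Y h p s u t CY0 a0 ab bT Pp phn Yn YB H1 H2 H3 H4).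
  exists J => _; split=> // t at_ tb.
  rewrite rough_int_germE//.
  apply: (@lim_mesh_to0 _ a t alpha (sewing_const alpha * K p) (J t) _ at_ alpha0)
    => [|q d aq qd].
    by rewrite mulr_ge0 ?(K0 p) ?sewing_const_ge0.
  exact: Jr.
have SE t : a <= t -> t <= b -> S t = \sum_(p <- Ps P (n - fsize h)) J p t.
  move=> at_ tb; rewrite /S sum_int_germE//; apply: eq_big_seq => p /HJ[_ _]; exact.
have Sa : S a = 0.
  by rewrite SE// ?(ltW ab)// big_seq big1// => p /HJ[].
pose CS : R := \sum_(p <- Ps P (n - fsize h)) sewing_const alpha * germ_bound CY h p.
have CS0 : 0 <= CS.
  by apply: sumr_ge0 => p _; rewrite mulr_ge0 ?germ_bound_ge0 ?sewing_const_ge0.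
have err s t : a <= s -> s <= t -> t <= b ->
    `|S t - S s - fpair (star (X s t) (delta R h)) (Y s)| <=
    CS * ((t - s) / (b - a)) * V ^+ (n.+1 - fsize h).
  move=> as_ st tb; have at_ := le_trans as_ st; have sb := le_trans st tb.
  have tsl : t - s <= b - a by rewrite lerB.
  rewrite !SE//.
  have Yh k : k \in msupp (Y s) -> (fsize h < fsize k)%N by move=> /Ysupp/andP[].
  rewrite -(@sum_germ _ _ P hP X n Y h Yn s t Yh hn) -!sumrB.
  apply: le_trans (ler_norm_sum _ _ _) _; rewrite /CS !mulr_suml.
  rewrite !big_seq; apply: ler_sum => p /HJ[_ Js _].
  apply: le_trans (Js s t as_ st tb) _; rewrite subSn// exprS /K.
  have vts : v (t - s) <= V by apply: v_le; rewrite // subr_ge0.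
  rewrite [leRHS](_ : _ = sewing_const alpha *
    (germ_bound CY h p * (V ^+ (n - fsize h) / (b - a))) * ((t - s) * V)); last by ring.
  apply: ler_wpM2l; first by apply: mulr_ge0; [exact: sewing_const_ge0|exact: (K0 p)].
  by apply: ler_wpM2l; rewrite // subr_ge0.
have bound_b : `|mcoeff h (Z b) - mcoeff h (Z a) - S b| <= (CS + CZ) * V ^+ (n.+1 - fsize h).
  have a01 : 0 <= a <= T by apply/andP; split; lra.
  have b01 : 0 <= b <= T by apply/andP; split; lra.
  (* [Y] only has components of degree above [fsize h], where it agrees with Z at [a]; by
     unitriangularity, the remaining components of Z contribute just the one at [h]. *)
  have E : fpair (star (X a b) (delta R h)) (Z a) =
      mcoeff h (Z a) + fpair (star (X a b) (delta R h)) (Y a).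
    rewrite (fpair_forests _ (fun k => @Zn a k a01)) (fpair_forests _ (@Yn a)).
    rewrite (bigD1_seq h) ?forests_uniq ?mem_forests//=.
    rewrite [in RHS](bigD1_seq h) ?forests_uniq ?mem_forests//=.
    rewrite star_delta_eq ?X1// eqxx mulr1 [mcoeff h (Y a)]mcoeff_outdom ?mul0r ?add0r.
      congr (_ + _); rewrite big_seq_cond [RHS]big_seq_cond; apply: eq_bigr => k.
      rewrite mem_forests => /andP[kn kh].
      have [hk|kh'|hk] := ltngtP (fsize h) (fsize k).
      - by rewrite Ya// hk.
      - by rewrite star_delta_lt// !mulr0.
      - by rewrite star_delta_eq ?X1// (negbTE kh) !mulr0.
    by apply/negP => /Ysupp; rewrite ltnn.
  have := ZB a01 b01 _ hn; rewrite (lt_eqF ab) /remainder fpair_delta E => /(_ isT) Zb.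
  have := err a b (lexx a) (ltW ab) (lexx b); rewrite Sa subr0 divff ?gt_eqF// mulr1 => Sb.
  rewrite (ger0_norm (ltW l0)) in Zb.
  have -> : mcoeff h (Z b) - mcoeff h (Z a) - S b =
    (mcoeff h (Z b) - (mcoeff h (Z a) + fpair (star (X a b) (delta R h)) (Y a))) -
    (S b - fpair (star (X a b) (delta R h)) (Y a)) by ring.
  apply: le_trans (ler_normB _ _) _; rewrite mulrDl addrC.
  by apply: lerD.
split.
- by rewrite /W Sa add0r subrr mul0r mul0r addr0.
- by rewrite /W divff ?gt_eqF// mul1r; ring.
move=> s t as_ st tb; set E := fpair _ _.
have -> : W t - W s - E = (S t - S s - E) +
    (t - s) / (b - a) * (mcoeff h (Z b) - mcoeff h (Z a) - S b).
  by rewrite /W; field; rewrite gt_eqF.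
have x0 : 0 <= (t - s) / (b - a) by rewrite divr_ge0// ?subr_ge0// ltW.
have slope : `|(t - s) / (b - a) * (mcoeff h (Z b) - mcoeff h (Z a) - S b)| <=
    (t - s) / (b - a) * ((CS + CZ) * V ^+ (n.+1 - fsize h)).
  by rewrite normrM (ger0_norm x0); exact: ler_wpM2l.
apply: le_trans (ler_normD _ _) _; apply: le_trans (lerD (err s t as_ st tb) slope) _.
rewrite /step_const -/CS; move: ((t - s) / (b - a)) (V ^+ _) => y z.
by rewrite le_eqVlt; apply/orP; left; apply/eqP; ring.
Qed.

Definition layer d : seq (forest A) := fset_set [set h | fsize h = d].

Lemma finite_layer d : finite_set [set h : forest A | fsize h = d].
Proof. by apply: sub_finite_set (finite_forest A d) => h /= ->. Qed.

Lemma mem_layer d h : (h \in layer d) = (fsize h == d).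
Proof.
rewrite in_fset_set; last exact: finite_layer.
by apply/idP/eqP => [/set_mem|hd]; last exact/mem_set.
Qed.

Definition interpolant_on (d : nat) (C : R) a b (Y : R -> H) := [/\
  forall w k, k \in msupp (Y w) -> (d <= fsize k <= n)%N,
  forall k, (d <= fsize k <= n)%N ->
    mcoeff k (Y a) = mcoeff k (Z a) /\ mcoeff k (Y b) = mcoeff k (Z b) &
  forall k, (d <= fsize k <= n)%N -> forall s t, a <= s -> s <= t -> t <= b ->
    `|remainder X Y k s t| <= C * ((t - s) / (b - a)) * v (b - a) ^+ (n.+1 - fsize k)].

(** By unitriangularity, a layer of degree [d] does not affect the remainders of higher degree, and
    those of degree [d] gain exactly the increments of [W] that [interp_step] controls. *)
Lemma add_layer d (CY : R) a b (Y Y' : R -> H) :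
    0 <= CY -> 0 <= a -> a < b -> b <= T -> (d <= n)%N ->
    interpolant_on d.+1 CY a b Y ->
    (forall w, Y' w = Y w + \sum_(h <- layer d)
       (sum_int P n.+1 X Y h a w + mcoeff h (Z a) + (w - a) / (b - a) *
         (mcoeff h (Z b) - mcoeff h (Z a) - sum_int P n.+1 X Y h a b)) *: e h) ->
  interpolant_on d (CY + \sum_(h <- layer d) step_const CY h) a b Y'.
Proof.
move=> CY0 a0 ab bT dn [Ysupp Yab YB] Y'E.
pose W h w : R := sum_int P n.+1 X Y h a w + mcoeff h (Z a) + (w - a) / (b - a) *
  (mcoeff h (Z b) - mcoeff h (Z a) - sum_int P n.+1 X Y h a b).
have Y'c k w : mcoeff k (Y' w) = mcoeff k (Y w) + (if fsize k == d then W k w else 0).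
  by rewrite Y'E mcoeffD mcoeff_sum_fbasis ?fset_uniq// mem_layer.
have WP h : fsize h = d -> [/\ W h a = mcoeff h (Z a), W h b = mcoeff h (Z b) &
    forall s t, a <= s -> s <= t -> t <= b ->
      `|W h t - W h s - fpair (star (X s t) (delta R h)) (Y s)| <=
      step_const CY h * ((t - s) / (b - a)) * v (b - a) ^+ (n.+1 - fsize h)].
  move=> hd; apply: interp_step; rewrite ?hd// => k /Yab[].
  by [].
have Yd k w : (fsize k <= d)%N -> mcoeff k (Y w) = 0.
  move=> kd; apply/eqP; rewrite mcoeff_eq0; apply/negP => /Ysupp/andP[dk _].
  by rewrite leqNgt dk in kd.
have l0 : 0 < b - a by rewrite subr_gt0.
have S0 h : 0 <= step_const CY h by exact: step_const_ge0.
split=> [w k|k /andP[dk kn]|k /andP[dk kn] s t as_ st tb].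
- rewrite -mcoeff_neq0 Y'c; case: (fsize k =P d) => [->|_]; first by rewrite leqnn.
  by rewrite addr0 mcoeff_neq0 => /Ysupp/andP[/ltnW -> ->].
- rewrite !Y'c; have [kd|kd] := eqVneq (fsize k) d.
    by have [-> -> _] := WP k kd; rewrite !Yd ?kd// !add0r.
  by rewrite !addr0; apply: Yab; rewrite kn ltn_neqAle eq_sym kd dk.
have s01 : 0 <= s <= T by rewrite (le_trans a0 as_) (le_trans st (le_trans tb bT)).
have t01 : 0 <= t <= T by rewrite (le_trans a0 (le_trans as_ st)) (le_trans tb bT).
have x0 : 0 <= (t - s) / (b - a) by rewrite divr_ge0// ?subr_ge0// ltW.
rewrite /remainder fpair_delta Y'c Y'E fpairD fpair_sumZ.
have sumE : \sum_(h <- layer d) W h s * fpair (star (X s t) (delta R k)) (e h) =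
    if fsize k == d then W k s else 0.
  under eq_bigr do rewrite fpairU.
  case: eqP => [kd|/eqP kd].
    rewrite (bigD1_seq k) ?fset_uniq ?mem_layer ?kd//= big_seq_cond big1 ?addr0.
      by rewrite star_delta_eq ?X1// eqxx mulr1.
    move=> h /andP[]; rewrite mem_layer => /eqP hd hk.
    by rewrite star_delta_eq ?X1// ?hd// (negbTE hk) mulr0.
  rewrite big_seq big1// => h; rewrite mem_layer => /eqP hd.
  by rewrite star_delta_lt ?mulr0// hd ltn_neqAle eq_sym kd.
rewrite -[\sum_(i <- _) _]/(\sum_(h <- layer d)
  W h s * fpair (star (X s t) (delta R k)) (e h)) sumE.
have [kd|kd] := eqVneq (fsize k) d; last first.
  have dk' : (d.+1 <= fsize k <= n)%N by rewrite kn ltn_neqAle eq_sym kd dk.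
  rewrite !addr0 -fpair_delta; apply: le_trans (YB k dk' s t as_ st tb) _.
  rewrite ler_wpM2r ?exprn_ge0 ?v_ge0// ler_wpM2r//.
  by rewrite lerDl sumr_ge0.
rewrite Yd ?kd// add0r opprD addrA addrAC.
have [_ _ WB] := WP k kd; apply: le_trans (WB s t as_ st tb) _.
rewrite kd ler_wpM2r ?exprn_ge0 ?v_ge0// ler_wpM2r//.
rewrite (bigD1_seq k) ?fset_uniq ?mem_layer ?kd//= addrCA lerDl.
by rewrite addr_ge0// sumr_ge0.
Qed.

(** Elements of P have positive degree, so in the top degree the general formula has no integrals
    and is the linear base case; [add_layer] can thus start from the zero path. *)
Lemma sum_int_top (Y : R -> H) h a t : fsize h = n -> sum_int P n.+1 X Y h a t = 0.
Proof.
move=> hn; rewrite sum_int_germE ?hn// subnn big_seq big1// => p /(PsP hP)[Pp].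
by have [_ p0] := P_deg hP Pp; rewrite leqNgt p0.
Qed.

(** [C] is chosen before [a] and [b]: one constant serves every piece of every dissection. *)
Lemma interp_upto_on m : (m <= n)%N -> exists2 C : R, 0 <= C &
  forall a b, 0 <= a -> a < b -> b <= T ->
    interpolant_on (n - m) C a b (interp_upto P n.+1 X Z m a b).
Proof.
have stepC (CY : R) d : 0 <= CY -> 0 <= CY + \sum_(h <- layer d) step_const CY h.
  by move=> CY0; rewrite addr_ge0// sumr_ge0// => h _; exact: step_const_ge0.
elim: m => [_|m IHm mn].
  exists (0 + \sum_(h <- layer n) step_const 0 h); first exact: stepC.
  move=> a b a0 ab bT; rewrite subn0.
  apply: (@add_layer n 0 a b (fun=> 0)) => //.
    split=> [w k|k|k]; first by rewrite msupp0.
    - by move=> /andP[k1 k2]; have := leq_trans k1 k2; rewrite ltnn.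
    - by move=> /andP[k1 k2]; have := leq_trans k1 k2; rewrite ltnn.
  move=> w; rewrite add0r /= fsbig_finite; last exact: finite_layer.
  apply: eq_big_seq => h; rewrite mem_layer => /eqP hn.
  rewrite !(sum_int_top _ _ _ hn) !fpair_delta add0r subr0; reflexivity.
have [CY CY0 HY] := IHm (ltnW mn).
exists (CY + \sum_(h <- layer (n - m.+1)) step_const CY h); first exact: stepC.
move=> a b a0 ab bT.
apply: (@add_layer (n - m.+1) CY a b _ _ CY0 a0 ab bT (leq_subr _ _)
  (_ : interpolant_on _ CY a b (interp_upto P n.+1 X Z m a b))).
  by rewrite subnSK//; exact: HY.
move=> w; rewrite /= fsbig_finite; last exact: finite_layer.
apply: congr1; apply: eq_bigr => h _; rewrite !fpair_delta; reflexivity.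
Qed.

Lemma interpolant_ends C a b (Y : R -> H) : 0 <= a -> a <= b -> b <= T ->
  interpolant_on 0 C a b Y -> Y a = Z a /\ Y b = Z b.
Proof.
move=> a0 ab bT [Ys Yab _]; have Zs c k : 0 <= c <= T -> (n < fsize k)%N -> mcoeff k (Z c) = 0.
  move=> c01 nk; apply/eqP; rewrite mcoeff_eq0; apply/negP => /(Zn c01).
  by rewrite leqNgt nk.
have YZ c : 0 <= c <= T ->
    (forall k, (fsize k <= n)%N -> mcoeff k (Y c) = mcoeff k (Z c)) -> Y c = Z c.
  move=> c01 H0; apply/malgP => k; have [/H0//|nk] := leqP (fsize k) n.
  rewrite Zs//; apply/eqP; rewrite mcoeff_eq0; apply/negP => /Ys/andP[_].
  by rewrite leqNgt nk.
by split; apply: YZ => [|k kn]; rewrite ?a0 ?bT ?(le_trans ab bT) ?(le_trans a0 ab)//;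
  have [] := Yab k kn.
Qed.

(** * Gluing the pieces and comparison on the whole interval *)

Section Global.
Variables (C : R) (C0 : 0 <= C).
Hypothesis HC : forall a b, 0 <= a -> a < b -> b <= T ->
  interpolant_on 0 C a b (interp_upto P n.+1 X Z n a b).
Hypothesis T0 : 0 < T.
Variable pi : seq R.
Hypothesis pi0T : itv_partition 0 T pi.
Local Notation Zt := (interpolation P n.+1 X Z pi).

Local Lemma pi_split p1 b p2 : pi = p1 ++ b :: p2 ->
  [/\ 0 <= last 0 p1, last 0 p1 < b, b <= T & b - last 0 p1 <= mesh 0 pi].
Proof.
move=> E; have [+ /eqP lT] := pi0T; rewrite E cat_path /= => /and3P[p1p p1b bp].
split=> //; first by apply: le_last_path => //; exact: mem_head.
  rewrite -lT E last_cat /=; apply: le_last_path => //; exact: mem_head.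
apply: (@fine_mesh _ 0 _ (last 0 p1, b)).
by rewrite pieces_cat mem_cat /pieces /= mem_head orbT.
Qed.

(** [find] assigns a common end point to the piece on its left, so the left end of a piece is
    excluded except for the first one. *)
Local Lemma Zt_piece p1 b p2 u : pi = p1 ++ b :: p2 -> u <= b ->
    last 0 p1 < u \/ p1 = [::] ->
  Zt u = interp_upto P n.+1 X Z n (last 0 p1) b u.
Proof.
move=> E ub uE; have hp1 : ~~ has (fun x => u <= x) p1.
  case: uE => [au|->//]; apply/hasPn => x xp1; rewrite -ltNge; apply: le_lt_trans au.
  have [+ _] := pi0T; rewrite E cat_path => /andP[p1p _].
  by apply: le_last_path; rewrite // inE xp1 orbT.
rewrite /interpolation; have -> : find (fun x => u <= x) pi = size p1.
  by rewrite E find_cat (negbTE hp1) /= ub addn0.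
by rewrite E -cat_cons nth_cat /= ltnSn -last_nth nth_cat ltnn subnn.
Qed.

Local Lemma Zt_point x : x \in 0 :: pi -> Zt x = Z x.
Proof.
have E0 p1 b p2 : pi = p1 ++ b :: p2 ->
    interp_upto P n.+1 X Z n (last 0 p1) b (last 0 p1) = Z (last 0 p1) /\
    interp_upto P n.+1 X Z n (last 0 p1) b b = Z b.
  move=> E; have [a0 ab bT _] := pi_split E.
  exact: interpolant_ends (ltW ab) bT (HC a0 ab bT).
rewrite inE => /predU1P[->|xpi]; last first.
  have [p1 [p2 E]] : exists p1 p2, pi = p1 ++ x :: p2.
    by case/path.splitPr: xpi => p1 p2; exists p1, p2.
  have [a0 ax xT _] := pi_split E.
  by rewrite (Zt_piece E (lexx x) (or_introl ax)); case: (E0 _ _ _ E).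
case Epi : pi => [|b p2].
  by have [_] := pi0T; rewrite Epi /= => /eqP T00; move: T0; rewrite -T00 ltxx.
have E : pi = [::] ++ b :: p2 by [].
have [a0 /= ab bT _] := pi_split E.
by rewrite -Epi (Zt_piece E (ltW ab) (or_intror erefl)); case: (E0 _ _ _ E).
Qed.

Local Lemma Zt_piece_le p1 b p2 u : pi = p1 ++ b :: p2 -> last 0 p1 <= u -> u <= b ->
  Zt u = interp_upto P n.+1 X Z n (last 0 p1) b u.
Proof.
move=> E; rewrite le_eqVlt => /predU1P[<-|au] ub; last by apply: Zt_piece E ub (or_introl au).
have [a0 ab bT _] := pi_split E.
have [-> _] := interpolant_ends a0 (ltW ab) bT (HC a0 ab bT).
apply: Zt_point; rewrite E; have := mem_last 0 p1.
by rewrite !inE mem_cat => /orP[->|->]; rewrite ?orbT.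
Qed.

(** The last clause orders the end points of the pieces when two times lie in different ones. *)
Local Lemma piece_ex t : 0 <= t <= T -> exists p1 b p2, [/\ pi = p1 ++ b :: p2,
  last 0 p1 <= t, t <= b & forall x, x \in pi -> x < t -> x <= last 0 p1].
Proof.
move=> /andP[t0 tT]; have [pp /eqP lT] := pi0T.
have hp : has (fun x => t <= x) pi.
  apply/hasP; exists T => //; have := mem_last 0 pi; rewrite lT inE => /predU1P[T00|//].
  by move: T0; rewrite T00 ltxx.
case/split_find: hp pp => b p1 p2 tb hp1 pp; exists p1, b, p2.
rewrite cat_rcons in pp *; move: (pp); rewrite cat_path /= => /and3P[p1p p1b bp].
split=> //.
  have := mem_last 0 p1; rewrite inE => /predU1P[->//|lp1].
  by rewrite leNgt; apply/negP => tl; move/hasPn: hp1 => /(_ _ lp1); rewrite (ltW tl).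
move=> x; rewrite mem_cat inE => /or3P[xp1 _|/eqP ->|xp2].
- by apply: le_last_path => //; rewrite inE xp1 orbT.
- by rewrite ltNge tb.
move=> xt; have : b < x by move/(order_path_min lt_trans)/allP : bp => /(_ x xp2).
by move=> bx; have := lt_trans xt (le_lt_trans tb bx); rewrite ltxx.
Qed.

Hypothesis nalpha : n.+1%:R * alpha <= 1.

(** The ratio [x = d / l] lies in [[0, 1]], and there [x <= x^(j alpha)] because [j alpha <= 1]. *)
Local Lemma linear_powR_le d l j : 0 <= d -> d <= l -> 0 < l -> (j <= n.+1)%N ->
  d / l * v l ^+ j <= v d ^+ j.
Proof.
move=> d0 dl l0 jn; have x0 : 0 <= d / l by rewrite divr_ge0// ltW.
have x1 : d / l <= 1 by rewrite ler_pdivrMr// mul1r.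
have -> : v d = v (d / l) * v l.
  by rewrite /v -powRM// ?divfK ?gt_eqF// ltW.
rewrite exprMn ler_wpM2r ?exprn_ge0 ?v_ge0//.
rewrite /v -powR_mulnr//; have [->|xn0] := eqVneq (d / l) 0.
  exact: powR_ge0.
rewrite -[leLHS]powRr1//; apply: ger_powR; first by rewrite x1 lt_neqAle eq_sym xn0 x0.
apply: le_trans nalpha; rewrite mulrC.
by apply: ler_wpM2r; [exact: ltW|rewrite ler_nat].
Qed.

Local Lemma Zt_supp w k : 0 <= w <= T -> k \in msupp (Zt w) -> (fsize k <= n)%N.
Proof.
move=> w01; have [p1 [b [p2 [E aw wb _]]]] := piece_ex w01.
have [a0 ab bT _] := pi_split E; rewrite (Zt_piece_le E aw wb).
by have [Ys _ _] := HC a0 ab bT; move=> /Ys/andP[].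
Qed.

Local Lemma remainder_eq (Y Y' : R -> H) h s t :
  Y s = Y' s -> Y t = Y' t -> remainder X Y h s t = remainder X Y' h s t.
Proof. by move=> Es Et; rewrite /remainder Es Et. Qed.

Local Lemma Zt_local p1 b p2 s t h : pi = p1 ++ b :: p2 -> (fsize h <= n)%N ->
    last 0 p1 <= s -> s <= t -> t <= b ->
  `|remainder X Zt h s t| <= C * v (t - s) ^+ (n.+1 - fsize h).
Proof.
move=> E hn as_ st tb; have [a0 ab bT _] := pi_split E.
have [_ _ /(_ h hn s t as_ st tb) B] := HC a0 ab bT.
rewrite (remainder_eq h (Zt_piece_le E as_ (le_trans st tb)) (Zt_piece_le E (le_trans as_ st) tb)).
apply: le_trans B _; rewrite -mulrA ler_wpM2l//; apply: linear_powR_le.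
- by rewrite subr_ge0.
- by rewrite lerB.
- by rewrite subr_gt0.
- exact: leq_subr.
Qed.

Local Lemma X_id s f : 0 <= s <= T -> X s s f = (f == fone A)%:R.
Proof. by move=> s01; apply: character_id; [exact: X1|exact: chen]. Qed.

Local Lemma remainder_id (Y : R -> H) h s : 0 <= s <= T -> remainder X Y h s s = 0.
Proof.
move=> s01; rewrite /remainder; apply/eqP; rewrite subr_eq0; apply/eqP.
apply: eq_fpair => k _; rewrite -[LHS]mul1r -(X1 s01 s01).
rewrite -(cop_fone_fst (fun w => X s s w.1 * delta R h w.2)) big_mkcond.
apply: eq_bigr => u _; rewrite X_id//.
by case: (u.1 =P _) => _; rewrite ?mul0r.
Qed.

Definition glue_const : R := \sum_(k <- forests A n) (size (cop k))%:R * CX.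

Lemma glue_const_ge0 : 0 <= glue_const.
Proof. by apply: sumr_ge0 => k _; rewrite mulr_ge0. Qed.

(** Unitriangularity removes the [k] smaller than [h]; for the others the powers of [v d] match, as
    [(|k| - |h|) + (N - |k|) = N - |h|]. *)
Local Lemma glue_bound d s t h (F : forest A -> R) (c : R) : 0 <= s <= T -> 0 <= t <= T ->
    `|t - s| <= d -> 0 <= c -> (fsize h <= n)%N ->
    (forall k, (fsize k <= n)%N -> `|F k| <= c * v d ^+ (n.+1 - fsize k)) ->
  `|\sum_(k <- forests A n) star (X s t) (delta R h) k * F k| <=
    glue_const * c * v d ^+ (n.+1 - fsize h).
Proof.
move=> s01 t01 std c0 hn Fc; apply: le_trans (ler_norm_sum _ _ _) _.
rewrite /glue_const !mulr_suml !big_seq; apply: ler_sum => k; rewrite mem_forests => kn.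
have vd0 := v_ge0 d; rewrite normrM.
have [hk|kh] := leqP (fsize h) (fsize k); last first.
  by rewrite star_delta_lt// normr0 mul0r !mulr_ge0 ?exprn_ge0.
have Xd : forall f, (fsize f <= fsize k)%N -> `|X s t f| <= CX * v d ^+ fsize f.
  move=> f fk; apply: le_trans (XB s01 t01 (leq_trans fk kn)) _.
  by rewrite ler_wpM2l// lerXn2r ?nnegrE// v_le.
have B := star_delta_bound h CX0 vd0 Xd.
apply: le_trans (ler_pM (normr_ge0 _) (normr_ge0 _) B (Fc k kn)) _.
have -> : (n.+1 - fsize h = (fsize k - fsize h) + (n.+1 - fsize k))%N.
  by rewrite addnBAC// subnKC// ltnW// ltnS.
by rewrite exprD mulrACA -!mulrA.
Qed.

Local Lemma chain_bound (Y : R -> H) d s u t (c1 c2 : R) :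
    (forall w k, 0 <= w <= T -> k \in msupp (Y w) -> (fsize k <= n)%N) ->
    0 <= s <= T -> 0 <= u <= T -> 0 <= t <= T -> `|t - u| <= d -> 0 <= c1 ->
    (forall h, (fsize h <= n)%N -> `|remainder X Y h s u| <= c1 * v d ^+ (n.+1 - fsize h)) ->
    (forall h, (fsize h <= n)%N -> `|remainder X Y h u t| <= c2 * v d ^+ (n.+1 - fsize h)) ->
  forall h, (fsize h <= n)%N ->
    `|remainder X Y h s t| <= (c2 + glue_const * c1) * v d ^+ (n.+1 - fsize h).
Proof.
move=> Yn s01 u01 t01 utd c10 B1 B2 h hn.
rewrite (remainder_chen _ (fun k => @Yn s k s01) (fun k => @Yn u k u01) (chen s01 u01 t01)).
apply: le_trans (ler_normD _ _) _; rewrite mulrDl; apply: lerD; first exact: B2.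
exact: glue_bound.
Qed.

Local Lemma v_pow_le d d' j : 0 <= d -> d <= d' -> v d ^+ j <= v d' ^+ j.
Proof. by move=> d0 dd'; rewrite lerXn2r ?nnegrE ?v_ge0// v_le. Qed.

(** Two uses of [chain_bound], along [s, b, a] and then [s, a, t]: the outer stretches lie in single
    pieces and have constant [C], the middle one has constant [CZ]. *)
Definition forward_const : R := C + glue_const * (CZ + glue_const * C).

Lemma forward_const_ge : C <= forward_const.
Proof. by rewrite lerDl !(mulr_ge0, addr_ge0)// glue_const_ge0. Qed.

(** When [s] and [t] are in different pieces, let [b] be the first dissection point from [s] on and
    [a] the last one before [t]. However many pieces lie between [b] and [a], that stretch costs a
    single remainder of Z. *)
Local Lemma Zt_forward s t h : 0 <= s -> s <= t -> t <= T -> (fsize h <= n)%N ->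
  `|remainder X Zt h s t| <= forward_const * v (t - s) ^+ (n.+1 - fsize h).
Proof.
move=> s0 st tT hn.
have s01 : 0 <= s <= T by rewrite s0 (le_trans st tT).
have t01 : 0 <= t <= T by rewrite (le_trans s0 st) tT.
have [p1 [b [p2 [E as_ sb _]]]] := piece_ex s01.
have [tb|bt] := leP t b.
  apply: le_trans (Zt_local E hn as_ st tb) _.
  by rewrite ler_wpM2r ?exprn_ge0 ?v_ge0// forward_const_ge.
have [q1 [b' [q2 [E' at_ tb' before]]]] := piece_ex t01.
have bpi : b \in pi by rewrite E mem_cat mem_head orbT.
have ba := before b bpi bt; set a := last 0 q1 in at_ ba before.
have api : a \in 0 :: pi.
  by have := mem_last 0 q1; rewrite E' !inE mem_cat => /orP[->|->]; rewrite ?orbT.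
have b01 : 0 <= b <= T by rewrite (le_trans s0 sb) (le_trans (ltW bt) tT).
have a01 : 0 <= a <= T by rewrite (le_trans s0 (le_trans sb ba)) (le_trans at_ tT).
have d0 : 0 <= t - s by rewrite subr_ge0.
have g0 := glue_const_ge0.
have Bsa h' : (fsize h' <= n)%N ->
    `|remainder X Zt h' s a| <= (CZ + glue_const * C) * v (t - s) ^+ (n.+1 - fsize h').
  apply: (chain_bound Zt_supp s01 b01 a01) => // [|h'' hn''|h'' hn''].
  - by rewrite ger0_norm ?subr_ge0// lerB.
  - apply: le_trans (Zt_local E hn'' as_ sb (lexx b)) _; rewrite ler_wpM2l//.
    by apply: v_pow_le; rewrite ?subr_ge0// lerB// ltW.
  (* A remainder depends only on the values of the path at its two times, where the interpolation
     and Z agree. *)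
  rewrite (remainder_eq h'' (Zt_point _) (Zt_point api)); last by rewrite inE bpi orbT.
  have [<-|nba] := eqVneq b a.
    by rewrite remainder_id// normr0 mulr_ge0// exprn_ge0// v_ge0.
  apply: le_trans (ZB b01 a01 nba hn'') _; rewrite ler_wpM2l//.
  by rewrite ger0_norm ?subr_ge0//; apply: v_pow_le; rewrite ?subr_ge0// lerB.
apply: (chain_bound Zt_supp s01 a01 t01 _ _ Bsa) => // [||h' hn'].
- by rewrite ger0_norm ?subr_ge0// lerB// (le_trans sb).
- by rewrite !(addr_ge0, mulr_ge0).
apply: le_trans (Zt_local E' hn' (lexx _) at_ tb') _; rewrite ler_wpM2l//.
by apply: v_pow_le; rewrite ?subr_ge0// lerB// (le_trans sb).
Qed.

Definition dist_const : R := CZ + (forward_const + glue_const * forward_const).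

Lemma dist_const_ge0 : 0 <= dist_const.
Proof.
by have := glue_const_ge0; have := le_trans C0 forward_const_ge; move=> f0 g0;
  rewrite !(addr_ge0, mulr_ge0).
Qed.

Local Lemma Zt_bound s t h : 0 <= s <= T -> 0 <= t <= T -> (fsize h <= n)%N ->
  `|remainder X Zt h s t| <= (forward_const + glue_const * forward_const) *
    v `|t - s| ^+ (n.+1 - fsize h).
Proof.
move=> s01 t01 hn; have [s0 sT] := andP s01; have [t0 tT] := andP t01.
have g0 := glue_const_ge0; have f0 := le_trans C0 forward_const_ge.
have [st|ts] := leP s t.
  apply: le_trans (Zt_forward s0 st tT hn) _; rewrite ger0_norm ?subr_ge0//.
  by rewrite ler_wpM2r ?exprn_ge0 ?v_ge0// lerDl mulr_ge0.
(* Going from [t] to [s] and back has remainder 0, which expresses the backward remainder by forward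
   ones. *)
have := remainder_chen h (fun k => @Zt_supp t k t01) (fun k => @Zt_supp s k s01) (chen t01 s01 t01).
rewrite remainder_id// => /esym/eqP; rewrite addr_eq0 => /eqP ->; rewrite normrN mulrDl.
apply: le_trans (_ : _ <= glue_const * forward_const * v `|t - s| ^+ (n.+1 - fsize h)) _.
  have ds : `|t - s| = s - t by rewrite distrC ger0_norm// subr_ge0 ltW.
  rewrite ds; apply: glue_bound => // [|k kn]; first by rewrite ds.
  exact: (Zt_forward t0 (ltW ts) sT kn).
by rewrite lerDr mulr_ge0// exprn_ge0// v_ge0.
Qed.

Local Lemma dist_holder s t h : 0 <= s <= T -> 0 <= t <= T -> s != t -> (fsize h <= n)%N ->
  `|remainder X Z h s t - remainder X Zt h s t| <=
    dist_const * v `|t - s| ^+ (n.+1 - fsize h).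
Proof.
move=> s01 t01 st hn; apply: le_trans (ler_normB _ _) _; rewrite mulrDl.
by apply: lerD; [exact: ZB|exact: Zt_bound].
Qed.

(** Both paths agree at the dissection point [a] before [t], so their difference at [t] is the
    difference of their remainders over [[a, t]], an interval no longer than the mesh. *)
Local Lemma pointwise_dist t k : 0 <= t <= T -> (fsize k <= n)%N ->
  `|mcoeff k (Z t) - mcoeff k (Zt t)| <= dist_const * v (mesh 0 pi) ^+ (n.+1 - fsize k).
Proof.
move=> t01 kn; have [p1 [b [p2 [E at_ tb _]]]] := piece_ex t01.
have [a0 ab bT meshb] := pi_split E; set a := last 0 p1 in at_ a0 ab meshb.
have api : a \in 0 :: pi.
  by have := mem_last 0 p1; rewrite E !inE mem_cat => /orP[->|->]; rewrite ?orbT.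
have c0 := dist_const_ge0.
move: at_; rewrite le_eqVlt => /predU1P[<-|at_].
  by rewrite (Zt_point api) subrr normr0 mulr_ge0// exprn_ge0// v_ge0.
have a01 : 0 <= a <= T by rewrite a0 (le_trans (ltW ab) bT).
have := dist_holder a01 t01 _ kn; rewrite (lt_eqF at_) => /(_ isT).
rewrite /remainder (Zt_point api) !fpair_delta opprB addrA subrK.
have -> : `|t - a| = t - a by rewrite ger0_norm// subr_ge0 ltW.
move=> B; apply: le_trans B _; rewrite ler_wpM2l//.
apply: v_pow_le; first by rewrite subr_ge0 ltW.
by apply: le_trans meshb; rewrite lerB.
Qed.

(** One factor [v (mesh 0 pi)] is kept and the remaining powers are bounded by [v T]; the two
    summands 1 and [glue_const] belong to the times [t] and [s]. *)
Definition small_const h : R := (1 + glue_const) * dist_const * v T ^+ (n - fsize h).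

Lemma small_const_ge0 h : 0 <= small_const h.
Proof.
by rewrite !mulr_ge0 ?exprn_ge0 ?v_ge0 ?dist_const_ge0// addr_ge0 ?glue_const_ge0.
Qed.

Local Lemma mesh_le_T : mesh 0 pi <= T.
Proof.
apply: le_mesh => [|I Ipi]; first exact: ltW.
have [p0 /eqP lT] := pi0T.
suff : forall a p, 0 <= a -> path <%R a p -> last a p <= T -> fine T a p.
  by move=> /(_ 0 pi (lexx 0) p0); rewrite lT lexx => /(_ isT I Ipi).
move=> a p; elim: p a => [//|x p IHp] a a0 /= /andP[ax xp] xT J.
rewrite /pieces /= inE => /orP[/eqP -> /=|]; last first.
  by apply: IHp => //; rewrite (le_trans a0)// ltW.
rewrite lerBlDr (le_trans (le_last_path xp (mem_head _ _)))// (le_trans xT)//.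
by rewrite lerDl.
Qed.

Local Lemma dist_small s t h : 0 <= s <= T -> 0 <= t <= T -> (fsize h <= n)%N ->
  `|remainder X Z h s t - remainder X Zt h s t| <= small_const h * v (mesh 0 pi).
Proof.
move=> s01 t01 hn; have vT0 : 0 < v T by exact: powR_gt0.
have c0 := dist_const_ge0; have m0 := mesh_ge0 0 pi; have g0 := glue_const_ge0.
(* Chosen so that [c * v T ^+ (n.+1 - fsize k)] retains one factor [v (mesh 0 pi)] for every [k],
   the form required by [glue_bound] with [d = T]. *)
pose c := dist_const * v (mesh 0 pi) / v T.
have cc0 : 0 <= c by rewrite !mulr_ge0 ?v_ge0// invr_ge0 ltW.
have F r k : 0 <= r <= T -> (fsize k <= n)%N ->
    `|mcoeff k (Z r) - mcoeff k (Zt r)| <= c * v T ^+ (n.+1 - fsize k).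
  move=> r01 kn; apply: le_trans (pointwise_dist r01 kn) _.
  rewrite subSn// !exprS /c mulrA.
  have -> : dist_const * v (mesh 0 pi) / v T * (v T * v T ^+ (n - fsize k)) =
    dist_const * v (mesh 0 pi) * v T ^+ (n - fsize k) by field; rewrite gt_eqF.
  by rewrite ler_wpM2l ?mulr_ge0 ?v_ge0// v_pow_le// mesh_le_T.
have -> : remainder X Z h s t - remainder X Zt h s t =
    (mcoeff h (Z t) - mcoeff h (Zt t)) - \sum_(k <- forests A n)
      star (X s t) (delta R h) k * (mcoeff k (Z s) - mcoeff k (Zt s)).
  rewrite /remainder !fpair_delta (fpair_forests _ (fun k => @Zn s k s01)).
  rewrite (fpair_forests _ (fun k => @Zt_supp s k s01)).
  under [in RHS]eq_bigr do rewrite mulrBr mulrC [X in _ - X]mulrC.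
  by rewrite sumrB; ring.
apply: le_trans (ler_normB _ _) _.
apply: (@le_trans _ _ (c * v T ^+ (n.+1 - fsize h) + glue_const * c * v T ^+ (n.+1 - fsize h))).
  apply: lerD; first exact: F.
  apply: glue_bound => // [|k kn]; last exact: F.
  have [s0 sT] := andP s01; have [t0 tT] := andP t01.
  rewrite ler_norml; apply/andP; split; last by rewrite lerBlDr (le_trans tT)// lerDl.
  by rewrite lerNl opprB lerBlDr (le_trans sT)// lerDl.
rewrite subSn// exprS /c /small_const le_eqVlt; apply/orP; left; apply/eqP.
by field; rewrite gt_eqF.
Qed.

Variable beta : R.
Hypothesis beta0 : 0 < beta.
Hypothesis beta_alpha : beta < alpha.

(** The minimum of [x] and [q] is at most any weighted geometric mean of them. *)
Local Lemma geometric_mean_le (x q D K lam : R) : 0 < lam -> lam < 1 -> 0 <= x -> 0 <= q ->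
  0 <= K -> D <= K * x -> D <= K * q -> D <= K * (x `^ lam * q `^ (1 - lam)).
Proof.
move=> l0 l1 x0 q0 K0 Dx Dq.
have split y : 0 <= y -> y = y `^ lam * y `^ (1 - lam).
  move=> y0; rewrite -powRD ?subrKC ?powRr1//.
  by rewrite oner_eq0.
have l1' : 0 <= 1 - lam by rewrite subr_ge0 ltW.
have [xq|qx] := leP x q.
  apply: le_trans Dx _; rewrite ler_wpM2l// {1}(split x x0).
  by rewrite ler_wpM2l ?powR_ge0// powR_le.
apply: le_trans Dq _; rewrite ler_wpM2l// {1}(split q q0).
by rewrite ler_wpM2r ?powR_ge0// powR_le// ltW.
Qed.

Local Lemma holder_dist h : (fsize h <= n)%N ->
  (holder T ((n.+1 - fsize h)%N%:R * beta)%R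
     (fun s t => remainder X Z h s t - remainder X Zt h s t)%R <=
   ((dist_const + small_const h) * mesh 0 pi `^ (alpha - beta))%:E)%E.
Proof.
move=> hn; apply: ge_ereal_sup => _ [s [t [s01 t01 st ->]]].
have c0 := dist_const_ge0; have k0 := small_const_ge0 h.
have m0 := mesh_ge0 0 pi.
have ts0 : 0 < `|t - s| by rewrite normr_gt0 subr_eq0 eq_sym.
rewrite lee_fin ler_pdivrMr ?powR_gt0//.
(* The weight [beta / alpha] lowers the Hoelder exponent from [alpha] to [beta] and leaves
   [alpha - beta] for the mesh. *)
have lam1 : beta / alpha < 1 by rewrite ltr_pdivrMr// mul1r.
have lam0 : 0 < beta / alpha by exact: divr_gt0.
pose x : R := v `|t - s| ^+ (n.+1 - fsize h).
have x0 : 0 <= x by rewrite exprn_ge0// v_ge0.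
have K0 : 0 <= dist_const + small_const h by rewrite addr_ge0.
have := @geometric_mean_le x (v (mesh 0 pi))
  `|remainder X Z h s t - remainder X Zt h s t| _ _ lam0 lam1 x0 (v_ge0 _) K0.
have -> : x `^ (beta / alpha) = `|t - s| `^ ((n.+1 - fsize h)%N%:R * beta).
  rewrite /x /v -powR_mulnr// -powRrM; congr (_ `^ _).
  by field; rewrite gt_eqF.
have -> : v (mesh 0 pi) `^ (1 - beta / alpha) = mesh 0 pi `^ (alpha - beta).
  by rewrite /v -powRrM; congr (_ `^ _); field; rewrite gt_eqF.
rewrite [_ `^ _ * _ `^ _]mulrC mulrA; apply.
  apply: le_trans (dist_holder s01 t01 st hn) _.
  by rewrite ler_wpM2r ?exprn_ge0 ?v_ge0// lerDl.
apply: le_trans (dist_small s01 t01 hn) _.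
by rewrite ler_wpM2r ?v_ge0// lerDr.
Qed.

Local Lemma holder_ge0 gamma F : (0 <= holder T gamma F)%E.
Proof.
apply: (@le_trans _ _ ((`|F 0 T| / `|T - 0| `^ gamma)%:E)).
  by rewrite lee_fin divr_ge0// powR_ge0.
by apply: ereal_sup_ubound; exists 0, T; rewrite !lexx (ltW T0) (lt_eqF T0).
Qed.

Definition total_const : R := \sum_(h <- forests A n) (dist_const + small_const h).

Lemma ctrl_dist_interpolation :
  (0 <= ctrl_dist T beta n.+1 X Z Zt <= (total_const * mesh 0 pi `^ (alpha - beta))%:E)%E.
Proof.
rewrite /ctrl_dist fsbig_finite; last exact: finite_forest.
apply/andP; split.
  by apply: sume_ge0 => h _; rewrite adde_ge0 ?lee_fin// holder_ge0.
rewrite /total_const mulr_suml -sumEFin; rewrite !big_seq.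
apply: lee_sum => h; rewrite mem_forests => hn.
have -> : Zt 0 = Z 0 by apply: Zt_point; exact: mem_head.
by rewrite subrr fpairE linear0 normr0 add0e holder_dist.
Qed.

End Global.

End LocalStep.

(** * Uniform constants and the limit of vanishing mesh *)

Theorem proposition3p8 (R : realType) (A : finType) (hA : (0 < #|A|)%N)
    (T : R) (hT : 0 < T)
    (P : set (malg (forest A) R)) (hP : primitive_basis P)
    (alpha : R) (h01 : 0 < alpha < 1)
    (hn : forall n : nat, alpha <> n%:R^-1)
    (N : nat) (hN : N = Num.truncn alpha^-1)
    (X : R -> R -> forest A -> R) (hX : rough_path T alpha X)
    (Z : R -> malg (forest A) R) (hZ : controlled_path T alpha N X Z)
    (beta : R) (hb : 0 < beta < alpha) :
  ctrl_dist T beta N X Z (interpolation P N X Z pi) @[pi --> mesh_to0 0 T]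
    --> 0%E.
Proof.
have [alpha0 alpha1] := andP h01; have [beta0 beta_alpha] := andP hb.
have ia0 : 0 <= alpha^-1 by rewrite invr_ge0 ltW.
have Na : N%:R * alpha <= 1.
  by rewrite hN -ler_pdivlMr// div1r truncn_le.
(* [N = 0] contradicts [alpha < 1]; from here on [n] stands for [N - 1]. *)
case: N hN Na hZ => [N0 _|n _ Na [Zn Zrem]].
  have : (0 < Num.truncn alpha^-1)%N by rewrite truncn_gt0 invf_ge1// ltW.
  by rewrite -N0.
have [Xmor chen XH] := hX.
have X1 s t : 0 <= s <= T -> 0 <= t <= T -> X s t (fone A) = 1.
  by move=> s0 t0; have [_] := Xmor s t s0 t0.
have Xid s f : 0 <= s <= T -> X s s f = (f == fone A)%:R.
  by move=> s0; apply: character_id; [exact: X1|exact: chen].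
have /choice[cX HcX] (h : forest A) := holder_bound (XH h).
(* The summand 1 covers equal times and the empty forest, a case that [holder] leaves out. *)
pose CX : R := 1 + \sum_(h <- forests A n) cX h.
have cX0 h : 0 <= cX h by have [] := HcX h.
have CX0 : 0 <= CX by rewrite addr_ge0// sumr_ge0.
have XB s t f : 0 <= s <= T -> 0 <= t <= T -> (fsize f <= n)%N ->
    `|X s t f| <= CX * (`|t - s| `^ alpha) ^+ fsize f.
  move=> s0 t0 fn; have [<-|st] := eqVneq s t.
    rewrite Xid// subrr normr0 powR0 ?gt_eqF//.
    have [->|f1] := eqVneq f (fone A); last by rewrite normr0 mulr_ge0// exprn_ge0.
    by rewrite fsize1 expr0 mulr1 normr1 lerDl sumr_ge0.
  have [_ /(_ s t s0 t0 st) B] := HcX f; apply: le_trans B _.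
  rewrite powR_mulnr// ler_wpM2r ?exprn_ge0 ?powR_ge0//.
  rewrite /CX (bigD1_seq f) ?forests_uniq ?mem_forests//= addrCA lerDl.
  by rewrite addr_ge0// sumr_ge0.
have /choice[cZ HcZ] (h : forest A) : exists c : R, 0 <= c /\ ((fsize h <= n)%N ->
    forall s t, 0 <= s <= T -> 0 <= t <= T -> s != t ->
    `|remainder X Z h s t| <= c * `|t - s| `^ ((n.+1 - fsize h)%N%:R * alpha)).
  have [hn'|hn'] := leqP (fsize h) n; last by exists 0.
  by have [c [c0 cB]] := holder_bound (Zrem h hn'); exists c.
have cZ0 h : 0 <= cZ h by have [] := HcZ h.
pose CZ : R := \sum_(h <- forests A n) cZ h.
have CZ0 : 0 <= CZ by rewrite sumr_ge0.
have ZB s t h : 0 <= s <= T -> 0 <= t <= T -> s != t -> (fsize h <= n)%N ->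
    `|remainder X Z h s t| <= CZ * (`|t - s| `^ alpha) ^+ (n.+1 - fsize h).
  move=> s0 t0 st hn'; have [_ /(_ hn' s t s0 t0 st) B] := HcZ h; apply: le_trans B _.
  rewrite mulrC [_%:R * _]mulrC powR_mulnr// mulrC.
  rewrite ler_wpM2r ?exprn_ge0 ?powR_ge0//.
  by rewrite /CZ (bigD1_seq h) ?forests_uniq ?mem_forests//= lerDl sumr_ge0.
have [C C0] := @interp_upto_on R A P hP T alpha n X Z CX CZ alpha0 X1 chen
  CX0 XB CZ0 ZB Zn n (leqnn n).
rewrite subnn => HC.
have bound := @ctrl_dist_interpolation R A P T alpha n X Z CX CZ alpha0 X1 chen
  CX0 XB CZ0 ZB Zn C C0 HC hT _ _ Na beta beta0 beta_alpha.
set K := total_const _ _ _ _ _ _ _ in bound.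
have PF : ProperFilter (mesh_to0 0 T) by apply: mesh_to0_proper; exact: ltW.
apply: (@squeeze_cvge _ _ _ _ (cst 0%E) _
  (fun pi => (K * mesh 0 pi `^ (alpha - beta))%:E)).
- by exists 1 => // p pp _; exact: bound.
- exact: cvg_cst.
apply: cvg_EFin; first by exists 1.
apply/cvgrPdist_le => eps eps0.
have ab0 : 0 < alpha - beta by rewrite subr_gt0.
have K1 : 0 < `|K| + 1 by rewrite ltr_wpDl.
have [d d0 de] := powR_small ab0 (divr_gt0 eps0 K1).
exists d => // p pp pd; rewrite sub0r normrN normrM (ger0_norm (powR_ge0 _ _)).
apply: (@le_trans _ _ ((`|K| + 1) * (eps / (`|K| + 1)))); last first.
  by rewrite mulrC divfK// gt_eqF.
apply: ler_pM; rewrite ?powR_ge0 ?lerDl//.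
apply: le_trans de; apply: powR_le; [exact: ltW|exact: mesh_ge0|exact: ltW].
Qed.
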